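(* The upper bound $\Lambda_q$ for $M_q$ is asymptotically sharp as $q\to\infty$, i.e. $\lim_{q\to\infty} \Lambda_q/M_q = 1$, and, as $q\to\infty$, $$M_q \sim \sqrt{\frac{6}{\pi q}},$$ i.e. $\lim_{q\to\infty} M_q\,\sqrt{\pi q/6} = 1$.
   Context: The Fourier transform is $\widehat f(\xi) = \int_{\mathbb{R}} f(x)e^{-2\pi i x\xi}\, dx$ (extended to $L^2(\mathbb{R})$ as usual). The Paley--Wiener space is $PW^2 := \{f\in L^2(\mathbb{R}): \operatorname{supp}\widehat f\subset[-1/2,1/2]\}$ (complex-valued functions). For real $q>2$, $M_q := \sup_{f\in PW^2,\ \|f\|_2=1}\int_{\mathbb{R}}|f(x)|^q\,dx$. For $s>0$, $\lambda(s):=\sup_{f\in PW^2,\ \lVert f\rVert_2=1} \int_{-s/2}^{s/2}|f(x)|^2\, dx$. The function $\lambda$ is non-decreasing, and it is well known that it is real-analytic on $(0,\infty)$; $\lambda'$ denotes its derivative (so $\lambda'\ge 0$). For $q>2$, $\Lambda_q := \int_0^{\infty} (\lambda'(x))^{q/2}\,dx$. *)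

(* Defs.v *)
From HB Require Import structures.
From mathcomp Require Import all_boot all_order all_algebra.
From mathcomp Require Import complex.
From mathcomp Require Import all_classical all_reals all_analysis.

Set Implicit Arguments.
Unset Strict Implicit.
Unset Printing Implicit Defensive.

Import Order.TTheory GRing.Theory Num.Theory.
Import numFieldNormedType.Exports.

Local Open Scope classical_set_scope.
Local Open Scope ring_scope.
Local Open Scope complex_scope.

Section PaleyWiener.
Context {R : realType}.
Implicit Types (f g : R -> R[i]) (q s : R).
Local Notation mu := (@lebesgue_measure R).

Definition cmeasurable f : Prop :=
  measurable_fun setT (fun x => complex.Re (f x)) /\
  measurable_fun setT (fun x => complex.Im (f x)).

Definition cLnorm (p : \bar R) f : \bar R :=
  Lnorm mu p (fun x => (Normc.normc (f x))%:E).

Definition cLfun (p : \bar R) : set (R -> R[i]) :=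
  [set f | cmeasurable f /\ (cLnorm p f < +oo)%E].

Definition cexpi (t : R) : R[i] := cos t +i* sin t.

Definition cintegral f : R[i] :=
  (\int[mu]_x complex.Re (f x)) +i* (\int[mu]_x complex.Im (f x)).

(* The integral formula; meaningful for [f] in L^1. *)
Definition fourier1 f (xi : R) : R[i] :=
  cintegral (fun x => f x * cexpi (- (2 * pi * x * xi))).

Definition cvg_L2 (u : nat -> R -> R[i]) f : Prop :=
  cLnorm 2%:E (fun x => u n x - f x) @[n --> \oo] --> 0%E.

(* [g] is a representative of the Fourier transform of [f] in L^2, i.e. of the
   continuous extension to L^2 of [fourier1] on L^1 `&` L^2; it is determined
   by [f] up to almost everywhere equality. *)
Definition is_fourier2 f g : Prop :=
  [/\ cLfun 2%:E f, cLfun 2%:E g &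
    exists u : nat -> R -> R[i],
      [/\ forall n, (cLfun 1%:E `&` cLfun 2%:E) (u n),
          cvg_L2 u f & cvg_L2 (fun n => fourier1 (u n)) g]].

(* The support of a class modulo almost everywhere equality: the complement of
   the largest open set on which [g] vanishes almost everywhere. *)
Definition ess_supp g : set R :=
  [set x | forall U : set R, open U -> U x ->
    ~ mu.-negligible (U `&` [set y | g y != 0])].

Definition PW2 : set (R -> R[i]) :=
  [set f | cLfun 2%:E f /\
    exists g, is_fourier2 f g /\ ess_supp g `<=` `[- 2^-1, 2^-1]].

Definition PW2_sphere : set (R -> R[i]) :=
  [set f | PW2 f /\ cLnorm 2%:E f = 1%E].

Definition M_ q : \bar R :=
  ereal_sup [set (\int[mu]_x (Normc.normc (f x) `^ q)%:E)%E | f in PW2_sphere].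

(* The supremum lies in [0, 1], so [fine] loses nothing. *)
Definition lambda s : R :=
  fine (ereal_sup
    [set (\int[mu]_(x in `[(- (s / 2))%R, (s / 2)%R])
            (Normc.normc (f x) ^+ 2)%:E)%E | f in PW2_sphere]).

Definition Lambda_ q : \bar R :=
  (\int[mu]_(x in `]0%R, +oo[) (derive1 lambda x `^ (q / 2))%:E)%E.

End PaleyWiener.

(* Main.v *)
(* Write sinc x = sin (pi x) / (pi x).  Let f be a unit vector of PW^2 with transform g, and
   e_x (t) = exp (- 2 i pi t x) on [-1/2, 1/2], so that f(x) = <g, e_x> almost everywhere.
   Bessel's inequality for g and the vectors e_x, e_y, whose scalar product is sinc (x - y), gives
     |f(x)|^2 + |f(y)|^2 <= 1 + |sinc (x - y)| = 2 u(x - y).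
   - Taking y = - x, lambda (t) - lambda (s) <= (t - s) sup u over [s, t]; hence lambda is
     1-Lipschitz, has a density h with h = lambda' almost everywhere, and lambda' <= u.
   - The set {|f|^2 > t} has diameter at most the length of {u > t} on the half-line, so by
     the layer cake formula the part of M_q coming from large values of |f|^2 is at most the
     integral of u^(q/2) near 0.
   As u(s) = 1 - pi^2 s^2 / 12 + O(s^4) and u is bounded away from 1 away from 0, both M_q and
   Lambda_q are at most (1 + o(1)) times the integral of exp (- pi^2 q s^2 / 24) over s > 0, which is
   sqrt (6 / (pi q)).  For the lower bounds, f = sinc gives M_q >= integral of |sinc|^q, while
   lambda (s) >= s - pi^2 s^3 / 36 (f = sinc again) together with lambda' <= u forces lambda' to be
   close to u in the mean on [0, K / sqrt q], which is enough to bound Lambda_q from below. *)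
Require Import Defs.
From HB Require Import structures.
From mathcomp Require Import all_boot all_order all_algebra.
From mathcomp Require Import complex.
From mathcomp Require Import all_classical all_reals all_analysis.
From mathcomp Require Import measurable_realfun.
From mathcomp Require Import ring lra.
Set Implicit Arguments.
Unset Strict Implicit.
Unset Printing Implicit Defensive.
Import Order.TTheory GRing.Theory Num.Theory.
Import numFieldNormedType.Exports.
Local Open Scope classical_set_scope.
Local Open Scope ring_scope.

(** * Integrable and square-integrable functions of a real variable *)

Section Basics.
Context {R : realType}.
Local Notation mu := (@lebesgue_measure R).
Implicit Types f g a b u : R -> R.

(** Bessel's inequality needs f(x) as a scalar product for almost every x, but the transform of f is
    only given as an L^2 limit of transforms of integrable functions. Two facts are proved for
    integrable functions and are stable under such limits: an inequality between the norms and the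
    multiplication formula. Inversion then follows by duality, pairing f with indicators of
    intervals. The transforms of these indicators are not integrable, hence the damping by exp (-
    |t| / (n + 1)), which on the other side is averaging against Poisson kernels. The lower bound
    for Lambda_q rests on a coincidence of third order: the integral of u over [0, s] and the lower
    bound of lambda (s) given by sinc both begin with s - pi^2 s^3 / 36. They differ by O(s^5), and
    passing to powers p = q / 2 costs a factor p. At s = K / sqrt q the loss is O(q^(-3/2)) against
    a main term of order q^(-1/2). *)

Definition intg f := mu.-integrable setT (EFin \o f).
Definition sqintg f := measurable_fun setT f /\ intg (fun x => f x ^+ 2).

Lemma intg_measurable f : intg f -> measurable_fun setT f.
Proof. by move=> /integrableP[/measurable_EFinP]. Qed.

Lemma eq_intg f g : f =1 g -> intg f -> intg g.
Proof. by move=> /funext ->. Qed.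

Lemma le_intg f g : measurable_fun setT f -> (forall x, `|f x| <= `|g x|) -> intg g -> intg f.
Proof.
move=> mf fg ig; apply: le_integrable ig => //; first exact/measurable_EFinP.
by move=> x _; rewrite /= lee_fin.
Qed.

Lemma intgD f g : intg f -> intg g -> intg (fun x => f x + g x).
Proof. by move=> i1 i2; have := integrableD measurableT i1 i2. Qed.

Lemma intgB f g : intg f -> intg g -> intg (fun x => f x - g x).
Proof. by move=> i1 i2; have := integrableB measurableT i1 i2. Qed.

Lemma intgZ k f : intg f -> intg (fun x => k * f x).
Proof. by move=> i1; have := integrableZl measurableT k i1. Qed.

Lemma intg_norm f : intg f -> intg (fun x => `|f x|).
Proof. exact: integrable_norm. Qed.

Lemma intg_bounded f g (M : R) : measurable_fun setT g -> (forall x, `|g x| <= M) ->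
  intg f -> intg (fun x => f x * g x).
Proof.
move=> mg gM fi; apply: (le_intg (g := fun x => M * f x)).
- by apply: measurable_funM => //; exact: intg_measurable.
- move=> x; rewrite !normrM mulrC ler_wpM2r//.
  by rewrite (le_trans (gM x))// ler_norm.
- exact: intgZ.
Qed.

Lemma sqintgM f g : sqintg f -> sqintg g -> intg (fun x => f x * g x).
Proof.
move=> [mf f2] [mg g2].
apply: (le_intg (g := fun x => f x ^+ 2 + g x ^+ 2)) (intgD f2 g2).
  exact: measurable_funM.
move=> x; rewrite normrM [leRHS]ger0_norm ?addr_ge0 ?sqr_ge0//.
rewrite -[f x ^+ 2]real_normK ?num_real// -[g x ^+ 2]real_normK ?num_real//.
nra.
Qed.

Lemma sqintgD f g : sqintg f -> sqintg g -> sqintg (fun x => f x + g x).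
Proof.
move=> sf sg; have fg := sqintgM sf sg; case: sf sg => mf f2 [mg g2].
split; first exact: measurable_funD.
apply: eq_intg (intgD (intgD f2 g2) (intgZ 2 fg)) => x; ring.
Qed.

Lemma sqintgZ k f : sqintg f -> sqintg (fun x => k * f x).
Proof.
move=> [mf f2]; split; first by apply: measurable_funM.
by apply: eq_intg (intgZ (k ^+ 2) f2) => x; ring.
Qed.

Lemma sqintgB f g : sqintg f -> sqintg g -> sqintg (fun x => f x - g x).
Proof.
move=> sf sg; have [m1 i1] := sqintgD sf (sqintgZ (-1) sg); split.
  by case: sf sg => mf f2 [mg g2]; exact: measurable_funB.
by apply: eq_intg i1 => x; ring.
Qed.

Lemma measurable_sqr f : measurable_fun setT f -> measurable_fun setT (fun x => f x ^+ 2).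
Proof. by move=> mf; exact: measurable_funX. Qed.

Lemma intg_lty f : measurable_fun setT f -> (forall x, 0 <= f x) ->
  (\int[mu]_x (f x)%:E < +oo)%E -> intg f.
Proof.
move=> mf f0 fy; apply/integrableP; split; first exact/measurable_EFinP.
by under eq_integral do rewrite /= ger0_norm//.
Qed.

Lemma intg_int_lty f : intg f -> (\int[mu]_x (f x)%:E < +oo)%E.
Proof. by move=> fi; apply: integrable_lty. Qed.

Lemma EFin_Rint f : intg f -> (\int[mu]_x f x)%:E = (\int[mu]_x (f x)%:E)%E.
Proof. by move=> fi; rewrite /Rintegral fineK//; exact: integrable_fin_num. Qed.

Lemma RintD f g : intg f -> intg g ->
  \int[mu]_x (f x + g x) = \int[mu]_x f x + \int[mu]_x g x.
Proof. by move=> fi gi; rewrite RintegralD. Qed.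

Lemma RintB f g : intg f -> intg g ->
  \int[mu]_x (f x - g x) = \int[mu]_x f x - \int[mu]_x g x.
Proof. by move=> fi gi; rewrite RintegralB. Qed.

Lemma RintZ k f : intg f -> \int[mu]_x (k * f x) = k * \int[mu]_x f x.
Proof. by move=> fi; rewrite RintegralZl. Qed.

Lemma le_Rint f g : intg f -> intg g -> (forall x, f x <= g x) ->
  \int[mu]_x f x <= \int[mu]_x g x.
Proof. by move=> fi gi fg; apply: le_Rintegral. Qed.

Lemma le_norm_Rint f : intg f -> `|\int[mu]_x f x| <= \int[mu]_x `|f x|.
Proof. by move=> fi; apply: le_normr_Rintegral. Qed.

Lemma eq_Rint f g : f =1 g -> \int[mu]_x f x = \int[mu]_x g x.
Proof. by move=> /funext ->. Qed.

Lemma Rint_bounded f g (M : R) : intg f -> measurable_fun setT g ->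
  (forall x, `|g x| <= M) -> `|\int[mu]_x (f x * g x)| <= M * \int[mu]_x `|f x|.
Proof.
move=> fi mg gM; have ig := intg_bounded mg gM fi.
rewrite (le_trans (le_norm_Rint ig))// -RintZ; last exact: intg_norm.
apply: le_Rint; [exact: intg_norm|by apply: intgZ; exact: intg_norm|].
by move=> x; rewrite normrM mulrC ler_wpM2r.
Qed.

Lemma continuous_kernel_int a (K : R -> R -> R) (M : R) :
  intg a -> (forall t, measurable_fun setT (K ^~ t)) ->
  (forall x, continuous (K x)) -> (forall x t, `|K x t| <= M) ->
  continuous (fun t => \int[mu]_x (a x * K x t)).
Proof.
move=> ia mK cK KM t.
have := @continuity_under_integral R _ _ mu (fun t x => a x * K x t) setT measurableT
  (t - 1) (t + 1) _ _ (fun x => M * `|a x|) _ _ t.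
apply.
- by move=> s _; exact: intg_bounded ia.
- apply: aeW => x _ s _.
  by apply: cvgM; [exact: cvg_cst|exact: cK].
- by apply: intgZ; exact: intg_norm.
- by move=> s _; apply: aeW => x _; rewrite normrM mulrC ler_wpM2r.
- by rewrite inE/= in_itv/=; lra.
Qed.

(** The integrand is at most M |a(x)| |b(y)|, which is integrable on the product. Every exchange of
    integrals of signed functions below has this shape. *)
Lemma Rint_Fubini a b (K : R -> R -> R) (M : R) :
  intg a -> intg b -> measurable_fun setT (fun z : R * R => K z.1 z.2) ->
  (forall x y, `|K x y| <= M) ->
  \int[mu]_x (a x * \int[mu]_y (b y * K x y)) = \int[mu]_y (b y * \int[mu]_x (a x * K x y)).
Proof.
move=> ia ib mK KM.
have mKx x : measurable_fun setT (K x).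
  by have h := measurableT_comp mK (pair1_measurable x); exact: h.
have mKy y : measurable_fun setT (K ^~ y).
  by have h := measurableT_comp mK (pair2_measurable y); exact: h.
pose F (z : R * R) := a z.1 * b z.2 * K z.1 z.2.
have mF : measurable_fun setT F.
  apply: measurable_funM => //; apply: measurable_funM.
    exact: (measurableT_comp (intg_measurable ia)).
  exact: (measurableT_comp (intg_measurable ib)).
have iF : (mu \x mu)%E.-integrable setT (EFin \o F).
  apply/integrable12ltyP; first exact/measurable_EFinP.
  apply: (@le_lt_trans _ _ (\int[mu]_x (`|a x| * (M * \int[mu]_y `|b y|))%:E)%E); last first.
    apply: intg_int_lty; apply: (eq_intg (f := fun x => (M * \int[mu]_y `|b y|) * `|a x|)).
      by move=> x; rewrite mulrC.
    by apply: intgZ; exact: intg_norm.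
  apply: ge0_le_integral => //.
  - by move=> x _; exact: integral_ge0.
  - have mAF : measurable_fun setT (abse \o (EFin \o F)).
      by apply: measurableT_comp => //; exact/measurable_EFinP.
    have h := @measurable_fun_fubini_tonelli_F _ _ _ _ R mu (abse \o (EFin \o F)) mAF (fun=> abse_ge0 _).
    exact: h.
  - apply/measurable_EFinP; apply: measurable_funM => //.
    by apply: intg_measurable; exact: intg_norm.
  - move=> x _.
    have ibx : intg (fun y => `|a x| * (M * `|b y|)).
      by apply: intgZ; apply: intgZ; exact: intg_norm.
    have -> : (`|a x| * (M * \int[mu]_y `|b y|))%:E = (\int[mu]_y (`|a x| * (M * `|b y|))%:E)%E.
      by rewrite -EFin_Rint// RintZ ?RintZ//; do ?apply: intgZ; exact: intg_norm.
    apply: ge0_le_integral => //=.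
    + apply/measurable_EFinP; apply: (measurableT_comp (@normr_measurable R setT)).
      by have h := measurableT_comp mF (pair1_measurable x); exact: h.
    + by apply/measurable_EFinP; exact: intg_measurable.
    + move=> y _; rewrite lee_fin /F/= !normrM -mulrA ler_wpM2l// mulrC ler_wpM2r//.
have := Fubini iF; rewrite /F/= => FE.
have E1 : (\int[mu]_x \int[mu]_y (a x * b y * K x y)%:E)%E =
          (\int[mu]_x (a x * \int[mu]_y (b y * K x y))%:E)%E.
  apply: eq_integral => x _; rewrite -RintZ; last exact: intg_bounded ib.
  rewrite EFin_Rint; last by apply: intgZ; exact: intg_bounded ib.
  by apply: eq_integral => y _; rewrite mulrA.
have E2 : (\int[mu]_y \int[mu]_x (a x * b y * K x y)%:E)%E =
          (\int[mu]_y (b y * \int[mu]_x (a x * K x y))%:E)%E.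
  apply: eq_integral => y _; rewrite -RintZ; last exact: intg_bounded ia.
  rewrite EFin_Rint; last by apply: intgZ; exact: intg_bounded ia.
  by apply: eq_integral => x _; rewrite mulrA [b y * _]mulrC.
by rewrite /Rintegral -E1 -E2 FE.
Qed.

End Basics.

(** * Continuity and the fundamental theorem of calculus *)

Section Calculus.
Context {R : realType}.
Local Notation mu := (@lebesgue_measure R).
Implicit Types (f g F : R -> R) (x a b : R).

Lemma continuous_fcst (c : R) : continuous (fun _ : R => c).
Proof. by move=> x; exact: cvg_cst. Qed.

Lemma continuous_fid : continuous (fun x : R => x).
Proof. by move=> x; exact: cvg_id. Qed.

Lemma continuous_fD f g : continuous f -> continuous g -> continuous (fun x => f x + g x).
Proof. by move=> cf cg x; apply: cvgD; [exact: cf|exact: cg]. Qed.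

Lemma continuous_fN f : continuous f -> continuous (fun x => - f x).
Proof. by move=> cf x; apply: cvgN; exact: cf. Qed.

Lemma continuous_fM f g : continuous f -> continuous g -> continuous (fun x => f x * g x).
Proof. by move=> cf cg x; apply: cvgM; [exact: cf|exact: cg]. Qed.

Lemma continuous_fX f n : continuous f -> continuous (fun x => f x ^+ n).
Proof.
move=> cf; elim: n => [|n IH]; first exact: continuous_fcst.
by under eq_fun do rewrite exprS; exact: continuous_fM.
Qed.

Lemma continuous_fnorm f : continuous f -> continuous (fun x => `|f x|).
Proof. by move=> cf x; apply: cvg_norm; exact: cf. Qed.

Lemma continuous_fV f : (forall x, f x != 0) -> continuous f -> continuous (fun x => (f x)^-1).
Proof. by move=> f0 cf x; apply: cvgV; [exact: f0|exact: cf]. Qed.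

Lemma continuous_fcomp f (h : R -> R) : continuous h -> continuous f -> continuous (fun x => h (f x)).
Proof. by move=> ch cf x; apply: continuous_comp; [exact: cf|exact: ch]. Qed.

Lemma is_derive1_continuous F f : (forall x : R, is_derive x 1 F (f x)) -> continuous F.
Proof.
move=> dF x; apply: differentiable_continuous; apply/derivable1_diffP.
by have [] := dF x.
Qed.

Lemma is_derive1E F x a : is_derive x 1 F a -> derive1 F x = a.
Proof. by move=> dF; rewrite derive1E; exact: derive_val. Qed.

Lemma FTC_itv f F (a b : R) : a <= b -> continuous f -> (forall x : R, is_derive x 1 F (f x)) ->
  (\int[mu]_(x in `[a, b]) (f x)%:E = (F b - F a)%:E)%E.
Proof.
rewrite le_eqVlt => /predU1P[<- _ _|ab cf dF].
  by rewrite set_itv1 integral_set1 subrr.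
have cF := is_derive1_continuous dF.
rewrite (continuous_FTC2 (F := F) ab) ?EFinB//.
- exact: continuous_subspaceT.
- split.
  + by move=> x _; have [] := dF x.
  + by apply: cvg_at_right_filter; exact: cF.
  + by apply: cvg_at_left_filter; exact: cF.
- by move=> x _; rewrite (is_derive1E (dF x)).
Qed.

Lemma FTC_itvy f F (a l : R) : (forall x, 0 <= f x) -> continuous f ->
  (forall x : R, is_derive x 1 F (f x)) -> F x @[x --> +oo] --> l ->
  (\int[mu]_(x in `[a, +oo[) (f x)%:E = (l - F a)%:E)%E.
Proof.
move=> f0 cf dF Fl; have cF := is_derive1_continuous dF.
rewrite (ge0_continuous_FTC2y (F := F) (l := l)) ?EFinB//.
- exact: continuous_subspaceT.
- by apply: cvg_at_right_filter; exact: cF.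
- by move=> x _; rewrite (is_derive1E (dF x)).
Qed.

(** The function [g] continues [f] from the half-line [0, +oo[, so that [F] may be given by one
    smooth formula: an even [f] containing |x|, such as [expdecay], is smooth only on each side of
    0. *)
Lemma FTC_even f F (l : R) : (forall x, 0 <= f x) -> continuous f -> (forall x, f (- x) = f x) ->
  forall g, continuous g -> (forall x, 0 <= g x) -> (forall x, 0 <= x -> g x = f x) ->
  (forall x : R, is_derive x 1 F (g x)) -> F x @[x --> +oo] --> l ->
  (\int[mu]_x (f x)%:E = (2 * (l - F 0))%:E)%E.
Proof.
move=> f0 cf fN g cg g0 gf dF Fl.
rewrite ge0_symfun_integralT//; last by move=> x /=; rewrite fN.
rewrite -set_itvcy EFinM -(@FTC_itvy g F 0 l)//; congr (_ * _)%E.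
by apply: eq_integral => x; rewrite inE/= in_itv/= andbT => x0; rewrite gf.
Qed.

End Calculus.
(** Recursion on the syntax; subterms of another shape are left as goals. *)
Ltac cont := lazymatch goal with
  | |- continuous (fun _ => ?c) => exact: continuous_fcst
  | |- continuous (fun x => x) => exact: continuous_fid
  | |- continuous (fun x => (@?f x + @?g x)%R) => apply: (@continuous_fD _ f g); cont
  | |- continuous (fun x => (@?f x * @?g x)%R) => apply: (@continuous_fM _ f g); cont
  | |- continuous (fun x => (- @?f x)%R) => apply: (@continuous_fN _ f); cont
  | |- continuous (fun x => (@?f x ^+ ?n)%R) => apply: (@continuous_fX _ f n); cont
  | |- continuous (fun x => `|@?f x|%R) => apply: (@continuous_fnorm _ f); cont
  | |- continuous (fun x => expR (@?f x)) => apply: (@continuous_fcomp _ f expR (@continuous_expR _)); cont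
  | |- continuous (fun x => sin (@?f x)) => apply: (@continuous_fcomp _ f sin (@continuous_sin _)); cont
  | |- continuous (fun x => cos (@?f x)) => apply: (@continuous_fcomp _ f cos (@continuous_cos _)); cont
  | |- continuous (fun x => atan (@?f x)) => apply: (@continuous_fcomp _ f atan (@continuous_atan _)); cont
  | |- _ => idtac
  end.

(** * The Poisson kernel as the transform of a two-sided exponential *)

Section Poisson.
Context {R : realType}.
Local Notation mu := (@lebesgue_measure R).

(** The Poisson kernel of the half-plane in the normalization with 2 pi in the exponent: the Fourier
    transform of [expdecay e], a probability density that concentrates at 0 as e tends to 0. *)
Definition poisson (e x : R) : R := 2 * e / (e ^+ 2 + (2 * pi * x) ^+ 2).

Lemma poisson_den_gt0 (e x : R) : 0 < e -> 0 < e ^+ 2 + (2 * pi * x) ^+ 2.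
Proof. by move=> e0; rewrite ltr_wpDr ?sqr_ge0 ?exprn_gt0. Qed.

Lemma poisson_ge0 (e x : R) : 0 < e -> 0 <= poisson e x.
Proof. by move=> e0; rewrite /poisson divr_ge0 ?mulr_ge0// ltW// ?poisson_den_gt0. Qed.

Lemma poissonN (e x : R) : poisson e (- x) = poisson e x.
Proof. by rewrite /poisson mulrN sqrrN. Qed.

Lemma is_derive_poisson (e t x : R) : 0 < e ->
  is_derive x 1 (fun x => atan (2 * pi * (x - t) / e) / pi) (poisson e (x - t)).
Proof.
move=> e0; apply: is_derive_eq; rewrite /GRing.scale/= /poisson.
have p0 : pi != 0 :> R by rewrite gt_eqF ?pi_gt0.
have d0 := poisson_den_gt0 (x - t) e0.
have d1 : 0 < 1 + (2 * pi * (x - t) / e) ^+ 2 by rewrite ltr_pwDl ?sqr_ge0.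
have e1 : e != 0 by rewrite gt_eqF.
move: pi p0 d0 d1 => p p0 d0 d1; field.
by rewrite p0 e1 /= !gt_eqF//.
Qed.

Lemma continuous_poisson (e : R) : 0 < e -> continuous (poisson e).
Proof.
move=> e0; rewrite /poisson; cont; apply: continuous_fV; last by cont.
by move=> x; rewrite gt_eqF ?poisson_den_gt0.
Qed.

Lemma cvgy_poisson_primitive (e : R) : 0 < e ->
  atan (2 * pi * (x - 0) / e) / pi @[x --> +oo] --> (2^-1 : R).
Proof.
move=> e0; have -> : 2^-1 = (pi / 2) / pi :> R.
  by rewrite mulrAC mulfV ?mul1r// gt_eqF ?pi_gt0.
apply: cvgM; last exact: cvg_cst.
apply: (cvg_comp (fun x : R => 2 * pi * (x - 0) / e) (@atan R)); last exact: cvgy_atan.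
apply/cvgryPge => A; near=> x.
rewrite subr0 ler_pdivlMr// -ler_pdivrMl ?mulr_gt0 ?pi_gt0//.
Unshelve. all: by end_near. Qed.

Lemma integral_poisson (e : R) : 0 < e -> (\int[mu]_x (poisson e x)%:E = 1)%E.
Proof.
move=> e0.
rewrite (@FTC_even _ (poisson e) _ 2^-1 _ _ _ (poisson e) _ _ _ _ (cvgy_poisson_primitive e0)).
- by rewrite subr0 mulr0 mul0r atan0 mul0r subr0 mulfV// pnatr_eq0.
- by move=> x; exact: poisson_ge0.
- exact: continuous_poisson.
- by move=> x; rewrite poissonN.
- exact: continuous_poisson.
- by move=> x; exact: poisson_ge0.
- by [].
- by move=> x; have := is_derive_poisson 0 x e0; rewrite [in X in is_derive _ _ _ X]subr0.
Qed.

Lemma integral_poisson_itv (e t a b : R) : 0 < e -> a <= b ->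
  (\int[mu]_(x in `[a, b]) (poisson e (x - t))%:E =
   ((atan (2 * pi * (b - t) / e) - atan (2 * pi * (a - t) / e)) / pi)%:E)%E.
Proof.
move=> e0 ab; rewrite mulrBl (FTC_itv ab _ (fun x => is_derive_poisson t x e0))//.
apply: (@continuous_fcomp _ (fun x => x - t)); first exact: continuous_poisson.
cont.
Qed.

Definition expdecay (e x : R) : R := expR (- (e * `|x|)).

Lemma expdecay_ge0 (e x : R) : 0 <= expdecay e x. Proof. exact: expR_ge0. Qed.

Lemma expdecay_le1 (e x : R) : 0 <= e -> expdecay e x <= 1.
Proof. by move=> e0; rewrite /expdecay -expR0 ler_expR oppr_le0 mulr_ge0. Qed.

Lemma expdecayN (e x : R) : expdecay e (- x) = expdecay e x.
Proof. by rewrite /expdecay normrN. Qed.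

Lemma continuous_expdecay (e : R) : continuous (expdecay e).
Proof. by rewrite /expdecay; cont. Qed.

Lemma cvgy_expN (e : R) : 0 < e -> expR (- (e * x)) @[x --> +oo] --> (0 : R).
Proof.
move=> e0; apply: (cvg_comp (fun x : R => e * x) (fun y => expR (- y))); last exact: cvgr_expR.
apply/cvgryPge => A; near=> x.
rewrite mulrC -ler_pdivrMr//.
Unshelve. all: by end_near. Qed.

(** The summand 1 makes the integrand nonnegative, so that the half-line integral can be read off an
    antiderivative and integrability follows from the finite value. The integral with the cosine
    alone is then obtained by subtracting the one without cosine, which comes from w = 0. *)
Lemma integral_expdecay_1Dcos (e w : R) : 0 < e ->
  (\int[mu]_x (expdecay e x * (1 + cos (w * x)))%:E = (2 / e + 2 * e / (e ^+ 2 + w ^+ 2))%:E)%E.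
Proof.
move=> e0; have ew : 0 < e ^+ 2 + w ^+ 2 by rewrite ltr_wpDr ?sqr_ge0 ?exprn_gt0.
have c0 (y : R) : 0 <= 1 + cos y by rewrite -lerBlDl sub0r cos_geN1.
pose g x := expR (- (e * x)) * (1 + cos (w * x)).
pose F x := expR (- (e * x)) * (- e^-1 + (w * sin (w * x) - e * cos (w * x)) / (e ^+ 2 + w ^+ 2)).
have dF (x : R) : is_derive x 1 F (g x).
  rewrite /F /g; apply: is_derive_eq; rewrite /GRing.scale/=.
  by field; rewrite gt_eqF// gt_eqF.
pose C := e^-1 + (`|w| + e) / (e ^+ 2 + w ^+ 2).
have FC x : `|F x| <= C * expR (- (e * x)).
  rewrite /F normrM ger0_norm ?expR_ge0// mulrC ler_wpM2r ?expR_ge0//.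
  rewrite (le_trans (ler_normD _ _))// normrN normfV (gtr0_norm e0) lerD2l.
  rewrite normrM normfV (gtr0_norm ew) ler_pM2r ?invr_gt0//.
  rewrite (le_trans (ler_normB _ _))// !normrM (gtr0_norm e0) lerD//.
    by rewrite ler_piMr// ler_norml sin_geN1 sin_le1.
  by rewrite ler_piMr ?(ltW e0)// ler_norml cos_geN1 cos_le1.
have CE : C * expR (- (e * x)) @[x --> +oo] --> (0 : R).
  by rewrite -(mulr0 C); apply: cvgM; [exact: cvg_cst|exact: cvgy_expN].
have F0 : F x @[x --> +oo] --> (0 : R).
  apply: (squeeze_cvgr (f := fun x => - (C * expR (- (e * x)))) (h := fun x => C * expR (- (e * x)))) => //.
    by apply: nearW => x; rewrite -ler_norml.
  by rewrite -oppr0; exact: cvgN.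
rewrite (FTC_even _ _ _ _ _ _ dF F0).
- congr EFin; rewrite /F !mulr0 oppr0 expR0 sin0 cos0.
  by field; rewrite gt_eqF// gt_eqF.
- by move=> x; rewrite mulr_ge0 ?expdecay_ge0.
- by rewrite /expdecay; cont.
- by move=> x; rewrite expdecayN mulrN cosN.
- by rewrite /g; cont.
- by move=> x; rewrite mulr_ge0 ?expR_ge0.
- by move=> x x0; rewrite /g /expdecay ger0_norm.
Qed.

Lemma intg_expdecay_1Dcos (e w : R) : 0 < e -> intg (fun x => expdecay e x * (1 + cos (w * x))).
Proof.
move=> e0; apply: intg_lty; last by rewrite integral_expdecay_1Dcos// ltry.
  by apply: continuous_measurable_fun; rewrite /expdecay; cont.
by move=> x; rewrite mulr_ge0 ?expdecay_ge0// -lerBlDl sub0r cos_geN1.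
Qed.

Lemma intg_expdecay (e : R) : 0 < e -> intg (expdecay e).
Proof.
move=> e0; apply: eq_intg (intgZ 2^-1 (intg_expdecay_1Dcos 0 e0)) => x.
by rewrite mul0r cos0; field.
Qed.

Lemma Rint_expdecay (e : R) : 0 < e -> \int[mu]_x expdecay e x = 2 / e.
Proof.
move=> e0; have := EFin_Rint (intg_expdecay_1Dcos 0 e0).
rewrite integral_expdecay_1Dcos// => -[].
rewrite (@eq_Rint _ (fun x => expdecay e x * (1 + cos (0 * x))) (fun x => 2 * expdecay e x)); last by move=> x; rewrite mul0r cos0; ring.
rewrite RintZ; last exact: intg_expdecay.
move=> h; apply: (@mulfI _ 2) => //; rewrite h.
by field; rewrite gt_eqF.
Qed.

Lemma Rint_expdecay_cos (e t : R) : 0 < e ->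
  \int[mu]_x (expdecay e x * cos (2 * pi * t * x)) = poisson e t.
Proof.
move=> e0; have := EFin_Rint (intg_expdecay_1Dcos (2 * pi * t) e0).
rewrite integral_expdecay_1Dcos// => -[].
have i1 := intg_expdecay e0.
have i2 : intg (fun x => expdecay e x * cos (2 * pi * t * x)).
  apply: (intg_bounded (M := 1)) i1; first by apply: continuous_measurable_fun; cont.
  by move=> x; rewrite ler_norml cos_geN1 cos_le1.
rewrite (@eq_Rint _ (fun x => expdecay e x * (1 + cos (2 * pi * t * x)))
  (fun x => expdecay e x + expdecay e x * cos (2 * pi * t * x))); last first.
  by move=> x; ring.
by rewrite RintD// Rint_expdecay// => /addrI.
Qed.

End Poisson.

(** * Translation, reflection and Fatou's lemma *)

Section Integral_tools.
Context {R : realType}.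
Local Notation mu := (@lebesgue_measure R).

Lemma lebesgue_measure_shift (c : R) (A : set R) : measurable A ->
  pushforward mu ((fun x => x + c) : _ -> measurableTypeR R) A = mu A.
Proof.
move=> mA; apply/esym/lebesgue_measure_unique => //=.
  by apply: measurable_funD.
move=> ? _ [[a b]] _ <-.
rewrite /pushforward.
have -> : (fun x => x + c) @^-1` `]a, b] = `](a - c)%R, (b - c)%R]%classic.
  by apply/seteqP; split => x /=; rewrite !in_itv/= ltrBlDr lerBrDr.
by rewrite !lebesgue_measure_itv/= !lte_fin ltrD2r; case: ifP => // _; congr EFin; ring.
Qed.

Lemma ge0_integral_shift (c : R) (f : R -> \bar R) : measurable_fun setT f ->
  (forall x, (0 <= f x)%E) -> (\int[mu]_x f (x + c)%R = \int[mu]_x f x)%E.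
Proof.
move=> mf f0; pose T (x : measurableTypeR R) : measurableTypeR R := x + c.
have mT : measurable_fun setT T by apply: measurable_funD.
transitivity (\int[pushforward mu T]_x f x)%E.
  by rewrite (ge0_integral_pushforward mT _ measurableT mf).
by apply: eq_measure_integral => A mA _; exact: lebesgue_measure_shift.
Qed.

Lemma ge0_integral_opp (f : R -> \bar R) : measurable_fun setT f ->
  (forall x, (0 <= f x)%E) -> (\int[mu]_x f (- x)%R = \int[mu]_x f x)%E.
Proof.
move=> mf f0; pose T (x : measurableTypeR R) : measurableTypeR R := - x.
have mT : measurable_fun setT T by exact: measurableT_comp.
transitivity (\int[pushforward mu T]_x f x)%E.
  by rewrite (ge0_integral_pushforward mT _ measurableT mf).
by apply: eq_measure_integral => A mA _; exact: lebesgue_measureN.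
Qed.

Lemma fatou_le (h : nat -> R -> R) (f : R -> R) (B : \bar R) :
  (forall n, measurable_fun setT (h n)) -> (forall n x, 0 <= h n x) ->
  (forall x, h n x @[n --> \oo] --> f x) ->
  (\forall n \near \oo, (\int[mu]_x (h n x)%:E <= B)%E) ->
  (\int[mu]_x (f x)%:E <= B)%E.
Proof.
move=> mh h0 hf [N _ hB].
have mhE n : measurable_fun setT (EFin \o h n) by exact/measurable_EFinP.
have -> : (\int[mu]_x (f x)%:E = \int[mu]_x limn_einf (fun n => (h n x)%:E))%E.
  apply: eq_integral => x _.
  have hx : (h n x)%:E @[n --> \oo] --> (f x)%:E.
    by apply: cvg_EFin; [exact: nearW|exact: hf].
  by have [-> _] := cvg_limn_einf_sup hx.
apply: (le_trans (fatou mu measurableT mhE _)) => //.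
  by move=> n x _; rewrite lee_fin.
rewrite limn_einf_lim; apply: lime_le; first exact: is_cvg_einfs.
apply: nearW => n.
(* The infimum over the indices beyond n is at most the value at any of them; [maxn n N] is one at
   which the bound [hB] is available. *)
apply: (le_trans _ (hB (maxn n N) _)); last by rewrite /= leq_maxr.
apply: ereal_inf_lbound; exists (maxn n N) => //=.
by rewrite leq_maxl.
Qed.

End Integral_tools.

(** * Sine and cosine transforms, Plancherel inequality *)

Section Plancherel.
Context {R : realType}.
Local Notation mu := (@lebesgue_measure R).
Implicit Types u a : R -> R.

(** For a real [u] the Fourier transform is fcos u - i fsin u: the sign is kept out of [fsin]. *)
Definition fcos u (t : R) := \int[mu]_x (u x * cos (2 * pi * x * t)).
Definition fsin u (t : R) := \int[mu]_x (u x * sin (2 * pi * x * t)).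

Lemma normr_cos_le1 (x : R) : `|cos x| <= 1.
Proof. by rewrite ler_norml cos_geN1 cos_le1. Qed.

Lemma normr_sin_le1 (x : R) : `|sin x| <= 1.
Proof. by rewrite ler_norml sin_geN1 sin_le1. Qed.

Lemma measurable_cos_lin (t : R) : measurable_fun setT (fun x : R => cos (2 * pi * x * t)).
Proof. by apply: continuous_measurable_fun; cont. Qed.

Lemma measurable_sin_lin (t : R) : measurable_fun setT (fun x : R => sin (2 * pi * x * t)).
Proof. by apply: continuous_measurable_fun; cont. Qed.

Lemma intg_cos u t : intg u -> intg (fun x => u x * cos (2 * pi * x * t)).
Proof.
by apply: (intg_bounded (M := 1)) => //; [exact: measurable_cos_lin|move=> x; exact: normr_cos_le1].
Qed.

Lemma intg_sin u t : intg u -> intg (fun x => u x * sin (2 * pi * x * t)).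
Proof.
by apply: (intg_bounded (M := 1)) => //; [exact: measurable_sin_lin|move=> x; exact: normr_sin_le1].
Qed.

Lemma continuous_fcos u : intg u -> continuous (fcos u).
Proof.
move=> iu; apply: (continuous_kernel_int (M := 1) iu) => [t|x|x t].
- exact: measurable_cos_lin.
- cont.
- exact: normr_cos_le1.
Qed.

Lemma continuous_fsin u : intg u -> continuous (fsin u).
Proof.
move=> iu; apply: (continuous_kernel_int (M := 1) iu) => [t|x|x t].
- exact: measurable_sin_lin.
- cont.
- exact: normr_sin_le1.
Qed.

Lemma fcosN u t : fcos u (- t) = fcos u t.
Proof. by apply: eq_Rint => x; rewrite mulrN cosN. Qed.

Lemma fsinN u t : intg u -> fsin u (- t) = - fsin u t.
Proof.
move=> iu; rewrite /fsin -[RHS]mulN1r -RintZ; last exact: intg_sin.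
by apply: eq_Rint => x; rewrite mulrN sinN; ring.
Qed.

Lemma fcos_bound u t : intg u -> `|fcos u t| <= \int[mu]_x `|u x|.
Proof.
move=> iu; have := Rint_bounded (M := 1) iu (measurable_cos_lin t).
by rewrite mul1r; apply => x; exact: normr_cos_le1.
Qed.

Lemma fsin_bound u t : intg u -> `|fsin u t| <= \int[mu]_x `|u x|.
Proof.
move=> iu; have := Rint_bounded (M := 1) iu (measurable_sin_lin t).
by rewrite mul1r; apply => x; exact: normr_sin_le1.
Qed.

(** The real part of exp (2 i pi x t) times the transform of [u] at t; [fsin_shift] is the imaginary
    part. *)
Lemma fcos_shift u x t : intg u ->
  cos (2 * pi * x * t) * fcos u t + sin (2 * pi * x * t) * fsin u t =
  \int[mu]_y (u y * cos (2 * pi * (x - y) * t)).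
Proof.
move=> iu; rewrite /fcos /fsin -!RintZ; [|exact: intg_sin|exact: intg_cos].
rewrite -RintD; [|apply: intgZ; exact: intg_cos|apply: intgZ; exact: intg_sin].
apply: eq_Rint => y.
by rewrite mulrBr mulrBl cosB; ring.
Qed.

Lemma fsin_shift u x t : intg u ->
  sin (2 * pi * x * t) * fcos u t - cos (2 * pi * x * t) * fsin u t =
  \int[mu]_y (u y * sin (2 * pi * (x - y) * t)).
Proof.
move=> iu; rewrite /fcos /fsin -!RintZ; [|exact: intg_sin|exact: intg_cos].
rewrite -RintB; [|apply: intgZ; exact: intg_cos|apply: intgZ; exact: intg_sin].
apply: eq_Rint => y.
by rewrite mulrBr mulrBl sinB; ring.
Qed.

Let D u x t := cos (2 * pi * x * t) * fcos u t + sin (2 * pi * x * t) * fsin u t.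

Let Dbound u x t : intg u -> `|D u x t| <= 2 * \int[mu]_x `|u x|.
Proof.
move=> iu; have h1 := fcos_bound t iu; have h2 := fsin_bound t iu.
have h3 := normr_cos_le1 (2 * pi * x * t); have h4 := normr_sin_le1 (2 * pi * x * t).
rewrite mulr_natl mulr2n (le_trans (ler_normD _ _))// !normrM lerD//.
  by rewrite -[leRHS]mul1r ler_pM.
by rewrite -[leRHS]mul1r ler_pM.
Qed.

Lemma measurable_fst_cos (f : R * R -> R) : measurable_fun setT f ->
  measurable_fun setT (fun z => cos (f z)).
Proof. by move=> mf; apply: measurableT_comp => //; exact: continuous_measurable_fun (@continuous_cos R). Qed.

Lemma measurable_fst_sin (f : R * R -> R) : measurable_fun setT f ->
  measurable_fun setT (fun z => sin (f z)).
Proof. by move=> mf; apply: measurableT_comp => //; exact: continuous_measurable_fun (@continuous_sin R). Qed.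

Let measurable_arg : measurable_fun setT (fun z : R * R => 2 * pi * z.1 * z.2).
Proof. by apply: measurable_funM => //; apply: measurable_funM. Qed.

Let mD u : intg u -> measurable_fun setT (fun z : R * R => D u z.1 z.2).
Proof.
move=> iu; apply: measurable_funD; apply: measurable_funM.
- exact: measurable_fst_cos.
- apply: (measurableT_comp (continuous_measurable_fun (continuous_fcos iu))).
  exact: measurable_snd.
- exact: measurable_fst_sin.
- apply: (measurableT_comp (continuous_measurable_fun (continuous_fsin iu))).
  exact: measurable_snd.
Qed.

(** The squared modulus of the transform is a double integral over (x, y) with kernel cos (2 pi (x -
    y) t), and integrating in t against [expdecay e] turns the cosine into a Poisson kernel. The
    weight makes Fubini applicable: the transform of an integrable function is only bounded. *)
Lemma Plancherel_weighted u (e : R) : 0 < e -> intg u ->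
  \int[mu]_t (expdecay e t * (fcos u t ^+ 2 + fsin u t ^+ 2)) =
  \int[mu]_x (u x * \int[mu]_y (u y * poisson e (x - y))).
Proof.
move=> e0 iu.
have -> : \int[mu]_t (expdecay e t * (fcos u t ^+ 2 + fsin u t ^+ 2)) =
    \int[mu]_t (expdecay e t * \int[mu]_x (u x * D u x t)).
  apply: eq_Rint => t; congr (_ * _).
  rewrite (@eq_Rint _ _ (fun x => fcos u t * (u x * cos (2 * pi * x * t)) +
      fsin u t * (u x * sin (2 * pi * x * t)))); last by move=> x; rewrite /D; ring.
  rewrite RintD; [|apply: intgZ; exact: intg_cos|apply: intgZ; exact: intg_sin].
  by rewrite !RintZ ?expr2//; [exact: intg_sin|exact: intg_cos].
rewrite (Rint_Fubini (M := 2 * \int[mu]_x `|u x|) (intg_expdecay e0) iu (K := fun t x => D u x t)).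
- apply: eq_Rint => x; congr (_ * _).
  under eq_Rintegral do rewrite /D fcos_shift//.
  rewrite (Rint_Fubini (M := 1) (intg_expdecay e0) iu (K := fun t y => cos (2 * pi * (x - y) * t))).
  + by apply: eq_Rint => y; rewrite Rint_expdecay_cos.
  + apply: measurable_fst_cos; apply: measurable_funM => //.
    apply: measurable_funM => //; exact: measurable_funB.
  + by move=> *; exact: normr_cos_le1.
- by apply: (measurableT_comp (mD iu) (@measurable_swap _ _ _ _)).
- by move=> *; exact: Dbound.
Qed.

Lemma measurable_poisson e : 0 < e -> measurable_fun setT (@poisson R e).
Proof. by move=> e0; apply: continuous_measurable_fun; exact: continuous_poisson. Qed.

Lemma poisson_le e (x : R) : 0 < e -> `|poisson e x| <= 2 / e.
Proof.
move=> e0; rewrite ger0_norm ?poisson_ge0// /poisson ler_pdivrMr ?poisson_den_gt0//.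
rewrite mulrDr.
have -> : 2 / e * e ^+ 2 = 2 * e by field; rewrite gt_eqF.
by rewrite lerDl mulr_ge0 ?sqr_ge0// divr_ge0// ltW.
Qed.

Lemma integral_conv_poisson (w : R -> R) (e : R) : 0 < e -> intg w -> (forall x, 0 <= w x) ->
  (\int[mu]_x (\int[mu]_y (w y * poisson e (x - y)))%:E = \int[mu]_y (w y)%:E)%E.
Proof.
move=> e0 iw w0.
have mP (x : R) : measurable_fun setT (fun y : R => poisson e (x - y)).
  by apply: (measurableT_comp (measurable_poisson e0)); exact: measurable_funB.
transitivity (\int[mu]_x \int[mu]_y (w y * poisson e (x - y))%:E)%E.
  apply: eq_integral => x _; rewrite EFin_Rint//.
  by apply: (intg_bounded (M := 2 / e)) iw => // y; exact: poisson_le.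
have mF : measurable_fun setT (fun z : R * R => (w z.2 * poisson e (z.1 - z.2))%:E).
  apply/measurable_EFinP; apply: measurable_funM.
    exact: (measurableT_comp (intg_measurable iw)).
  by apply: (measurableT_comp (measurable_poisson e0)); exact: measurable_funB.
have F0 (z : R * R) : (0 <= (w z.2 * poisson e (z.1 - z.2))%:E)%E.
  by rewrite lee_fin mulr_ge0 ?poisson_ge0.
have -> := @fubini_tonelli _ _ _ _ R mu mu _ mF F0.
apply: eq_integral => y _ /=.
under eq_integral do rewrite EFinM.
rewrite ge0_integralZl_EFin//.
- rewrite (ge0_integral_shift (f := fun x => (poisson e x)%:E) (- y))//.
  + by rewrite integral_poisson// mule1.
  + by apply/measurable_EFinP; exact: measurable_poisson.
  + by move=> x; rewrite lee_fin poisson_ge0.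
- by move=> x _; rewrite lee_fin poisson_ge0.
- apply/measurable_EFinP; apply: (measurableT_comp (measurable_poisson e0)).
  exact: measurable_funB.
Qed.

Lemma poissonB e (x y : R) : poisson e (x - y) = poisson e (y - x).
Proof. by rewrite -poissonN opprB. Qed.

Lemma measurable_poissonB e (x : R) : 0 < e -> measurable_fun setT (fun y : R => poisson e (x - y)).
Proof.
by move=> e0; apply: (measurableT_comp (measurable_poisson e0)); exact: measurable_funB.
Qed.

Lemma integral_poissonB e (x : R) : 0 < e -> (\int[mu]_y (poisson e (x - y))%:E = 1)%E.
Proof.
move=> e0; under eq_integral do rewrite poissonB.
rewrite (ge0_integral_shift (f := fun x => (poisson e x)%:E) (- x))//.
- by rewrite integral_poisson.
- by apply/measurable_EFinP; exact: measurable_poisson.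
- by move=> y; rewrite lee_fin poisson_ge0.
Qed.

Lemma continuous_conv_poisson u e : 0 < e -> intg u ->
  continuous (fun x => \int[mu]_y (u y * poisson e (x - y))).
Proof.
move=> e0 iu; apply: (continuous_kernel_int (M := 2 / e) iu (K := fun y x => poisson e (x - y))).
- by move=> x; exact: measurable_poissonB.
- move=> y; apply: (@continuous_fcomp _ (fun x => x - y)); first exact: continuous_poisson.
  cont.
- by move=> y x; exact: poisson_le.
Qed.

(** Since u(x) u(y) <= (u(x)^2 + u(y)^2) / 2 and the Poisson kernel is symmetric, nonnegative and of
    mass 1 in each variable, its quadratic form is at most the squared norm. *)
Lemma Plancherel_weighted_le u (e : R) : 0 < e -> intg u -> sqintg u ->
  \int[mu]_t (expdecay e t * (fcos u t ^+ 2 + fsin u t ^+ 2)) <= \int[mu]_x (u x ^+ 2).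
Proof.
move=> e0 iu [mu_ iu2]; rewrite Plancherel_weighted//.
pose W x := \int[mu]_y (u y * poisson e (x - y)).
pose V x := \int[mu]_y (u y ^+ 2 * poisson e (x - y)).
have ib a : intg a -> forall x, intg (fun y => a y * poisson e (x - y)).
  move=> ia x; apply: (intg_bounded (M := 2 / e)) ia; first exact: measurable_poissonB.
  by move=> y; exact: poisson_le.
have iV : intg V.
  apply: intg_lty.
  - by apply: continuous_measurable_fun; exact: continuous_conv_poisson.
  - by move=> x; apply: Rintegral_ge0 => y _; rewrite mulr_ge0 ?sqr_ge0 ?poisson_ge0.
  - rewrite integral_conv_poisson//; first exact: intg_int_lty.
    by move=> x; exact: sqr_ge0.
have VE : \int[mu]_x V x = \int[mu]_x (u x ^+ 2).
  by rewrite /Rintegral integral_conv_poisson// => x; exact: sqr_ge0.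
have iP x : intg (fun y => poisson e (x - y)).
  apply: intg_lty; [exact: measurable_poissonB|by move=> y; exact: poisson_ge0|].
  by rewrite integral_poissonB ?ltry.
have PE x : \int[mu]_y poisson e (x - y) = 1.
  by rewrite /Rintegral integral_poissonB.
have iuW : intg (fun x => u x * W x).
  apply: (intg_bounded (M := 2 / e * \int[mu]_x `|u x|) _ _ iu).
    by apply: continuous_measurable_fun; exact: continuous_conv_poisson.
  by move=> x; apply: Rint_bounded => //; [exact: measurable_poissonB|move=> y; exact: poisson_le].
have iH : intg (fun x => 2^-1 * (u x ^+ 2) + 2^-1 * V x) by apply: intgD; exact: intgZ.
apply: (@le_trans _ _ (\int[mu]_x (2^-1 * (u x ^+ 2) + 2^-1 * V x))).
  apply: le_Rint => // x.
  have -> : 2^-1 * u x ^+ 2 = \int[mu]_y (2^-1 * u x ^+ 2 * poisson e (x - y)).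
    by rewrite RintZ// PE mulr1.
  rewrite /W /V -!RintZ//; [|exact: ib|exact: ib].
  rewrite -RintD; [|exact: intgZ|by apply: intgZ; exact: ib].
  apply: le_Rint; [by apply: intgZ; exact: ib| |].
    by apply: intgD; apply: intgZ => //; exact: ib.
  move=> y; have := poisson_ge0 (x - y) e0; move: (poisson _ _) => P P0.
  have : 0 <= P * (u x - u y) ^+ 2 by rewrite mulr_ge0 ?sqr_ge0.
  nra.
rewrite RintD; [|exact: intgZ|exact: intgZ].
by rewrite (RintZ _ iu2) (RintZ _ iV) VE; move: (Rintegral _ _ _) => I; lra.
Qed.

Lemma cvg_expdecay (t : R) : expdecay n.+1%:R^-1 t @[n --> \oo] --> (1 : R).
Proof.
rewrite -[X in _ --> X]expR0; apply: continuous_cvg; first exact: continuous_expR.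
rewrite -[X in _ --> X]oppr0 -(mul0r `|t|); apply: cvgN; apply: cvgM; last exact: cvg_cst.
exact: cvg_harmonic.
Qed.

(** Fatou's lemma as the damping factor tends to 1, the damped integrals having a common bound. *)
Lemma Plancherel_real_le u : intg u -> sqintg u ->
  (\int[mu]_t (fcos u t ^+ 2 + fsin u t ^+ 2)%:E <= \int[mu]_x (u x ^+ 2)%:E)%E.
Proof.
move=> iu su.
have cC := continuous_fcos iu; have cS := continuous_fsin iu.
have mF : measurable_fun setT (fun t => fcos u t ^+ 2 + fsin u t ^+ 2).
  by apply: continuous_measurable_fun; apply: continuous_fD; exact: continuous_fX.
apply: (fatou_le (h := fun n t => expdecay n.+1%:R^-1 t * (fcos u t ^+ 2 + fsin u t ^+ 2))).
- move=> n; apply: measurable_funM => //.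
  by apply: continuous_measurable_fun; exact: continuous_expdecay.
- by move=> n x; rewrite mulr_ge0 ?expdecay_ge0// addr_ge0 ?sqr_ge0.
- move=> t; rewrite -[X in _ --> X]mul1r; apply: cvgM; first exact: cvg_expdecay.
  exact: cvg_cst.
- apply: nearW => n; rewrite -EFin_Rint; last first.
    apply: (intg_bounded (M := 2 * (\int[mu]_x `|u x|) ^+ 2)) => //; last exact: intg_expdecay.
    move=> t; have h1 := fcos_bound t iu; have h2 := fsin_bound t iu.
    rewrite ger0_norm ?addr_ge0 ?sqr_ge0// mulr_natl mulr2n lerD//.
      by rewrite -[fcos u t ^+ 2]real_normK ?num_real// ler_pXn2r// nnegrE Rintegral_ge0.
    by rewrite -[fsin u t ^+ 2]real_normK ?num_real// ler_pXn2r// nnegrE Rintegral_ge0.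
  rewrite -EFin_Rint; last by case: su.
  by rewrite lee_fin Plancherel_weighted_le.
Qed.

End Plancherel.

(** * Cauchy-Schwarz and limits of integrals in L^2 *)

Section L2.
Context {R : realType}.
Local Notation mu := (@lebesgue_measure R).
Implicit Types a b u : R -> R.

Lemma cvg_sqr_le0 (x y : nat -> R) : x n @[n --> \oo] --> (0 : R) ->
  forall C, (forall n, y n ^+ 2 <= C * x n) -> y n @[n --> \oo] --> (0 : R).
Proof.
move=> x0 C yx; apply/norm_cvg0P.
have -> : (fun n => `|y n|) = (fun n => Num.sqrt (y n ^+ 2)).
  by apply/funext => n; rewrite sqrtr_sqr.
rewrite -[X in _ --> X]sqrtr0; apply: continuous_cvg; first exact: sqrt_continuous.
apply: (squeeze_cvgr (f := cst 0) (h := fun n => C * x n)).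
- by apply: nearW => n; rewrite sqr_ge0 yx.
- exact: cvg_cst.
- by rewrite -[X in _ --> X](mulr0 C); apply: cvgM => //; exact: cvg_cst.
Qed.

Lemma sqintg_sqr a : sqintg a -> intg (fun x => a x ^+ 2).
Proof. by case. Qed.

Lemma Rint_sqr_ge0 a : 0 <= \int[mu]_x (a x ^+ 2).
Proof. by apply: Rintegral_ge0 => x _; exact: sqr_ge0. Qed.

Lemma Rint_Cauchy_Schwarz a b : sqintg a -> sqintg b ->
  (\int[mu]_x (a x * b x)) ^+ 2 <= \int[mu]_x (a x ^+ 2) * \int[mu]_x (b x ^+ 2).
Proof.
move=> sa sb; have iab := sqintgM sa sb.
have ia := sqintg_sqr sa; have ib := sqintg_sqr sb.
have A0 := Rint_sqr_ge0 a; have B0 := Rint_sqr_ge0 b.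
have quad t : 0 <= \int[mu]_x (a x ^+ 2) - t * (2 * \int[mu]_x (a x * b x)) + t ^+ 2 * \int[mu]_x (b x ^+ 2).
  rewrite -(RintZ 2 iab) -(RintZ t (intgZ 2 iab)) -(RintZ _ ib) -RintB//; last by do 2 apply: intgZ.
  rewrite -RintD; [|by apply: intgB => //; do 2 apply: intgZ|exact: intgZ].
  apply: Rintegral_ge0 => x _.
  have -> : a x ^+ 2 - t * (2 * (a x * b x)) + t ^+ 2 * b x ^+ 2 = (a x - t * b x) ^+ 2 by ring.
  exact: sqr_ge0.
move: (Rintegral _ _ _) (Rintegral _ _ _) (Rintegral _ _ _) A0 B0 quad => C B A A0 B0 quad.
move: B0; rewrite le_eqVlt => /predU1P[B0|B0].
  have [->|C0] := eqVneq C 0; first by rewrite expr0n/= -B0 mulr0.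
  (* When the integral of b^2 is 0 the form is affine in t, and at this t it takes the value -1. *)
  have := quad ((A + 1) / (2 * C)).
  have -> : (A + 1) / (2 * C) * (2 * C) = A + 1 by field.
  by rewrite -B0 mulr0 addr0; lra.
have := quad (C / B).
have -> : A - C / B * (2 * C) + (C / B) ^+ 2 * B = A - C ^+ 2 / B by field; rewrite gt_eqF.
by rewrite subr_ge0 ler_pdivrMr.
Qed.

Lemma cvg_Rint_mul (a_ : nat -> R -> R) a b : (forall n, sqintg (a_ n)) -> sqintg a -> sqintg b ->
  \int[mu]_x ((a_ n x - a x) ^+ 2) @[n --> \oo] --> (0 : R) ->
  \int[mu]_x (a_ n x * b x) @[n --> \oo] --> \int[mu]_x (a x * b x).
Proof.
move=> san sa sb h.
have E n : \int[mu]_x (a_ n x * b x) - \int[mu]_x (a x * b x) = \int[mu]_x ((a_ n x - a x) * b x).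
  rewrite -RintB; [|exact: sqintgM|exact: sqintgM].
  by apply: eq_Rint => x; ring.
apply/subr_cvg0; apply: (cvg_sqr_le0 h (C := \int[mu]_x (b x ^+ 2))) => n.
by rewrite E mulrC; apply: Rint_Cauchy_Schwarz => //; exact: sqintgB.
Qed.

Lemma cvg_Rint_sqr (a_ : nat -> R -> R) a : (forall n, sqintg (a_ n)) -> sqintg a ->
  \int[mu]_x ((a_ n x - a x) ^+ 2) @[n --> \oo] --> (0 : R) ->
  \int[mu]_x (a_ n x ^+ 2) @[n --> \oo] --> \int[mu]_x (a x ^+ 2).
Proof.
move=> san sa h; have h2 := cvg_Rint_mul san sa sa h.
have i2 := sqintgM sa sa.
move: h2; set I := \int[mu]_x (a x * a x); move=> h2.
have -> : (fun n => \int[mu]_x (a_ n x ^+ 2)) =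
    (fun n => \int[mu]_x ((a_ n x - a x) ^+ 2) + 2 * \int[mu]_x (a_ n x * a x) - I).
  apply/funext => n.
  have i1 := sqintgM (san n) sa.
  have i3 := sqintg_sqr (sqintgB (san n) sa).
  rewrite /I -RintZ// -RintD//; last exact: intgZ.
  rewrite -RintB//; last by apply: intgD => //; exact: intgZ.
  by apply: eq_Rint => x; ring.
have h3 : 2 * \int[mu]_x (a_ n x * a x) @[n --> \oo] --> 2 * I.
  by apply: cvgM => //; exact: cvg_cst.
have h4 : (fun _ : nat => I) n @[n --> \oo] --> I by exact: cvg_cst.
by have := cvgB (cvgD h h3) h4; rewrite add0r (_ : 2 * I - I = I); [exact|ring].
Qed.

Lemma cvg_Rint_dominated (h : nat -> R -> R) (f G : R -> R) :
  (forall n, measurable_fun setT (h n)) -> intg G -> (forall n x, `|h n x| <= G x) ->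
  (forall x, h n x @[n --> \oo] --> f x) ->
  intg f /\ \int[mu]_x h n x @[n --> \oo] --> \int[mu]_x f x.
Proof.
move=> mh iG hG hf.
have mf : measurable_fun setT f.
  by apply: (measurable_fun_cvg (h := h)) => // x _; exact: hf.
have mhE n : measurable_fun setT (EFin \o h n) by exact/measurable_EFinP.
have mfE : measurable_fun setT (EFin \o f) by exact/measurable_EFinP.
have := @dominated_convergence _ _ _ mu setT measurableT (fun n => EFin \o h n) (EFin \o f) (EFin \o G).
case.
- exact: mhE.
- exact: mfE.
- by apply: aeW => x _; apply: cvg_EFin; [exact: nearW|exact: hf].
- exact: iG.
- by apply: aeW => x n _; rewrite /= lee_fin.
move=> i1 _ i2; split=> //.
have := fine_cvg (f := fun n => (\int[mu]_x (h n x)%:E)%E) (a := \int[mu]_x f x).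
by apply; rewrite EFin_Rint.
Qed.
End L2.

(* A complex function is handled as the pair of its real and imaginary parts:
   [fre u v] and [fim u v] are those of the Fourier transform of [u + i v]. *)
Section Complex_pairs.
Context {R : realType}.
Local Notation mu := (@lebesgue_measure R).
Implicit Types a b u v : R -> R.

Definition fre u v (t : R) := fcos u t + fsin v t.
Definition fim u v (t : R) := fcos v t - fsin u t.

Lemma measurable_fcos u : intg u -> measurable_fun setT (fcos u).
Proof. by move=> iu; apply: continuous_measurable_fun; exact: continuous_fcos. Qed.

Lemma measurable_fsin u : intg u -> measurable_fun setT (fsin u).
Proof. by move=> iu; apply: continuous_measurable_fun; exact: continuous_fsin. Qed.

Lemma sqintg_fcos u : intg u -> sqintg u -> sqintg (fcos u).
Proof.
move=> iu su; split; first exact: measurable_fcos.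
apply: intg_lty; first by apply: measurable_sqr; exact: measurable_fcos.
  by move=> x; exact: sqr_ge0.
apply: le_lt_trans (intg_int_lty (sqintg_sqr su)).
apply: le_trans (Plancherel_real_le iu su).
apply: ge0_le_integral => //.
- by move=> x _; rewrite lee_fin sqr_ge0.
- by apply/measurable_EFinP; apply: measurable_sqr; exact: measurable_fcos.
- apply/measurable_EFinP; apply: measurable_funD; apply: measurable_sqr.
    exact: measurable_fcos.
  exact: measurable_fsin.
- by move=> x _; rewrite lee_fin lerDl sqr_ge0.
Qed.

Lemma sqintg_fsin u : intg u -> sqintg u -> sqintg (fsin u).
Proof.
move=> iu su; split; first exact: measurable_fsin.
apply: intg_lty; first by apply: measurable_sqr; exact: measurable_fsin.
  by move=> x; exact: sqr_ge0.
apply: le_lt_trans (intg_int_lty (sqintg_sqr su)).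
apply: le_trans (Plancherel_real_le iu su).
apply: ge0_le_integral => //.
- by move=> x _; rewrite lee_fin sqr_ge0.
- by apply/measurable_EFinP; apply: measurable_sqr; exact: measurable_fsin.
- apply/measurable_EFinP; apply: measurable_funD; apply: measurable_sqr.
    exact: measurable_fcos.
  exact: measurable_fsin.
- by move=> x _; rewrite lee_fin lerDr sqr_ge0.
Qed.

Lemma sqintg_fre u v : intg u -> sqintg u -> intg v -> sqintg v -> sqintg (fre u v).
Proof. by move=> *; apply: sqintgD; [exact: sqintg_fcos|exact: sqintg_fsin]. Qed.

Lemma sqintg_fim u v : intg u -> sqintg u -> intg v -> sqintg v -> sqintg (fim u v).
Proof. by move=> *; apply: sqintgB; [exact: sqintg_fcos|exact: sqintg_fsin]. Qed.

Lemma Rint_opp a : intg a -> (forall x, 0 <= a x) -> \int[mu]_x a (- x) = \int[mu]_x a x.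
Proof.
move=> ia a0; rewrite /Rintegral; congr fine.
apply: (ge0_integral_opp (f := fun x => (a x)%:E)) => //.
by apply/measurable_EFinP; exact: intg_measurable.
Qed.

(* The cross terms of [|u^ + i v^|^2] are odd and disappear after symmetrization. *)
Lemma Plancherel_le u v : intg u -> sqintg u -> intg v -> sqintg v ->
  \int[mu]_t (fre u v t ^+ 2 + fim u v t ^+ 2) <= \int[mu]_x (u x ^+ 2 + v x ^+ 2).
Proof.
move=> iu su iv sv.
have sr := sqintg_fre iu su iv sv; have si := sqintg_fim iu su iv sv.
pose G t := fre u v t ^+ 2 + fim u v t ^+ 2.
have iG : intg G by apply: intgD; exact: sqintg_sqr.
have G0 t : 0 <= G t by rewrite addr_ge0 ?sqr_ge0.
have GN : \int[mu]_t G (- t) = \int[mu]_t G t by exact: Rint_opp.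
have P (w : R -> R) : intg w -> sqintg w -> \int[mu]_t (fcos w t ^+ 2 + fsin w t ^+ 2) <= \int[mu]_x (w x ^+ 2).
  move=> iw sw; rewrite -lee_fin EFin_Rint; last first.
    by apply: intgD; apply: sqintg_sqr; [exact: sqintg_fcos|exact: sqintg_fsin].
  by rewrite (EFin_Rint (sqintg_sqr sw)); exact: Plancherel_real_le.
have E t : G (- t) = 2 * (fcos u t ^+ 2 + fsin u t ^+ 2) + 2 * (fcos v t ^+ 2 + fsin v t ^+ 2) - G t.
  rewrite /G /fre /fim !fcosN (fsinN _ iu) (fsinN _ iv).
  by move: (fcos u t) (fsin u t) (fcos v t) (fsin v t) => *; ring.
have iQ (w : R -> R) : intg w -> sqintg w -> intg (fun t => fcos w t ^+ 2 + fsin w t ^+ 2).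
  by move=> iw sw; apply: intgD; apply: sqintg_sqr; [exact: sqintg_fcos|exact: sqintg_fsin].
rewrite (RintD (sqintg_sqr su) (sqintg_sqr sv)).
have := P _ iu su; have := P _ iv sv.
move: GN; rewrite (eq_Rint E).
have h1 := intgZ 2 (iQ _ iu su); have h2 := intgZ 2 (iQ _ iv sv).
rewrite (RintB (intgD h1 h2) iG) (RintD h1 h2) (RintZ 2 (iQ _ iu su)) (RintZ 2 (iQ _ iv sv)).
change (\int[mu]_t (fre u v t ^+ 2 + fim u v t ^+ 2)) with (\int[mu]_t G t).
move: (\int[mu]_t G t) => I0.
move: (Rintegral _ _ _) (Rintegral _ _ _) (Rintegral _ _ _) (Rintegral _ _ _) => I1 I2 I3 I4.
lra.
Qed.

Lemma Rint_fcos_sym a b : intg a -> intg b ->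
  \int[mu]_t (b t * fcos a t) = \int[mu]_x (a x * fcos b x).
Proof.
move=> ia ib; rewrite /fcos (Rint_Fubini (M := 1) ib ia (K := fun t x => cos (2 * pi * x * t))).
- by apply: eq_Rint => x; congr (_ * _); apply: eq_Rint => t; rewrite mulrAC.
- by apply: measurable_fst_cos; apply: measurable_funM => //; apply: measurable_funM.
- by move=> *; exact: normr_cos_le1.
Qed.

Lemma Rint_fsin_sym a b : intg a -> intg b ->
  \int[mu]_t (b t * fsin a t) = \int[mu]_x (a x * fsin b x).
Proof.
move=> ia ib; rewrite /fsin (Rint_Fubini (M := 1) ib ia (K := fun t x => sin (2 * pi * x * t))).
- by apply: eq_Rint => x; congr (_ * _); apply: eq_Rint => t; rewrite mulrAC.
- by apply: measurable_fst_sin; apply: measurable_funM => //; apply: measurable_funM.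
- by move=> *; exact: normr_sin_le1.
Qed.

Lemma intg_mul_fcos a b : intg a -> intg b -> intg (fun x => b x * fcos a x).
Proof.
move=> ia ib; apply: (intg_bounded (M := \int[mu]_x `|a x|) _ _ ib).
  exact: measurable_fcos.
by move=> t; exact: fcos_bound.
Qed.

Lemma intg_mul_fsin a b : intg a -> intg b -> intg (fun x => b x * fsin a x).
Proof.
move=> ia ib; apply: (intg_bounded (M := \int[mu]_x `|a x|) _ _ ib).
  exact: measurable_fsin.
by move=> t; exact: fsin_bound.
Qed.

(** With w = a + i b, this is the real part of the identity between the integral of the transform of
    u + i v times w and the integral of u + i v times the transform of w. *)
Lemma multiplication_formula u v a b : intg u -> intg v -> intg a -> intg b ->
  \int[mu]_t (fre u v t * a t - fim u v t * b t) = \int[mu]_x (u x * fre a b x - v x * fim a b x).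
Proof.
move=> iu iv ia ib.
rewrite (@eq_Rint _ _ (fun t => (a t * fcos u t + a t * fsin v t) - (b t * fcos v t - b t * fsin u t)));
  last by move=> t; rewrite /fre /fim; ring.
rewrite (@eq_Rint _ (fun x => u x * fre a b x - v x * fim a b x)
  (fun x => (u x * fcos a x + u x * fsin b x) - (v x * fcos b x - v x * fsin a x)));
  last by move=> t; rewrite /fre /fim; ring.
have c1 := intg_mul_fcos iu ia; have c2 := intg_mul_fsin iv ia.
have c3 := intg_mul_fcos iv ib; have c4 := intg_mul_fsin iu ib.
have d1 := intg_mul_fcos ia iu; have d2 := intg_mul_fsin ib iu.
have d3 := intg_mul_fcos ib iv; have d4 := intg_mul_fsin ia iv.
rewrite RintB; [|exact: intgD|exact: intgB].
rewrite (RintD c1 c2) (RintB c3 c4).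
rewrite [RHS]RintB; [|exact: intgD|exact: intgB].
rewrite (RintD d1 d2) (RintB d3 d4).
rewrite (Rint_fcos_sym iu ia) (Rint_fcos_sym iv ib) (Rint_fsin_sym iu ib) (Rint_fsin_sym iv ia).
move: (Rintegral _ _ _) (Rintegral _ _ _) (Rintegral _ _ _) (Rintegral _ _ _) => I1 I2 I3 I4.
ring.
Qed.

End Complex_pairs.

(** * From complex functions to pairs of real functions, and L^2 transforms *)

Section Complex_L2.
Context {R : realType}.
Local Notation mu := (@lebesgue_measure R).
Implicit Types f g : R -> R[i].

Definition re f x := complex.Re (f x).
Definition im f x := complex.Im (f x).

Lemma normc_sqr (z : R[i]) : Normc.normc z ^+ 2 = complex.Re z ^+ 2 + complex.Im z ^+ 2.
Proof. by case: z => a b /=; rewrite sqr_sqrtr// addr_ge0 ?sqr_ge0. Qed.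

Lemma normc_ge0 (z : R[i]) : 0 <= Normc.normc z.
Proof. by case: z => a b /=; exact: sqrtr_ge0. Qed.

Lemma cLnorm2_sqr f : (cLnorm 2%:E f `^ 2 = \int[mu]_x (re f x ^+ 2 + im f x ^+ 2)%:E)%E.
Proof.
rewrite /cLnorm powR_Lnorm//; apply: eq_integral => x _.
by rewrite abse_EFin poweR_EFin ger0_norm ?normc_ge0// powR_mulrn ?normc_ge0// normc_sqr.
Qed.

Lemma measurable_sq f : cmeasurable f -> measurable_fun setT (fun x => re f x ^+ 2 + im f x ^+ 2).
Proof. by move=> [mr mi]; apply: measurable_funD; apply: measurable_sqr. Qed.

Lemma sq_ge0 f x : 0 <= re f x ^+ 2 + im f x ^+ 2.
Proof. by rewrite addr_ge0 ?sqr_ge0. Qed.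

Lemma cLfun2P f : cLfun 2%:E f <-> sqintg (re f) /\ sqintg (im f).
Proof.
split=> [[[mr mi] fy]|[[mr ir] [mi ii]]].
  have i2 : intg (fun x => re f x ^+ 2 + im f x ^+ 2).
    apply: intg_lty; [exact: measurable_sq|exact: sq_ge0|].
    by rewrite -cLnorm2_sqr; exact: poweR_lty.
  by split; split => //; apply: le_intg i2; do ?[exact: measurable_sqr] => x;
    rewrite !ger0_norm ?sq_ge0 ?sqr_ge0// ?lerDl ?lerDr sqr_ge0.
split; first by split.
apply: (@lty_poweRy _ _ 2) => //; rewrite cLnorm2_sqr.
by apply: intg_int_lty; exact: intgD.
Qed.

Lemma cLnorm2E f : sqintg (re f) -> sqintg (im f) ->
  cLnorm 2%:E f = (Num.sqrt (\int[mu]_x (re f x ^+ 2 + im f x ^+ 2)))%:E.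
Proof.
move=> sr si; have := cLnorm2_sqr f.
have : (0 <= cLnorm 2%:E f)%E by exact: Lnorm_ge0.
rewrite -EFin_Rint; last by apply: intgD; exact: sqintg_sqr.
case: (cLnorm _ f) => [r|_|//]; last by rewrite poweRyr.
rewrite lee_fin poweR_EFin => r0 [] <-.
by rewrite powR_mulrn// sqrtr_sqr ger0_norm.
Qed.

Lemma cLfun1P f : cLfun 1%:E f <-> intg (re f) /\ intg (im f).
Proof.
have E : cLnorm 1%:E f = (\int[mu]_x (Normc.normc (f x))%:E)%E.
  by rewrite /cLnorm Lnorm1; apply: eq_integral => x _; rewrite /= ger0_norm ?normc_ge0.
split=> [[[mr mi] fy]|[ir ii]].
  have mn : measurable_fun setT (fun x => Normc.normc (f x)).
    have -> : (fun x => Normc.normc (f x)) = (fun x => Num.sqrt (re f x ^+ 2 + im f x ^+ 2)).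
      by apply/funext => x; rewrite -normc_sqr sqrtr_sqr ger0_norm ?normc_ge0.
    apply: measurableT_comp; last exact: measurable_sq.
    exact: continuous_measurable_fun (@sqrt_continuous R).
  have i2 : intg (fun x => Normc.normc (f x)).
    by apply: intg_lty => // [x|]; [exact: normc_ge0|rewrite -E].
  have le1 x : `|re f x| <= `|Normc.normc (f x)|.
    by rewrite -ler_sqr ?nnegrE// !real_normK ?num_real// normc_sqr lerDl sqr_ge0.
  have le2 x : `|im f x| <= `|Normc.normc (f x)|.
    by rewrite -ler_sqr ?nnegrE// !real_normK ?num_real// normc_sqr lerDr sqr_ge0.
  by split; [apply: le_intg le1 i2|apply: le_intg le2 i2].
have mf : cmeasurable f by split; exact: intg_measurable.
split => //; rewrite E.
apply: (@le_lt_trans _ _ (\int[mu]_x (`|re f x| + `|im f x|)%:E)%E).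
  apply: ge0_le_integral => //.
  - by move=> x _; rewrite lee_fin normc_ge0.
  - have -> : (fun x => (Normc.normc (f x))%:E) = (fun x => (Num.sqrt (re f x ^+ 2 + im f x ^+ 2))%:E).
      by apply/funext => x; rewrite -normc_sqr sqrtr_sqr ger0_norm ?normc_ge0.
    apply/measurable_EFinP; apply: measurableT_comp; last exact: measurable_sq.
    exact: continuous_measurable_fun (@sqrt_continuous R).
  - apply/measurable_EFinP; apply: intg_measurable.
    by apply: intgD; exact: intg_norm.
  - move=> x _; rewrite lee_fin -ler_sqr ?nnegrE ?normc_ge0 ?addr_ge0// normc_sqr.
    rewrite sqrrD !real_normK ?num_real// -addrA lerD2l lerDr mulrn_wge0// mulr_ge0//.
by apply: intg_int_lty; apply: intgD; exact: intg_norm.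
Qed.

Lemma cvg_L2P (u : nat -> R -> R[i]) f : (forall n, cLfun 2%:E (u n)) -> cLfun 2%:E f ->
  cvg_L2 u f <->
  \int[mu]_x ((re (u n) x - re f x) ^+ 2 + (im (u n) x - im f x) ^+ 2) @[n --> \oo] --> (0 : R).
Proof.
move=> hu /cLfun2P[fr fi].
have sr n : sqintg (fun x => re (u n) x - re f x).
  by have /cLfun2P[ur _] := hu n; exact: sqintgB.
have si n : sqintg (fun x => im (u n) x - im f x).
  by have /cLfun2P[_ ui] := hu n; exact: sqintgB.
pose I n := \int[mu]_x ((re (u n) x - re f x) ^+ 2 + (im (u n) x - im f x) ^+ 2).
have E n : cLnorm 2%:E (fun x => u n x - f x) = (Num.sqrt (I n))%:E.
  have reE : re (fun x => u n x - f x) = (fun x => re (u n) x - re f x).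
    by apply/funext => x; rewrite /re; case: (u n x) (f x) => ? ? [].
  have imE : im (fun x => u n x - f x) = (fun x => im (u n) x - im f x).
    by apply/funext => x; rewrite /im; case: (u n x) (f x) => ? ? [].
  by have := @cLnorm2E (fun x => u n x - f x); rewrite reE imE; apply.
rewrite /cvg_L2 (eq_cvg _ _ E) -/I.
have I0 n : 0 <= I n by apply: Rintegral_ge0 => x _; rewrite addr_ge0 ?sqr_ge0.
split=> [h|h].
  have {}h : Num.sqrt (I n) @[n --> \oo] --> (0 : R) by exact: (@fine_cvg _ _ _ _ (fun n => (Num.sqrt (I n))%:E) 0 h).
  have -> : I = (fun n => Num.sqrt (I n) * Num.sqrt (I n)).
    by apply/funext => n; rewrite -expr2 sqr_sqrtr.
  by rewrite -[X in _ --> X](mulr0 0); exact: cvgM.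
apply: cvg_EFin; first exact: nearW.
rewrite -[X in _ --> X]sqrtr0; apply: continuous_cvg => //; exact: sqrt_continuous.
Qed.

Lemma re_fourier1 f t : intg (re f) -> intg (im f) -> re (fourier1 f) t = fre (re f) (im f) t.
Proof.
move=> fr fi; rewrite /re /fourier1 /cintegral /= /fre /fcos /fsin.
rewrite -(RintD (intg_cos t fr) (intg_sin t fi)); apply: eq_Rint => x.
by rewrite /re /im; case: (f x) => r s; rewrite /cexpi /= cosN sinN; ring.
Qed.

Lemma im_fourier1 f t : intg (re f) -> intg (im f) -> im (fourier1 f) t = fim (re f) (im f) t.
Proof.
move=> fr fi; rewrite /im /fourier1 /cintegral /= /fim /fcos /fsin.
rewrite -(RintB (intg_cos t fi) (intg_sin t fr)); apply: eq_Rint => x.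
by rewrite /re /im; case: (f x) => r s; rewrite /cexpi /= cosN sinN; ring.
Qed.

Lemma Rint_sqrD_ge0 a b : 0 <= \int[mu]_x (a x ^+ 2 + b x ^+ 2).
Proof. by apply: Rintegral_ge0 => x _; rewrite addr_ge0 ?sqr_ge0. Qed.

Lemma cvg_L2_parts (a_ b_ : nat -> R -> R) a b :
  (forall n, sqintg (a_ n)) -> (forall n, sqintg (b_ n)) -> sqintg a -> sqintg b ->
  \int[mu]_x ((a_ n x - a x) ^+ 2 + (b_ n x - b x) ^+ 2) @[n --> \oo] --> (0 : R) ->
  \int[mu]_x ((a_ n x - a x) ^+ 2) @[n --> \oo] --> (0 : R) /\
  \int[mu]_x ((b_ n x - b x) ^+ 2) @[n --> \oo] --> (0 : R).
Proof.
move=> sa_ sb_ sa sb h.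
have ia n := sqintg_sqr (sqintgB (sa_ n) sa); have ib n := sqintg_sqr (sqintgB (sb_ n) sb).
by split; apply: squeeze_cvgr (cvg_cst (0 : R)) h; apply: nearW => n;
  rewrite Rint_sqr_ge0 (RintD (ia n) (ib n)) ?lerDl ?lerDr Rint_sqr_ge0.
Qed.

Lemma fourier2_limit f g : is_fourier2 f g ->
  exists ur ui : nat -> R -> R,
  [/\ forall n, [/\ intg (ur n), intg (ui n), sqintg (ur n) & sqintg (ui n)],
     \int[mu]_x ((ur n x - re f x) ^+ 2) @[n --> \oo] --> (0 : R),
     \int[mu]_x ((ui n x - im f x) ^+ 2) @[n --> \oo] --> (0 : R),
     \int[mu]_x ((fre (ur n) (ui n) x - re g x) ^+ 2) @[n --> \oo] --> (0 : R) &
     \int[mu]_x ((fim (ur n) (ui n) x - im g x) ^+ 2) @[n --> \oo] --> (0 : R)].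
Proof.
move=> [f2 g2 [u [u12 uf ug]]].
have /cLfun2P[fr fi] := f2; have /cLfun2P[gr gi] := g2.
have hu n : [/\ intg (re (u n)), intg (im (u n)), sqintg (re (u n)) & sqintg (im (u n))].
  by have [/cLfun1P[? ?] /cLfun2P[? ?]] := u12 n.
exists (fun n => re (u n)), (fun n => im (u n)).
have reE n : re (fourier1 (u n)) = fre (re (u n)) (im (u n)).
  by apply/funext => t; have [? ? _ _] := hu n; exact: re_fourier1.
have imE n : im (fourier1 (u n)) = fim (re (u n)) (im (u n)).
  by apply/funext => t; have [? ? _ _] := hu n; exact: im_fourier1.
have sF n : sqintg (fre (re (u n)) (im (u n))) by have [? ? ? ?] := hu n; exact: sqintg_fre.
have sG n : sqintg (fim (re (u n)) (im (u n))) by have [? ? ? ?] := hu n; exact: sqintg_fim.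
have hF n : cLfun 2%:E (fourier1 (u n)) by apply/cLfun2P; rewrite reE imE.
have sur n : sqintg (re (u n)) by case: (hu n).
have sui n : sqintg (im (u n)) by case: (hu n).
have [|h1 h2] := cvg_L2_parts sur sui fr fi.
  by apply/cvg_L2P => // n; have [] := u12 n.
have [|h3 h4] := cvg_L2_parts sF sG gr gi.
  by move: ug => /(cvg_L2P hF g2); under eq_fun do rewrite reE imE.
by split.
Qed.

(** The multiplication formula passes to the limit because both the test function a + i b and its
    transform are square-integrable. Together with the norm inequality below, this is how the
    definition of the L^2 transform is exploited. *)
Lemma fourier2_pairing f g a b : is_fourier2 f g ->
  intg a -> sqintg a -> intg b -> sqintg b ->
  \int[mu]_t (re g t * a t - im g t * b t) = \int[mu]_x (re f x * fre a b x - im f x * fim a b x).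
Proof.
move=> fg ia sa ib sb.
have [/cLfun2P[fr fi] /cLfun2P[gr gi] _] := fg.
have [ur [ui [hu h1 h2 h3 h4]]] := fourier2_limit fg.
have iur n : intg (ur n) by case: (hu n).
have iui n : intg (ui n) by case: (hu n).
have sur n : sqintg (ur n) by case: (hu n).
have sui n : sqintg (ui n) by case: (hu n).
have sF n : sqintg (fre (ur n) (ui n)) by exact: sqintg_fre.
have sG n : sqintg (fim (ur n) (ui n)) by exact: sqintg_fim.
have sA := sqintg_fre ia sa ib sb; have sB := sqintg_fim ia sa ib sb.
have L : \int[mu]_x (fre (ur n) (ui n) x * a x) - \int[mu]_x (fim (ur n) (ui n) x * b x)
    @[n --> \oo] --> \int[mu]_x (re g x * a x) - \int[mu]_x (im g x * b x).
  exact: cvgB (cvg_Rint_mul sF gr sa h3) (cvg_Rint_mul sG gi sb h4).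
have K : \int[mu]_x (ur n x * fre a b x) - \int[mu]_x (ui n x * fim a b x)
    @[n --> \oo] --> \int[mu]_x (re f x * fre a b x) - \int[mu]_x (im f x * fim a b x).
  exact: cvgB (cvg_Rint_mul sur fr sA h1) (cvg_Rint_mul sui fi sB h2).
rewrite (RintB (sqintgM gr sa) (sqintgM gi sb)) (RintB (sqintgM fr sA) (sqintgM fi sB)).
apply: (cvg_unique (@Rhausdorff R) L); apply: cvg_trans K.
apply: near_eq_cvg; apply: nearW => n /=.
rewrite -(RintB (sqintgM (sur n) sA) (sqintgM (sui n) sB)).
by rewrite -(RintB (sqintgM (sF n) sa) (sqintgM (sG n) sb)) multiplication_formula.
Qed.

Lemma fourier2_Plancherel_le f g : is_fourier2 f g ->
  \int[mu]_x (re g x ^+ 2 + im g x ^+ 2) <= \int[mu]_x (re f x ^+ 2 + im f x ^+ 2).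
Proof.
move=> fg; have [/cLfun2P[fr fi] /cLfun2P[gr gi] _] := fg.
have [ur [ui [hu h1 h2 h3 h4]]] := fourier2_limit fg.
have iur n : intg (ur n) by case: (hu n).
have iui n : intg (ui n) by case: (hu n).
have sur n : sqintg (ur n) by case: (hu n).
have sui n : sqintg (ui n) by case: (hu n).
have sF n : sqintg (fre (ur n) (ui n)) by exact: sqintg_fre.
have sG n : sqintg (fim (ur n) (ui n)) by exact: sqintg_fim.
have L : \int[mu]_x (fre (ur n) (ui n) x ^+ 2) + \int[mu]_x (fim (ur n) (ui n) x ^+ 2)
    @[n --> \oo] --> \int[mu]_x (re g x ^+ 2) + \int[mu]_x (im g x ^+ 2).
  exact: cvgD (cvg_Rint_sqr sF gr h3) (cvg_Rint_sqr sG gi h4).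
have K : \int[mu]_x (ur n x ^+ 2) + \int[mu]_x (ui n x ^+ 2)
    @[n --> \oo] --> \int[mu]_x (re f x ^+ 2) + \int[mu]_x (im f x ^+ 2).
  exact: cvgD (cvg_Rint_sqr sur fr h1) (cvg_Rint_sqr sui fi h2).
rewrite (RintD (sqintg_sqr gr) (sqintg_sqr gi)) (RintD (sqintg_sqr fr) (sqintg_sqr fi)).
apply: (ler_cvg_to L K); apply: nearW => n /=.
rewrite -(RintD (sqintg_sqr (sF n)) (sqintg_sqr (sG n))).
by rewrite -(RintD (sqintg_sqr (sur n)) (sqintg_sqr (sui n))) Plancherel_le.
Qed.

End Complex_L2.

(** * Damped inverse transforms and Poisson averages *)

Section Approximation.
Context {R : realType}.
Local Notation mu := (@lebesgue_measure R).
Implicit Types (h : R -> R).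

(** The integrand is odd. Adding [expdecay] makes it nonnegative, as the reflection lemma [Rint_opp]
    requires. *)
Lemma Rint_expdecay_sin (e t : R) : 0 < e ->
  \int[mu]_x (expdecay e x * sin (2 * pi * t * x)) = 0.
Proof.
move=> e0; pose G x := expdecay e x + expdecay e x * sin (2 * pi * t * x).
have ik := intg_expdecay e0.
have is_ : intg (fun x => expdecay e x * sin (2 * pi * t * x)).
  apply: (intg_bounded (M := 1)) ik; first by apply: continuous_measurable_fun; cont.
  by move=> x; exact: normr_sin_le1.
have iG : intg G by exact: intgD.
have G0 x : 0 <= G x.
  have -> : G x = expdecay e x * (1 + sin (2 * pi * t * x)) by rewrite /G; ring.
  by rewrite mulr_ge0 ?expdecay_ge0// -lerBlDl sub0r sin_geN1.
have := Rint_opp iG G0.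
rewrite (@eq_Rint _ _ (fun x => expdecay e x - expdecay e x * sin (2 * pi * t * x))); last first.
  by move=> x; rewrite /G expdecayN mulrN sinN mulrN.
rewrite (RintB ik is_) /G (RintD ik is_).
by move: (Rintegral _ _ _) (Rintegral _ _ _) => I J; lra.
Qed.

(** For a real [h], fcos h + i fsin h is its inverse transform. The two damped functions are the
    parts of [expdecay] times it: they are integrable, and the transform of the pair is the real
    function [smooth h n], the Poisson average of [h]. *)
Definition damp_re h n (t : R) := expdecay n.+1%:R^-1 t * fcos h t.
Definition damp_im h n (t : R) := expdecay n.+1%:R^-1 t * fsin h t.
Definition smooth h n (x : R) := \int[mu]_t (h t * poisson n.+1%:R^-1 (t - x)).

Let e0 n : 0 < n.+1%:R^-1 :> R. Proof. by rewrite invr_gt0. Qed.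

Lemma intg_damp_re h n : intg h -> intg (damp_re h n).
Proof. by move=> ih; apply: intg_mul_fcos => //; exact: intg_expdecay. Qed.

Lemma intg_damp_im h n : intg h -> intg (damp_im h n).
Proof. by move=> ih; apply: intg_mul_fsin => //; exact: intg_expdecay. Qed.

Lemma sqintg_bounded (f g : R -> R) (M : R) : measurable_fun setT g -> (forall x, `|g x| <= M) ->
  sqintg f -> sqintg (fun x => g x * f x).
Proof.
move=> mg gM [mf f2]; split; first exact: measurable_funM.
apply: (@eq_intg _ (fun x => f x ^+ 2 * g x ^+ 2)); first by move=> x; ring.
apply: (intg_bounded (M := M ^+ 2)) => //; first exact: measurable_sqr.
move=> x; rewrite ger0_norm ?sqr_ge0// -[g x ^+ 2]real_normK ?num_real//.
by rewrite ler_pXn2r// nnegrE ?(le_trans _ (gM x)).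
Qed.

Lemma measurable_expdecay (e : R) : measurable_fun setT (expdecay e).
Proof. by apply: continuous_measurable_fun; exact: continuous_expdecay. Qed.

Lemma expdecay_norm_le1 n (x : R) : `|expdecay n.+1%:R^-1 x| <= 1.
Proof. by rewrite ger0_norm ?expdecay_ge0// expdecay_le1. Qed.

Lemma sqintg_damp_re h n : intg h -> sqintg h -> sqintg (damp_re h n).
Proof.
move=> ih sh; apply: (sqintg_bounded (M := 1)); first exact: measurable_expdecay.
  by move=> x; exact: expdecay_norm_le1.
exact: sqintg_fcos.
Qed.

Lemma sqintg_damp_im h n : intg h -> sqintg h -> sqintg (damp_im h n).
Proof.
move=> ih sh; apply: (sqintg_bounded (M := 1)); first exact: measurable_expdecay.
  by move=> x; exact: expdecay_norm_le1.
exact: sqintg_fsin.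
Qed.

Lemma fre_damp h n x : intg h -> fre (damp_re h n) (damp_im h n) x = smooth h n x.
Proof.
move=> ih; rewrite /fre {1}/fcos {1}/fsin.
rewrite -(RintD (intg_cos x (intg_damp_re n ih)) (intg_sin x (intg_damp_im n ih))).
rewrite (@eq_Rint _ _ (fun t => expdecay n.+1%:R^-1 t *
    \int[mu]_y (h y * cos (2 * pi * (x - y) * t)))); last first.
  move=> t; rewrite -(fcos_shift x t ih) /damp_re /damp_im.
  by rewrite (mulrAC _ t x); move: (fcos h t) (fsin h t) => *; ring.
rewrite (Rint_Fubini (M := 1) (intg_expdecay (e0 n)) ih (K := fun t y => cos (2 * pi * (x - y) * t))).
- by apply: eq_Rint => y; rewrite Rint_expdecay_cos// poissonB.
- apply: measurable_fst_cos; apply: measurable_funM => //.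
  by apply: measurable_funM => //; exact: measurable_funB.
- by move=> *; exact: normr_cos_le1.
Qed.

Lemma fim_damp h n x : intg h -> fim (damp_re h n) (damp_im h n) x = 0.
Proof.
move=> ih; rewrite /fim {1}/fcos {1}/fsin.
rewrite -(RintB (intg_cos x (intg_damp_im n ih)) (intg_sin x (intg_damp_re n ih))).
rewrite (@eq_Rint _ _ (fun t => -1 * (expdecay n.+1%:R^-1 t *
    \int[mu]_y (h y * sin (2 * pi * (x - y) * t))))); last first.
  move=> t; rewrite -(fsin_shift x t ih) /damp_re /damp_im.
  by rewrite (mulrAC _ t x); move: (fcos h t) (fsin h t) => *; ring.
rewrite (@eq_Rint _ _ (fun t => expdecay n.+1%:R^-1 t *
    \int[mu]_y ((-1 * h y) * sin (2 * pi * (x - y) * t)))); last first.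
  move=> t; rewrite mulrCA; congr (_ * _); rewrite -RintZ; last first.
    apply: (intg_bounded (M := 1)) ih => [|y]; last exact: normr_sin_le1.
    by apply: continuous_measurable_fun; cont.
  by apply: eq_Rint => y; rewrite mulrA.
rewrite (Rint_Fubini (M := 1) (intg_expdecay (e0 n)) (intgZ (-1) ih) (K := fun t y => sin (2 * pi * (x - y) * t))).
- rewrite (@eq_Rint _ _ (fun=> 0)); first by rewrite /Rintegral integral0.
  by move=> y; rewrite Rint_expdecay_sin// mulr0.
- apply: measurable_fst_sin; apply: measurable_funM => //.
  by apply: measurable_funM => //; exact: measurable_funB.
- by move=> *; exact: normr_sin_le1.
Qed.

Lemma damp_cvg (p : R -> R) : sqintg p ->
  \int[mu]_t ((expdecay n.+1%:R^-1 t * p t - p t) ^+ 2) @[n --> \oo] --> (0 : R).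
Proof.
move=> sp.
have [||||_] := @cvg_Rint_dominated _ (fun n t => (expdecay n.+1%:R^-1 t * p t - p t) ^+ 2)
    (fun=> 0) (fun t => p t ^+ 2).
- move=> n; apply: measurable_sqr; apply: measurable_funB; last by case: sp.
  by apply: measurable_funM; [exact: measurable_expdecay|case: sp].
- exact: sqintg_sqr.
- move=> n t; have k0 := expdecay_ge0 n.+1%:R^-1 t; have := expdecay_norm_le1 n t.
  rewrite (ger0_norm k0) ger0_norm ?sqr_ge0//.
  move: (expdecay _ _) k0 => k k0 k1.
  have -> : (k * p t - p t) ^+ 2 = (1 - k) ^+ 2 * p t ^+ 2 by ring.
  rewrite ler_piMl ?sqr_ge0//; nra.
- move=> t; rewrite -[X in _ --> X](_ : (1 * p t - p t) * (1 * p t - p t) = 0); last by ring.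
  have K : expdecay n.+1%:R^-1 t * p t - p t @[n --> \oo] --> 1 * p t - p t.
    by apply: cvgB; [apply: cvgM; [exact: cvg_expdecay|exact: cvg_cst]|exact: cvg_cst].
  exact: (cvgM K K).
- by rewrite {2}/Rintegral integral0.
Qed.

Lemma measurable_smooth h n : intg h -> measurable_fun setT (smooth h n).
Proof.
move=> ih; apply: continuous_measurable_fun.
rewrite (_ : smooth h n = fun x => \int[mu]_t (h t * poisson n.+1%:R^-1 (x - t))).
  exact: continuous_conv_poisson.
by apply/funext => x; apply: eq_Rint => t; rewrite poissonB.
Qed.

Lemma sqintg_smooth h n : intg h -> sqintg h -> sqintg (smooth h n).
Proof.
move=> ih sh; have := sqintg_fre (intg_damp_re n ih) (sqintg_damp_re n ih sh)
  (intg_damp_im n ih) (sqintg_damp_im n ih sh).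
by rewrite (_ : fre _ _ = smooth h n)//; apply/funext => x; exact: fre_damp.
Qed.

Lemma expdecay_nondecreasing n m (x : R) : (n <= m)%N ->
  expdecay n.+1%:R^-1 x <= expdecay m.+1%:R^-1 x.
Proof.
move=> nm; rewrite /expdecay ler_expR lerN2 ler_wpM2r// lef_pV2 ?posrE//.
by rewrite ler_nat.
Qed.

(* The damped transforms form a Cauchy sequence in L2, so that by the Plancherel
   inequality the pointwise limit of their transforms is an L2 limit. *)
Lemma smooth_cvg_L2 h (chi : R -> R) : intg h -> sqintg h ->
  (forall x, smooth h n x @[n --> \oo] --> chi x) ->
  sqintg chi /\ \int[mu]_x ((smooth h n x - chi x) ^+ 2) @[n --> \oo] --> (0 : R).
Proof.
move=> ih sh hchi.
have mchi : measurable_fun setT chi.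
  by apply: (measurable_fun_cvg (h := smooth h)) => // n; exact: measurable_smooth.
have sp := sqintg_fcos ih sh; have sr := sqintg_fsin ih sh.
have iB n : intg (fun t => (expdecay n.+1%:R^-1 t * fcos h t - fcos h t) ^+ 2 +
    (expdecay n.+1%:R^-1 t * fsin h t - fsin h t) ^+ 2).
  apply: intgD; apply: sqintg_sqr; apply: sqintgB => //;
  [exact: sqintg_damp_re|exact: sqintg_damp_im].
pose B n := \int[mu]_t ((expdecay n.+1%:R^-1 t * fcos h t - fcos h t) ^+ 2 +
    (expdecay n.+1%:R^-1 t * fsin h t - fsin h t) ^+ 2).
have B0 : B n @[n --> \oo] --> (0 : R).
  have -> : B = (fun n => \int[mu]_t ((expdecay n.+1%:R^-1 t * fcos h t - fcos h t) ^+ 2) +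
      \int[mu]_t ((expdecay n.+1%:R^-1 t * fsin h t - fsin h t) ^+ 2)).
    apply/funext => n; rewrite /B RintD//; apply: sqintg_sqr; apply: sqintgB => //;
    [exact: sqintg_damp_re|exact: sqintg_damp_im].
  by rewrite -[X in _ --> X](addr0 0); apply: cvgD; exact: damp_cvg.
have mS n : measurable_fun setT (fun x => (smooth h n x - chi x) ^+ 2).
  by apply: measurable_sqr; apply: measurable_funB => //; exact: measurable_smooth.
have S n : (\int[mu]_x ((smooth h n x - chi x) ^+ 2)%:E <= (B n)%:E)%E.
  apply: (fatou_le (h := fun m x => (smooth h n x - smooth h m x) ^+ 2)).
  - by move=> m; apply: measurable_sqr; apply: measurable_funB; exact: measurable_smooth.
  - by move=> m x; exact: sqr_ge0.
  - move=> x; have K : smooth h n x - smooth h m x @[m --> \oo] --> smooth h n x - chi x.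
      by apply: cvgB; [exact: cvg_cst|exact: hchi].
    exact: (cvgM K K).
  - exists n => // m /= nm.
    have ir1 := intg_damp_re n ih; have ir2 := intg_damp_re m ih.
    have ii1 := intg_damp_im n ih; have ii2 := intg_damp_im m ih.
    have sr1 := sqintg_damp_re n ih sh; have sr2 := sqintg_damp_re m ih sh.
    have si1 := sqintg_damp_im n ih sh; have si2 := sqintg_damp_im m ih sh.
    have fcB (u v : R -> R) x : intg u -> intg v ->
        fcos (fun t => u t - v t) x = fcos u x - fcos v x.
      move=> iu iv; rewrite /fcos -(RintB (intg_cos x iu) (intg_cos x iv)).
      by apply: eq_Rint => t; ring.
    have fsB (u v : R -> R) x : intg u -> intg v ->
        fsin (fun t => u t - v t) x = fsin u x - fsin v x.
      move=> iu iv; rewrite /fsin -(RintB (intg_sin x iu) (intg_sin x iv)).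
      by apply: eq_Rint => t; ring.
    have := Plancherel_le (intgB ir1 ir2) (sqintgB sr1 sr2) (intgB ii1 ii2) (sqintgB si1 si2).
    have E x : fre (fun t => damp_re h n t - damp_re h m t) (fun t => damp_im h n t - damp_im h m t) x ^+ 2 +
       fim (fun t => damp_re h n t - damp_re h m t) (fun t => damp_im h n t - damp_im h m t) x ^+ 2 =
       (smooth h n x - smooth h m x) ^+ 2.
      rewrite -!fre_damp// /fre /fim fcB// fcB// fsB// fsB//.
      have := fim_damp n x ih; have := fim_damp m x ih; rewrite /fim.
      move: (fcos _ _) (fcos _ _) (fcos _ _) (fcos _ _) (fsin _ _) (fsin _ _) (fsin _ _) (fsin _ _).
      by move=> a1 a2 a3 a4 b1 b2 b3 b4 h1 h2; nra.
    rewrite (eq_Rint E) => le1.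
    rewrite -EFin_Rint; last by apply: sqintg_sqr; apply: sqintgB; exact: sqintg_smooth.
    rewrite lee_fin (le_trans le1)//; apply: le_Rint => //.
      by apply: intgD; apply: sqintg_sqr; exact: sqintgB.
    (* Two damping factors with indices n <= m satisfy 0 <= k <= l <= 1, so l - k <= 1 - k: the
       distance to the m-th average is bounded by [B n] uniformly in m. *)
    move=> t; have k0 := expdecay_ge0 n.+1%:R^-1 t; have l1 := expdecay_norm_le1 m t.
    rewrite (ger0_norm (expdecay_ge0 _ _)) in l1; have kl := expdecay_nondecreasing t nm.
    rewrite /damp_re /damp_im; move: k0 l1 kl.
    move: (expdecay n.+1%:R^-1 _) (expdecay m.+1%:R^-1 _) (fcos h t) (fsin h t).
    move=> k l p r k0 l1 kl.
    rewrite -!mulrBl.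
    have -> : (k * p - p) ^+ 2 + (k * r - r) ^+ 2 = (1 - k) ^+ 2 * (p ^+ 2 + r ^+ 2) by ring.
    have -> : ((k - l) * p) ^+ 2 + ((k - l) * r) ^+ 2 = (l - k) ^+ 2 * (p ^+ 2 + r ^+ 2) by ring.
    rewrite ler_wpM2r ?addr_ge0 ?sqr_ge0// ler_pXn2r ?nnegrE ?subr_ge0//.
      by rewrite lerD2r.
    by rewrite (le_trans kl).
have iS n : intg (fun x => (smooth h n x - chi x) ^+ 2).
  by apply: intg_lty => // [x|]; [exact: sqr_ge0|exact: le_lt_trans (S n) (ltry _)].
split.
  have s0 : sqintg (fun x => smooth h 0 x - chi x).
    by split => //; apply: measurable_funB => //; exact: measurable_smooth.
  have [m1 m2] := sqintgB (sqintg_smooth 0 ih sh) s0; split => //.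
  by apply: eq_intg m2 => x; ring.
apply: squeeze_cvgr (cvg_cst (0 : R)) B0; apply: nearW => n.
by rewrite Rint_sqr_ge0 -lee_fin EFin_Rint//; exact: S.
Qed.

End Approximation.

(** * Inversion on the Paley-Wiener space *)

Section Inversion.
Context {R : realType}.
Local Notation mu := (@lebesgue_measure R).
Implicit Types (h : R -> R) (f g : R -> R[i]).

(** The real and imaginary parts of the pairing of g with the inverse transform F = fcos h + i fsin
    h, equal to the pairing of f with the limit of the Poisson averages. The identity holds for the
    damped F by [fourier2_pairing], and both sides converge when the damping is removed. *)
Lemma fourier2_smooth f g h (chi : R -> R) : is_fourier2 f g -> intg h -> sqintg h ->
  (forall x, smooth h n x @[n --> \oo] --> chi x) ->
  \int[mu]_t (re g t * fcos h t - im g t * fsin h t) = \int[mu]_x (re f x * chi x) /\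
  \int[mu]_t (re g t * fsin h t + im g t * fcos h t) = \int[mu]_x (im f x * chi x).
Proof.
move=> fg ih sh hchi.
have [/cLfun2P[fr fi] /cLfun2P[gr gi] _] := fg.
have [schi hc] := smooth_cvg_L2 ih sh hchi.
have sp := sqintg_fcos ih sh; have sr := sqintg_fsin ih sh.
have ir n := intg_damp_re n ih; have ii n := intg_damp_im n ih.
have sdr n := sqintg_damp_re n ih sh; have sdi n := sqintg_damp_im n ih sh.
have ss n := sqintg_smooth n ih sh.
have L (v u q : R -> R) : sqintg v -> sqintg u -> sqintg q ->
    (forall n, sqintg (fun t => expdecay n.+1%:R^-1 t * q t)) ->
    \int[mu]_t (u t * (expdecay n.+1%:R^-1 t * q t)) @[n --> \oo] --> \int[mu]_t (u t * q t).
  move=> sv su sq sqn; have := cvg_Rint_mul sqn sq su (damp_cvg sq).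
  rewrite (@eq_Rint _ _ (fun t => u t * q t)); last by move=> t; rewrite mulrC.
  apply: cvg_trans; apply: near_eq_cvg; apply: nearW => n.
  by apply: eq_Rint => t; rewrite mulrC.
have K (u : R -> R) : sqintg u -> \int[mu]_t (u t * smooth h n t) @[n --> \oo] --> \int[mu]_t (u t * chi t).
  move=> su; have := cvg_Rint_mul ss schi su hc.
  rewrite (@eq_Rint _ _ (fun t => u t * chi t)); last by move=> t; rewrite mulrC.
  apply: cvg_trans; apply: near_eq_cvg; apply: nearW => n.
  by apply: eq_Rint => t; rewrite mulrC.
have E1 n : \int[mu]_t (re g t * damp_re h n t) - \int[mu]_t (im g t * damp_im h n t) =
    \int[mu]_x (re f x * smooth h n x).
  rewrite -(RintB (sqintgM gr (sdr n)) (sqintgM gi (sdi n))) (fourier2_pairing fg)//.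
  by apply: eq_Rint => x; rewrite fim_damp// fre_damp// mulr0 subr0.
have E2 n : \int[mu]_t (re g t * damp_im h n t) + \int[mu]_t (im g t * damp_re h n t) =
    \int[mu]_x (im f x * smooth h n x).
  (* The imaginary part is obtained as a real part, by testing against i F, whose parts are -
     [damp_im] and [damp_re]. *)
  have := fourier2_pairing fg (intgZ (-1) (ii n)) (sqintgZ (-1) (sdi n)) (ir n) (sdr n).
  rewrite (@eq_Rint _ _ (fun t => -1 * (re g t * damp_im h n t + im g t * damp_re h n t)));
    last by move=> t; ring.
  rewrite (@eq_Rint _ (fun x => re f x * _ - _) (fun t => -1 * (im f t * smooth h n t))); last first.
    move=> x; rewrite -(fre_damp n x ih).
    have -> : fre (fun t => -1 * damp_im h n t) (damp_re h n) x = - fim (damp_re h n) (damp_im h n) x.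
      rewrite /fre /fim opprB addrC; congr (_ + _).
      rewrite -[RHS]mulN1r /fcos -(RintZ _ (intg_cos x (ii n))).
      by apply: eq_Rint => t; rewrite mulrA.
    have -> : fim (fun t => -1 * damp_im h n t) (damp_re h n) x = fre (damp_re h n) (damp_im h n) x.
      rewrite /fre /fim; congr (_ + _).
      rewrite -[LHS]mulN1r /fsin -(RintZ _); last first.
        exact: intg_sin (intgZ (-1) (ii n)).
      by apply: eq_Rint => t; ring.
    by rewrite fim_damp// oppr0 mulr0 sub0r mulN1r.
  rewrite (RintZ _ (intgD (sqintgM gr (sdi n)) (sqintgM gi (sdr n)))) (RintZ _ (sqintgM fi (ss n))).
  move=> /(mulfI _) <-; first by rewrite (RintD (sqintgM gr (sdi n)) (sqintgM gi (sdr n))).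
  by rewrite oppr_eq0 oner_eq0.
split.
  rewrite (RintB (sqintgM gr sp) (sqintgM gi sr)).
  apply: (cvg_unique (@Rhausdorff R) _ (K _ fr)).
  have H : \int[mu]_t (re g t * damp_re h n t) - \int[mu]_t (im g t * damp_im h n t) @[n --> \oo]
      --> \int[mu]_t (re g t * fcos h t) - \int[mu]_t (im g t * fsin h t).
    by apply: cvgB; [exact: (L _ _ _ gr)|exact: (L _ _ _ gr)].
  by apply: cvg_trans H; apply: near_eq_cvg; apply: nearW => n; rewrite E1.
rewrite (RintD (sqintgM gr sr) (sqintgM gi sp)).
apply: (cvg_unique (@Rhausdorff R) _ (K _ fi)).
have H : \int[mu]_t (re g t * damp_im h n t) + \int[mu]_t (im g t * damp_re h n t) @[n --> \oo]
    --> \int[mu]_t (re g t * fsin h t) + \int[mu]_t (im g t * fcos h t).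
  by apply: cvgD; [exact: (L _ _ _ gr)|exact: (L _ _ _ gr)].
by apply: cvg_trans H; apply: near_eq_cvg; apply: nearW => n; rewrite E2.
Qed.

Definition ind (a b : R) : R -> R := \1_`[a, b].

Lemma indE a b x : ind a b x = (a <= x <= b)%R%:R.
Proof.
rewrite /ind indicE (_ : (x \in _) = (a <= x <= b)%R)//.
by apply/idP/idP; rewrite inE/= in_itv. Qed.

Lemma ind_sqr a b x : ind a b x ^+ 2 = ind a b x.
Proof. by rewrite indE; case: (_ <= _ <= _); rewrite ?expr1n// expr0n. Qed.

Lemma intg_ind a b : intg (ind a b).
Proof. exact: integrable_indic_itv. Qed.

Lemma sqintg_ind a b : sqintg (ind a b).
Proof.
split; first by apply: intg_measurable; exact: intg_ind.
by apply: eq_intg (intg_ind a b) => x; rewrite ind_sqr.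
Qed.

Lemma ind_mul (a b : R) (f : R -> R) x : ind a b x * f x = (f \_ `[a, b]) x.
Proof.
rewrite patchE /ind indicE; case: ifPn => _; first by rewrite mul1r.
by rewrite mul0r.
Qed.

Lemma Rint_ind (a b : R) (f : R -> R) : \int[mu]_x (ind a b x * f x) = \int[mu]_(x in `[a, b]) f x.
Proof. by rewrite [RHS]Rintegral_mkcond; apply: eq_Rint => x; rewrite ind_mul. Qed.

Lemma Rint_ind1 (a b : R) : a <= b -> \int[mu]_x ind a b x = b - a.
Proof.
move=> ab; rewrite (@eq_Rint _ _ (fun x => ind a b x * 1)); last by move=> x; rewrite mulr1.
rewrite Rint_ind Rintegral_cst ?mul1r; last exact: measurable_itv.
rewrite (_ : fine _ = fine (@lebesgue_measure R `[a, b]%classic))// lebesgue_measure_itv/= lte_fin.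
by move: ab; rewrite le_eqVlt => /predU1P[->|->]//=; rewrite ltxx subrr.
Qed.

(** The pointwise limit of the Poisson averages of [ind a b]; for a < b it differs from the
    indicator only at the two endpoints, where it is 1/2. *)
Definition chi (a b x : R) : R := (Num.sg (b - x) - Num.sg (a - x)) / 2.

Lemma cvg_atan_sg (y : R) :
  atan (2 * pi * y / n.+1%:R^-1) @[n --> \oo] --> Num.sg y * (pi / 2).
Proof.
have pos (z : R) : 0 < z -> atan (2 * pi * z / n.+1%:R^-1) @[n --> \oo] --> pi / 2.
  move=> z0; apply: (cvg_comp (fun n : nat => 2 * pi * z / n.+1%:R^-1) (@atan R)); last exact: cvgy_atan.
  apply/cvgryPge => A.
  have c0 : 0 < 2 * pi * z by rewrite !mulr_gt0 ?pi_gt0.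
  near=> n; rewrite invrK -ler_pdivrMl//.
  apply: (@le_trans _ _ n%:R); last by rewrite ler_nat.
  by near: n; exact: nbhs_infty_ger.
have [y0|y0|->] := ltrgtP y 0.
- rewrite ltr0_sg// mulN1r.
  have -> : (fun n : nat => atan (2 * pi * y / n.+1%:R^-1)) = (fun n => - atan (2 * pi * (- y) / n.+1%:R^-1)).
    by apply/funext => n; rewrite -atanN mulrN mulNr opprK.
  by apply: cvgN; apply: pos; rewrite oppr_gt0.
- by rewrite gtr0_sg// mul1r; exact: pos.
- rewrite sgr0 mul0r; have -> : (fun n : nat => atan (2 * pi * 0 / n.+1%:R^-1)) = (fun=> 0 : R).
    by apply/funext => n; rewrite mulr0 mul0r atan0.
  exact: cvg_cst.
Unshelve. all: by end_near. Qed.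

Lemma smooth_ind_cvg a b x : a <= b -> smooth (ind a b) n x @[n --> \oo] --> chi a b x.
Proof.
move=> ab.
have -> : smooth (ind a b) ^~ x = (fun n => (atan (2 * pi * (b - x) / n.+1%:R^-1) -
    atan (2 * pi * (a - x) / n.+1%:R^-1)) / pi).
  apply/funext => n; rewrite /smooth Rint_ind /Rintegral integral_poisson_itv//.
have -> : chi a b x = (Num.sg (b - x) * (pi / 2) - Num.sg (a - x) * (pi / 2)) / pi.
  by rewrite -mulrBl /chi -!mulrA; congr (_ * _); rewrite mulrCA mulfV ?mulr1// gt_eqF ?pi_gt0.
apply: cvgM; last exact: cvg_cst.
by apply: cvgB; exact: cvg_atan_sg.
Qed.

Lemma chi_ind a b x : x != a -> x != b -> a <= b -> chi a b x = ind a b x.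
Proof.
rewrite /chi indE => xa xb ab.
have [ax|ax|ax] := ltrgtP a x; last by rewrite ax eqxx in xa.
- have [bx|bx|bx] := ltrgtP b x; last by rewrite bx eqxx in xb.
  + by rewrite !ltr0_sg ?subr_lt0// subrr mul0r andbF.
  + by rewrite gtr0_sg ?subr_gt0// ltr0_sg ?subr_lt0//= mulr1n; lra.
- have bx : x < b by rewrite (lt_le_trans ax).
  by rewrite !gtr0_sg ?subr_gt0// subrr mul0r.
Qed.

Lemma chi_out a b x : a <= b -> ~~ (a <= x <= b) -> chi a b x = 0.
Proof.
move=> ab xab; rewrite chi_ind//; first by rewrite indE (negbTE xab).
  by apply: contra xab => /eqP ->; rewrite lexx.
by apply: contra xab => /eqP ->; rewrite lexx ab.
Qed.

Lemma ae_imply (P Q : R -> Prop) : (forall x, P x -> Q x) ->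
  {ae mu, forall x, P x} -> {ae mu, forall x, Q x}.
Proof.
move=> PQ; apply: filterS; first exact: (ae_filter_ringOfSetsType mu).
exact: PQ.
Qed.

Lemma ae_imply2 (P Q S : R -> Prop) : (forall x, P x -> Q x -> S x) ->
  {ae mu, forall x, P x} -> {ae mu, forall x, Q x} -> {ae mu, forall x, S x}.
Proof.
move=> PQ; apply: filterS2; first exact: (ae_filter_ringOfSetsType mu).
exact: PQ.
Qed.

Lemma Rint_ae_eq (u v : R -> R) : measurable_fun setT u -> measurable_fun setT v ->
  {ae mu, forall x, u x = v x} -> \int[mu]_x u x = \int[mu]_x v x.
Proof.
move=> mu_ mv uv; rewrite /Rintegral; congr fine; apply: ae_eq_integral => //.
- exact/measurable_EFinP.
- exact/measurable_EFinP.
- by apply: ae_imply uv => x -> _.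
Qed.

Lemma sqintg_chi a b : a <= b -> sqintg (chi a b).
Proof.
move=> ab; have [|//] := @smooth_cvg_L2 _ _ (chi a b) (intg_ind a b) (sqintg_ind a b).
by move=> x; exact: smooth_ind_cvg.
Qed.

Lemma Rint_chi (u : R -> R) a b : measurable_fun setT u -> a <= b ->
  \int[mu]_x (u x * chi a b x) = \int[mu]_x (ind a b x * u x).
Proof.
move=> mu_ ab; apply: Rint_ae_eq.
- by apply: measurable_funM => //; case: (sqintg_chi ab).
- by apply: measurable_funM => //; apply: intg_measurable; exact: intg_ind.
- have N (c : R) : {ae mu, forall x, x != c}.
    exists [set c]; split => //; first exact: lebesgue_measure_set1.
    by move=> x /= /negP; rewrite negbK => /eqP.
  apply: ae_imply2 (N b) (N a) => x xb xa.
  by rewrite chi_ind// mulrC.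
Qed.

Lemma locally_integrable_intg (w : R -> R) : measurable_fun setT w ->
  (forall a b, intg (fun x => ind a b x * w x)) -> locally_integrable setT w.
Proof.
move=> mw iw; split => //; first exact: openT.
move=> K _ cK; have mK : measurable K by apply: closed_measurable; exact: compact_closed.
have [M [_ /(_ (M + 1)) KM]] := compact_bounded cK.
have {}KM : K `<=` `[- (M + 1), M + 1]%classic.
  by move=> x Kx; rewrite /= in_itv/= -ler_norml; apply: KM => //; rewrite ltrDl.
apply: (@le_lt_trans _ _ (\int[mu]_(x in `[(- (M + 1))%R, (M + 1)%R]) `|w x|%:E)%E).
  apply: ge0_subset_integral => //.
  by apply/measurable_EFinP; apply: measurable_funTS; exact: measurableT_comp.
rewrite integral_mkcond; apply: le_lt_trans (intg_int_lty (intg_norm (iw (- (M + 1)) (M + 1)))).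
rewrite le_eqVlt; apply/orP; left; apply/eqP; apply: eq_integral => x _.
rewrite ind_mul !patchE; case: ifP => //; by rewrite normr0.
Qed.

(** The primitive of [w] starting at -n vanishes identically, while by Lebesgue differentiation its
    derivative is [w] almost everywhere to the right of -n. Countably many starting points exhaust
    the line. *)
Lemma ae_eq0_of_integrals (w : R -> R) : measurable_fun setT w ->
  (forall a b, intg (fun x => ind a b x * w x)) ->
  (forall a b, a <= b -> \int[mu]_x (ind a b x * w x) = 0) ->
  {ae mu, forall x, w x = 0}.
Proof.
move=> mw iw w0.
have iab a b : mu.-integrable `[a, b] (EFin \o w).
  apply/integrable_mkcond => //; apply: eq_integrable (iw a b) => // x _.
  by rewrite /= ind_mul !patchE; case: ifP.
have P (n : nat) : {ae mu, forall x, - n%:R < x -> w x = 0}.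
  have := @FTC1 R w (BLeft (- n%:R)) (fun y => iab _ y) (locally_integrable_intg mw iw).
  apply: ae_imply => x /= h nx; have [|_ <-] := h; first by rewrite lte_fin.
  rewrite derive1E; have -> : (fun y => \int[mu]_(t in `[(- n%:R)%R, y]) w t) = cst 0.
    apply/funext => y; have [ny|ny] := leP (- n%:R) y.
      by rewrite -Rint_ind w0.
    by rewrite set_itv_ge ?Rintegral_set0// bnd_simp -ltNge.
  by rewrite derive_cst.
have := ae_foralln P; apply: ae_imply => x h.
apply: (h (Num.truncn `|x|).+1); rewrite ltrNl.
by rewrite (le_lt_trans _ (truncnS_gt _))// -normrN ler_norm.
Qed.

(** The definition of the support provides a negligible piece around each outside point, hence
    uncountably many pieces. Shrinking the neighbourhoods to intervals with rational ends leaves a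
    countable union. *)
Lemma ess_supp_ae0 g (a b : R) : ess_supp g `<=` `[a, b] ->
  {ae mu, forall x, ~~ (a <= x <= b) -> g x = 0}.
Proof.
move=> gab.
pose S := [set y | g y != 0].
pose U2 (p : rat * rat) := `]ratr p.1 : R, ratr p.2 : R[%classic `&` S.
(* An enumeration of the pieces over rational intervals, replaced by the empty set when they are not
   negligible, so that every term is negligible. *)
pose F (n : nat) : set R := if unpickle n is Some p then
  (if `[< mu.-negligible (U2 p) >] then U2 p else set0) else set0.
have NF n : mu.-negligible (F n).
  rewrite /F; case: unpickle => [p|]; last exact: negligible_set0.
  by case: asboolP => // _; exact: negligible_set0.
have FE p : F (pickle p) = if `[< mu.-negligible (U2 p) >] then U2 p else set0.
  by rewrite /F pickleK.
apply: negligibleS (negligible_bigcup NF) => x /= /not_implyP[xab gx].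
have : ~ ess_supp g x by move=> /gab /=; rewrite in_itv/= => h; rewrite h in xab.
rewrite /ess_supp /= => /existsNP[U] /not_implyP[oU] /not_implyP[Ux] /contrapT NU.
have /nbhs_ballP[e /= e0 eU] : nbhs x U by exact: open_nbhs_nbhs.
have [q] : exists q : rat, ratr q \in `](x - e), x[ by apply: rat_in_itvoo; rewrite ltrBlDr ltrDl.
have [r] : exists r : rat, ratr r \in `]x, (x + e)[ by apply: rat_in_itvoo; rewrite ltrDl.
rewrite !in_itv/= => /andP[xr re] /andP[eq qx].
exists (pickle (q, r)); first exact: I.
rewrite FE.
have sub : U2 (q, r) `<=` U `&` S.
  move=> y [/=]; rewrite in_itv/= => /andP[qy yr] Sy; split => //; apply: eU.
  by rewrite /ball/= ltr_norml; apply/andP; split; lra.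
case: asboolP => [_|[]]; last exact: negligibleS NU.
by split; [rewrite /= in_itv/= qx xr|exact/eqP].
Qed.

(* The continuous representative of a band-limited function, from the pair
   [(a, b)] of the real and imaginary parts of its transform. *)
Definition inv_re (a b : R -> R) x := fcos a x - fsin b x.
Definition inv_im (a b : R -> R) x := fsin a x + fcos b x.

(** The pair (a, b) is g cut to the box, which alters g on a null set only and, g being
    square-integrable, makes it integrable: the inversion integral is then a genuine continuous
    function. Its agreement with f is tested on all intervals [p, q]. *)
Lemma PW2_inversion f : PW2 f -> exists a b : R -> R,
  [/\ intg a /\ intg b, sqintg a /\ sqintg b,
    forall x, a x = ind (- 2^-1) 2^-1 x * a x /\ b x = ind (- 2^-1) 2^-1 x * b x,
    \int[mu]_x (a x ^+ 2 + b x ^+ 2) <= \int[mu]_x (re f x ^+ 2 + im f x ^+ 2) &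
    {ae mu, forall x, re f x = inv_re a b x /\ im f x = inv_im a b x}].
Proof.
move=> [/cLfun2P[fr fi] [g [fg gsupp]]].
have [_ /cLfun2P[gr gi] _] := fg.
pose J := ind (- 2^-1) 2^-1 : R -> R.
have sJ : sqintg J by exact: sqintg_ind.
have J2 x : J x = J x * J x by rewrite -expr2 ind_sqr.
have J01 x : `|J x| <= 1 by rewrite /J indE; case: (_ <= _ <= _); rewrite ?normr1 ?normr0.
have mJ : measurable_fun setT J by case: sJ.
pose a x := J x * re g x; pose b x := J x * im g x.
have ia : intg a by exact: sqintgM.
have ib : intg b by exact: sqintgM.
have sa : sqintg a by exact: sqintg_bounded gr.
have sb : sqintg b by exact: sqintg_bounded gi.
have ae_g : {ae mu, forall x, re g x = a x /\ im g x = b x}.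
  apply: ae_imply (ess_supp_ae0 gsupp) => x gx0; rewrite /a /b /J indE.
  have [_|/gx0 gx] := boolP (_ <= _ <= _); first by rewrite !mul1r.
  by rewrite /re /im gx !mul0r.
exists a, b; split => //.
- by move=> x; rewrite /a /b !mulrA -!J2.
- apply: le_trans (fourier2_Plancherel_le fg); rewrite le_eqVlt; apply/orP; left; apply/eqP.
  apply: Rint_ae_eq.
  + by apply: measurable_funD; apply: measurable_sqr; [case: sa|case: sb].
  + by apply: measurable_funD; apply: measurable_sqr; [case: gr|case: gi].
  + by apply: ae_imply ae_g => x [-> ->].
have mA : measurable_fun setT (inv_re a b).
  by apply: measurable_funB; [exact: measurable_fcos|exact: measurable_fsin].
have mB : measurable_fun setT (inv_im a b).
  by apply: measurable_funD; [exact: measurable_fsin|exact: measurable_fcos].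
have ii (p q : R) : intg (ind p q) by exact: intg_ind.
have iA p q : intg (fun x => ind p q x * inv_re a b x).
  apply: eq_intg (intgB (intg_mul_fcos ia (ii p q)) (intg_mul_fsin ib (ii p q))) => x.
  by rewrite -mulrBr.
have iB p q : intg (fun x => ind p q x * inv_im a b x).
  apply: eq_intg (intgD (intg_mul_fsin ia (ii p q)) (intg_mul_fcos ib (ii p q))) => x.
  by rewrite -mulrDr.
(* The pairing of f with an interval becomes a pairing of (a, b) with the cosine and sine transforms
   of that interval; the symmetry of these transforms moves them onto [a] and [b], where they form
   the inversion integral. *)
have main p q : p <= q ->
    \int[mu]_x (ind p q x * re f x) = \int[mu]_x (ind p q x * inv_re a b x) /\
    \int[mu]_x (ind p q x * im f x) = \int[mu]_x (ind p q x * inv_im a b x).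
  move=> pq; have [] := fourier2_smooth fg (ii p q) (sqintg_ind p q) (fun x => @smooth_ind_cvg p q x pq).
  rewrite (Rint_chi fr.1 pq) (Rint_chi fi.1 pq) => <- <-.
  have sp := sqintg_fcos (ii p q) (sqintg_ind p q); have sr := sqintg_fsin (ii p q) (sqintg_ind p q).
  have mp := sp.1; have mr := sr.1; have mgr := gr.1; have mgi := gi.1.
  have ma := sa.1; have mb := sb.1.
  split.
    transitivity (\int[mu]_t (a t * fcos (ind p q) t - b t * fsin (ind p q) t)).
      apply: Rint_ae_eq; [by apply: measurable_funB; exact: measurable_funM|
        by apply: measurable_funB; exact: measurable_funM|].
      by apply: ae_imply ae_g => x [-> ->].
    rewrite (RintB (intg_mul_fcos (ii p q) ia) (intg_mul_fsin (ii p q) ib)).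
    rewrite (Rint_fcos_sym (ii p q) ia) (Rint_fsin_sym (ii p q) ib).
    rewrite -(RintB (intg_mul_fcos ia (ii p q)) (intg_mul_fsin ib (ii p q))).
    by apply: eq_Rint => x; rewrite -mulrBr.
  transitivity (\int[mu]_t (a t * fsin (ind p q) t + b t * fcos (ind p q) t)).
    apply: Rint_ae_eq; [by apply: measurable_funD; exact: measurable_funM|
      by apply: measurable_funD; exact: measurable_funM|].
    by apply: ae_imply ae_g => x [-> ->].
  rewrite (RintD (intg_mul_fsin (ii p q) ia) (intg_mul_fcos (ii p q) ib)).
  rewrite (Rint_fcos_sym (ii p q) ib) (Rint_fsin_sym (ii p q) ia).
  rewrite -(RintD (intg_mul_fsin ia (ii p q)) (intg_mul_fcos ib (ii p q))).
  by apply: eq_Rint => x; rewrite -mulrDr.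
have fin (u v : R -> R) : sqintg u -> measurable_fun setT v ->
    (forall p q, intg (fun x => ind p q x * v x)) ->
    (forall p q, p <= q -> \int[mu]_x (ind p q x * u x) = \int[mu]_x (ind p q x * v x)) ->
    {ae mu, forall x, u x = v x}.
  move=> su mv iv uv.
  have iu p q : intg (fun x => ind p q x * u x) by apply: sqintgM => //; exact: sqintg_ind.
  have : {ae mu, forall x, u x - v x = 0}.
    apply: (@ae_eq0_of_integrals (fun x => u x - v x)).
    - by apply: measurable_funB => //; case: su.
    - move=> p q; apply: eq_intg (intgB (iu p q) (iv p q)) => x.
      by rewrite mulrBr.
    - move=> p q pq; rewrite (@eq_Rint _ _ (fun x => ind p q x * u x - ind p q x * v x)).
        by rewrite (RintB (iu p q) (iv p q)) uv// subrr.
      by move=> x; rewrite mulrBr.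
  by apply: ae_imply => x /eqP; rewrite subr_eq0 => /eqP.
have h1 := fin _ _ fr mA iA (fun p q pq => (main p q pq).1).
have h2 := fin _ _ fi mB iB (fun p q pq => (main p q pq).2).
by apply: ae_imply2 h1 h2 => x -> ->.
Qed.

End Inversion.

(** * The sinc kernel and the two-point inequality *)

Section Sinc.
Context {R : realType}.
Local Notation mu := (@lebesgue_measure R).
Implicit Types x y t : R.

Definition box : R -> R := ind (- 2^-1) 2^-1.
(** As an integral, sinc needs no separate value at 0 and inherits continuity and bounds from
    [fcos]; [sincE] relates it to sin (pi x) / (pi x). *)
Definition sinc : R -> R := fcos box.

Lemma half_itv : - 2^-1 <= 2^-1 :> R.
Proof. lra. Qed.

Lemma intg_box : intg box. Proof. exact: intg_ind. Qed.

Lemma sqintg_box : sqintg box. Proof. exact: sqintg_ind. Qed.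

Lemma boxN t : box (- t) = box t.
Proof. by rewrite /box !indE lerNr opprK lerNl andbC. Qed.

Lemma Rint_box : \int[mu]_t box t = 1.
Proof. by rewrite Rint_ind1 ?half_itv//; lra. Qed.

Lemma fsin_box x : fsin box x = 0.
Proof.
have iS := intg_sin x intg_box.
pose G t := box t + box t * sin (2 * pi * t * x).
have G0 t : 0 <= G t.
  have -> : G t = box t * (1 + sin (2 * pi * t * x)) by rewrite /G; ring.
  by rewrite mulr_ge0 ?indE// -lerBlDl sub0r sin_geN1.
have := Rint_opp (intgD intg_box iS) G0.
rewrite (@eq_Rint _ _ (fun t => box t - box t * sin (2 * pi * t * x))); last first.
  by move=> t; rewrite /G boxN mulrN mulNr sinN mulrN.
rewrite (RintB intg_box iS) /G (RintD intg_box iS) -/(fsin box x).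
by move: (Rintegral _ _ _) (fsin _ _) => I J; lra.
Qed.

Lemma continuous_sinc : continuous sinc.
Proof. by apply: continuous_fcos; exact: intg_box. Qed.

Lemma sqintg_sinc : sqintg sinc.
Proof. by apply: sqintg_fcos; [exact: intg_box|exact: sqintg_box]. Qed.

Lemma normr_sinc_le1 x : `|sinc x| <= 1.
Proof.
have := fcos_bound x intg_box; rewrite (@eq_Rint _ (fun x => `|box x|) box) ?Rint_box//.
by move=> t; rewrite ger0_norm// indE.
Qed.

Lemma sincE x : pi * x * sinc x = sin (pi * x).
Proof.
have [->|x0] := eqVneq x 0; first by rewrite mulr0 mul0r sin0.
have px : 2 * pi * x != 0 :> R by rewrite mulf_neq0// gt_eqF// mulr_gt0// pi_gt0.
rewrite /sinc /fcos Rint_ind /Rintegral.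
pose F t := sin (2 * pi * t * x) / (2 * pi * x).
have dF t : is_derive t 1 F (cos (2 * pi * t * x)).
  apply: is_derive_eq; rewrite /GRing.scale/=.
  move: px; move: (pi : R) => p px; field.
  by move: px; rewrite !mulf_eq0 !negb_or => /andP[/andP[_ ->] ->].
rewrite (FTC_itv half_itv _ dF); last by cont.
have e1 : 2 * pi * (2^-1) * x = pi * x :> R by move: (pi : R) => p; field.
have e2 : 2 * pi * (- 2^-1) * x = - (pi * x) :> R by move: (pi : R) => p; field.
rewrite /F e1 e2 sinN /=; move: (sin _) px; move: (pi : R) => p u px; field.
by move: px; rewrite !mulf_eq0 !negb_or => /andP[/andP[_ ->] ->].
Qed.

(** The Taylor bounds that follow come from one another by successive integration, starting from cos
    <= 1. *)
Lemma ge0_of_derive (F f : R -> R) : continuous f -> (forall x, is_derive x 1 F (f x)) ->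
  (forall x, 0 <= x -> 0 <= f x) -> F 0 = 0 -> forall x, 0 <= x -> 0 <= F x.
Proof.
move=> cf dF f0 F0 x x0; have := FTC_itv x0 cf dF; rewrite F0 subr0 -lee_fin => <-.
by apply: integral_ge0 => y /=; rewrite in_itv/= => /andP[y0 _]; rewrite lee_fin f0.
Qed.

Lemma sin_le_id x : 0 <= x -> sin x <= x.
Proof.
move=> x0; rewrite -subr_ge0.
have dF (y : R) : is_derive y 1 (fun x : R => x - sin x) (1 - cos y) by apply: is_deriveB.
apply: (ge0_of_derive _ dF) x0.
- by cont.
- by move=> y _; rewrite subr_ge0 cos_le1.
- by rewrite sin0 subr0.
Qed.

Lemma cos_ge_quadratic x : 1 - x ^+ 2 / 2 <= cos x.
Proof.
wlog x0 : x / 0 <= x.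
  by move=> h; have [/h//|/ltW x0] := leP 0 x; rewrite -cosN -sqrrN; apply: h; rewrite oppr_ge0.
rewrite -subr_ge0.
apply: (@ge0_of_derive (fun x => cos x - (1 - x * x / 2)) (fun x => x - sin x)) x0.
- by cont.
- by move=> y; apply: is_derive_eq; rewrite /GRing.scale/=; field.
- by move=> y y0; rewrite subr_ge0 sin_le_id.
- by rewrite cos0; ring.
Qed.

Lemma sin_ge_cubic x : 0 <= x -> x - x ^+ 3 / 6 <= sin x.
Proof.
move=> x0; rewrite -subr_ge0.
have -> : sin x - (x - x ^+ 3 / 6) = sin x - (x - x * x * x / 6) by ring.
apply: (@ge0_of_derive (fun x => sin x - (x - x * x * x / 6)) (fun x => cos x - (1 - x ^+ 2 / 2))) x0.
- by cont.
- by move=> y; apply: is_derive_eq; rewrite /GRing.scale/=; field.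
- by move=> y y0; rewrite subr_ge0 cos_ge_quadratic.
- by rewrite sin0; ring.
Qed.

Lemma cos_le_quartic x : cos x <= 1 - x ^+ 2 / 2 + x ^+ 4 / 24.
Proof.
wlog x0 : x / 0 <= x.
  move=> h; have [/h//|/ltW x0] := leP 0 x; rewrite -cosN -sqrrN.
  have -> : x ^+ 4 = (- x) ^+ 4 by ring.
  by apply: h; rewrite oppr_ge0.
rewrite -subr_ge0.
have -> : 1 - x ^+ 2 / 2 + x ^+ 4 / 24 - cos x = 1 - x * x / 2 + x * x * x * x / 24 - cos x by ring.
apply: (@ge0_of_derive (fun x => 1 - x * x / 2 + x * x * x * x / 24 - cos x) (fun x => sin x - (x - x ^+ 3 / 6))) x0.
- by cont.
- by move=> y; apply: is_derive_eq; rewrite /GRing.scale/=; field.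
- by move=> y y0; rewrite subr_ge0 sin_ge_cubic.
- by rewrite cos0; ring.
Qed.

(** The second and fourth moments of the box are 1/12 and 1/80. They convert the Taylor bounds of
    cos (2 pi t x) into those of sinc, whose coefficients 1/6 and 1/120 are 4 / 2 / 12 and 16 / 24 /
    80. *)
Lemma Rint_box_poly (c0 c1 c2 : R) :
  \int[mu]_t (box t * (c0 + c1 * t ^+ 2 + c2 * t ^+ 4)) = c0 + c1 / 12 + c2 / 80.
Proof.
rewrite Rint_ind /Rintegral.
pose F t := c0 * t + c1 * (t * t * t) / 3 + c2 * (t * t * t * t * t) / 5.
have dF t : is_derive t 1 F (c0 + c1 * t ^+ 2 + c2 * t ^+ 4).
  by apply: is_derive_eq; rewrite /GRing.scale/=; field.
rewrite (FTC_itv half_itv _ dF); last by cont.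
by rewrite /F /=; field.
Qed.

Lemma intg_box_continuous (f : R -> R) : continuous f -> intg (fun t => box t * f t).
Proof.
move=> cf; have : mu.-integrable `[(- 2^-1)%R, 2^-1%R] (EFin \o f).
  by apply: continuous_compact_integrable; [exact: segment_compact|exact: continuous_subspaceT].
move=> /integrable_mkcond => /(_ (measurable_itv _)); apply: eq_integrable => // t _.
by rewrite /= /box ind_mul !patchE; case: ifP.
Qed.

Lemma sinc_ge x : 1 - (pi * x) ^+ 2 / 6 <= sinc x.
Proof.
have -> : 1 - (pi * x) ^+ 2 / 6 = \int[mu]_t (box t * (1 + - ((2 * pi * x) ^+ 2 / 2) * t ^+ 2 + 0 * t ^+ 4)).
  by rewrite Rint_box_poly; move: (pi : R) => p; field.
apply: le_Rint; first by apply: intg_box_continuous; cont.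
  exact: intg_cos intg_box.
move=> t; rewrite ler_wpM2l ?indE//.
apply: le_trans (cos_ge_quadratic _).
by rewrite le_eqVlt; apply/orP; left; apply/eqP; move: (pi : R) => p; field.
Qed.

Lemma sinc_le x : sinc x <= 1 - (pi * x) ^+ 2 / 6 + (pi * x) ^+ 4 / 120.
Proof.
have -> : 1 - (pi * x) ^+ 2 / 6 + (pi * x) ^+ 4 / 120 =
    \int[mu]_t (box t * (1 + - ((2 * pi * x) ^+ 2 / 2) * t ^+ 2 + ((2 * pi * x) ^+ 4 / 24) * t ^+ 4)).
  by rewrite Rint_box_poly; move: (pi : R) => p; field.
apply: le_Rint; first exact: intg_cos intg_box.
  by apply: intg_box_continuous; cont.
move=> t; rewrite ler_wpM2l ?indE//.
apply: le_trans (cos_le_quartic _) _.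
by rewrite le_eqVlt; apply/orP; left; apply/eqP; move: (pi : R) => p; field.
Qed.

(** The estimates on pi are 2 <= pi <= 4. For |x| <= 3/4, z = (pi x)^2 lies between 4 d^2 and 9, so
    the Taylor upper bound is at most 1 - 11 z / 120 and the lower one at least - 1/2. For |x| >
    3/4, |sinc x| <= 1 / (pi |x|) is at most 2/3, and 2/3 <= 1 - d^2 / 3. *)
Lemma sinc_far x (d : R) : 0 <= d -> d <= 1 -> d <= `|x| -> `|sinc x| <= 1 - d ^+ 2 / 3.
Proof.
move=> d0 d1 dx.
have p2 : 2 <= pi :> R by exact: pi_ge2.
have p4 : pi <= 4 :> R by have := pihalf_lt2 R; lra.
have [x34|x34] := leP `|x| (3 / 4).
  have x2 : x ^+ 2 <= 9 / 16.
    by rewrite -[x ^+ 2]real_normK ?num_real//; have := normr_ge0 x; nra.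
  have dx2 : d ^+ 2 <= x ^+ 2.
    by rewrite -[x ^+ 2]real_normK ?num_real// ler_pXn2r ?nnegrE.
  have := sinc_ge x; have := sinc_le x.
  have -> : (pi * x) ^+ 4 = (pi * x) ^+ 2 * (pi * x) ^+ 2 by move: (pi : R) => p; ring.
  have z9 : (pi * x) ^+ 2 <= 9.
    move: (pi : R) p2 p4 => p p2 p4; rewrite exprMn; have : p ^+ 2 <= 16 by nra.
    have := sqr_ge0 x; have := sqr_ge0 p; nra.
  have zd : 4 * d ^+ 2 <= (pi * x) ^+ 2.
    move: (pi : R) p2 p4 => p p2 p4; rewrite exprMn; have : 4 <= p ^+ 2 by nra.
    have := sqr_ge0 x; nra.
  have dd : d ^+ 2 <= 1 by rewrite expr_le1.
  have dd0 := sqr_ge0 d.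
  move: ((pi * x) ^+ 2) (d ^+ 2) (sinc x) z9 zd dd dd0 => z D S z9 zd D1 D0 hu hl.
  have z0 : 0 <= z by lra.
  have zz : z * z <= 9 * z by rewrite ler_wpM2r.
  by rewrite ler_norml; apply/andP; split; lra.
have dd : d ^+ 2 <= 1 by rewrite expr_le1.
have : `|pi * x| * `|sinc x| <= 1 by rewrite -normrM sincE normr_sin_le1.
rewrite normrM (ger0_norm (ltW (pi_gt0 R))).
have := normr_ge0 (sinc x).
move: `|sinc x| `|x| x34 (d ^+ 2) dd (pi : R) p2 => S X X34 D D1 p p2 S0 h.
have : 3 / 2 * S <= 1 by apply: le_trans h; rewrite ler_wpM2r//; nra.
lra.
Qed.

End Sinc.

Section Two_points.
Context {R : realType}.
Local Notation mu := (@lebesgue_measure R).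
Variables (a b : R -> R).
Hypotheses (ia : intg a) (ib : intg b) (sa : sqintg a) (sb : sqintg b).
Hypothesis supp : forall t, a t = box t * a t /\ b t = box t * b t.
Hypothesis ab1 : \int[mu]_t (a t ^+ 2 + b t ^+ 2) <= 1.

Definition inv_sq x := inv_re a b x ^+ 2 + inv_im a b x ^+ 2.

Let cs x t : R := cos (2 * pi * t * x).
Let sn x t : R := sin (2 * pi * t * x).

Let intg_re x : intg (fun t => a t * cs x t - b t * sn x t).
Proof. by apply: intgB; [exact: intg_cos|exact: intg_sin]. Qed.

Let intg_im x : intg (fun t => a t * sn x t + b t * cs x t).
Proof. by apply: intgD; [exact: intg_sin|exact: intg_cos]. Qed.

Let Rint_re x : \int[mu]_t (a t * cs x t - b t * sn x t) = inv_re a b x.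
Proof. by rewrite RintB//; [exact: intg_cos|exact: intg_sin]. Qed.

Let Rint_im x : \int[mu]_t (a t * sn x t + b t * cs x t) = inv_im a b x.
Proof. by rewrite RintD//; [exact: intg_sin|exact: intg_cos]. Qed.

(* Expand 0 <= || g - c (f(x) e_x + f(y) e_y) ||^2 for c = 1 / (1 + |sinc (x - y)|),
   where g is the transform of f and e_x the character t |-> exp (- 2 i pi t x) on the box. *)
Lemma two_points x y : inv_sq x + inv_sq y <= 1 + `|sinc (x - y)|.
Proof.
set A := inv_re a b x; set B := inv_im a b x; set A' := inv_re a b y; set B' := inv_im a b y.
set S := inv_sq x + inv_sq y; set s := sinc (x - y).
have SE : S = A ^+ 2 + B ^+ 2 + (A' ^+ 2 + B' ^+ 2) by [].
pose c := (1 + `|s|)^-1.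
have s0 : 0 < 1 + `|s| by rewrite ltr_pwDl.
have c0 : 0 < c by rewrite invr_gt0.
(* The real part of g times the conjugate of f(x) e_x + f(y) e_y, with f(x) = A + i B and f(y) = A'
   + i B'. *)
pose H t := A * (a t * cs x t - b t * sn x t) + B * (a t * sn x t + b t * cs x t) +
  (A' * (a t * cs y t - b t * sn y t) + B' * (a t * sn y t + b t * cs y t)).
have iH : intg H by apply: intgD; apply: intgD; apply: intgZ.
have HE : \int[mu]_t H t = S.
  rewrite /H RintD; [|by apply: intgD; apply: intgZ|by apply: intgD; apply: intgZ].
  rewrite RintD; [|by apply: intgZ|by apply: intgZ].
  rewrite RintD; [|by apply: intgZ|by apply: intgZ].
  rewrite !RintZ// !Rint_re !Rint_im SE /A /B /A' /B'.
  by move: (inv_re _ _ _) (inv_im _ _ _) (inv_re _ _ _) (inv_im _ _ _) => *; ring.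
(* The squared modulus of f(x) e_x + f(y) e_y on the box; its cross terms integrate to multiples of
   sinc (x - y) and of the vanishing sine transform. *)
pose K t := S * box t + ((2 * (A * A' + B * B')) * (box t * cs (x - y) t) +
  (2 * (A' * B - A * B')) * (box t * sn (x - y) t)).
have ic := intg_cos (x - y) (intg_box : intg (@box R)).
have is_ := intg_sin (x - y) (intg_box : intg (@box R)).
have iK : intg K.
  by apply: intgD; [exact: intgZ intg_box|apply: intgD; exact: intgZ].
have KE : \int[mu]_t K t = S + 2 * (A * A' + B * B') * s.
  rewrite /K RintD; [|exact: intgZ intg_box|by apply: intgD; exact: intgZ].
  rewrite RintD; [|exact: intgZ|exact: intgZ].
  rewrite (RintZ _ intg_box) (RintZ _ ic) (RintZ _ is_) Rint_box mulr1.
  by rewrite -/(fsin box (x - y)) fsin_box mulr0 addr0.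
have i2 : intg (fun t => a t ^+ 2 + b t ^+ 2) by apply: intgD; exact: sqintg_sqr.
have pw t : 0 <= (a t ^+ 2 + b t ^+ 2) + ((- 2 * c) * H t + c ^+ 2 * K t).
  pose p := A * cs x t + B * sn x t + (A' * cs y t + B' * sn y t).
  pose r := B * cs x t - A * sn x t + (B' * cs y t - A' * sn y t).
  have -> : (a t ^+ 2 + b t ^+ 2) + ((- 2 * c) * H t + c ^+ 2 * K t) =
      (a t - c * (box t * p)) ^+ 2 + (b t - c * (box t * r)) ^+ 2.
    have J2 : box t * box t = box t by rewrite -expr2 ind_sqr.
    have aE : a t * box t = a t by rewrite mulrC -(supp t).1.
    have bE : b t * box t = b t by rewrite mulrC -(supp t).2.
    have E1 : cs (x - y) t = cs x t * cs y t + sn x t * sn y t.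
      by rewrite /cs /sn mulrBr cosB.
    have E2 : sn (x - y) t = sn x t * cs y t - cs x t * sn y t.
      by rewrite /cs /sn mulrBr sinB.
    have E3 : cs x t * cs x t + sn x t * sn x t = 1.
      by rewrite -!expr2 cos2Dsin2.
    have E4 : cs y t * cs y t + sn y t * sn y t = 1.
      by rewrite -!expr2 cos2Dsin2.
    rewrite /H /K SE E1 E2 /p /r.
    move: (a t) (b t) (box t) (cs x t) (sn x t) (cs y t) (sn y t) J2 aE bE E3 E4 {E1 E2}.
    move: A B A' B' {p r S s SE s0 H iH HE K ic is_ iK KE} c {c0}.
    move=> A B A' B' c at_ bt J c1 s1 c2 s2 J2 aE bE E3 E4.
    set P := A * c1 + B * s1 + (A' * c2 + B' * s2).
    set Q := B * c1 - A * s1 + (B' * c2 - A' * s2).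
    have -> : (at_ - c * (J * P)) ^+ 2 + (bt - c * (J * Q)) ^+ 2 =
       at_ ^+ 2 + bt ^+ 2 - 2 * c * ((at_ * J) * P + (bt * J) * Q) + c ^+ 2 * ((J * J) * (P ^+ 2 + Q ^+ 2)) by ring.
    rewrite J2 aE bE.
    have -> : P ^+ 2 + Q ^+ 2 = (A ^+ 2 + B ^+ 2) * (c1 * c1 + s1 * s1) + (A' ^+ 2 + B' ^+ 2) * (c2 * c2 + s2 * s2) +
      2 * (A * A' + B * B') * (c1 * c2 + s1 * s2) + 2 * (A' * B - A * B') * (s1 * c2 - c1 * s2).
      by rewrite /P /Q; ring.
    by rewrite E3 E4 /P /Q; ring.
  by rewrite addr_ge0 ?sqr_ge0.
have : 0 <= \int[mu]_t ((a t ^+ 2 + b t ^+ 2) + ((- 2 * c) * H t + c ^+ 2 * K t)).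
  by apply: Rintegral_ge0 => t _.
rewrite (RintD i2 (intgD (intgZ _ iH) (intgZ _ iK))) (RintD (intgZ _ iH) (intgZ _ iK)).
rewrite (RintZ _ iH) (RintZ _ iK) HE KE => h.
(* The integral of [K] is thus at most S (1 + |s|), and c (1 + |s|) = 1, so the expansion is at most
   1 - 2 c S + c S. *)
have S1 : 2 * (A * A' + B * B') * s <= S * `|s|.
  rewrite (le_trans (ler_norm _))// normrM ler_wpM2r// SE.
  move: A B A' B' {S SE H iH HE K iK KE pw h} => A B A' B'.
  have := sqr_ge0 (A - A'); have := sqr_ge0 (B - B').
  have := sqr_ge0 (A + A'); have := sqr_ge0 (B + B').
  by rewrite ler_norml => *; apply/andP; split; nra.
have cs1 : c * (1 + `|s|) = 1 by rewrite mulVf// gt_eqF.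
suff : c * S <= 1 by rewrite mulrC -ler_pdivlMr// div1r invrK.
have h2 : c ^+ 2 * (S + 2 * (A * A' + B * B') * s) <= c * S.
  have -> : c * S = c ^+ 2 * (S * (1 + `|s|)).
    by rewrite expr2 -mulrA [c * (S * _)]mulrCA cs1 mulr1.
  by rewrite ler_wpM2l ?sqr_ge0// [leRHS]mulrDr mulr1 lerD2l.
move: ab1 h h2; move: (Rintegral _ _ _) => I I1.
move: (c ^+ 2 * _) => T; rewrite -mulrA mulNr; move: (c * S) => U; lra.
Qed.

End Two_points.

Section Sinc_PW2.
Context {R : realType}.
Local Notation mu := (@lebesgue_measure R).

Definition csinc (x : R) : R[i] := (sinc x +i* 0)%C.

Lemma sqintg0 : sqintg (fun _ : R => 0 : R).
Proof.
split; first exact: measurable_cst.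
apply: (@eq_intg _ (fun x : R => 0 * ind 0 0 x)); first by move=> x; rewrite expr0n mul0r.
by apply: intgZ; exact: intg_ind.
Qed.

(** Since sinc is square-integrable but not integrable, it is approached by its damped versions,
    whose transforms are the Poisson averages of the box. Their pointwise limit [chi] is the
    representative of the box that arises. *)
Lemma is_fourier2_sinc :
  is_fourier2 csinc (fun t => (chi (- 2^-1) 2^-1 t +i* 0)%C).
Proof.
have ib := @intg_box R; have sb := @sqintg_box R.
have sr := sqintg_chi (@half_itv R).
have [|_ hc] := @smooth_cvg_L2 _ _ (chi (- 2^-1) 2^-1) ib sb.
  by move=> x; apply: smooth_ind_cvg; exact: half_itv.
have s0 := sqintg0.
have cs : cLfun 2%:E csinc by apply/cLfun2P; split => //; exact: sqintg_sinc.
have cc : cLfun 2%:E (fun t => (chi (- 2^-1) 2^-1 t +i* 0)%C : R[i]) by apply/cLfun2P.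
split => //.
pose u n x : R[i] := (damp_re box n x +i* damp_im box n x)%C.
have hu n : intg (re (u n)) /\ intg (im (u n)).
  by split; [exact: intg_damp_re|exact: intg_damp_im].
have su n : sqintg (re (u n)) /\ sqintg (im (u n)).
  by split; [exact: sqintg_damp_re|exact: sqintg_damp_im].
exists u; split.
- by move=> n; split; [apply/cLfun1P; exact: hu|apply/cLfun2P; exact: su].
- apply/cvg_L2P => //; first by move=> n; apply/cLfun2P; exact: su.
  have := damp_cvg (@sqintg_sinc R); apply: cvg_trans; apply: near_eq_cvg; apply: nearW => n.
  apply: eq_Rint => x; rewrite /re /im /u /csinc /= /damp_re /damp_im fsin_box.
  by rewrite mulr0 subrr [0 ^+ 2]expr0n addr0.
- have E n : re (fourier1 (u n)) = smooth box n.
    by apply/funext => t; have [? ?] := hu n; rewrite re_fourier1// fre_damp.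
  have F n : im (fourier1 (u n)) = fun=> 0.
    by apply/funext => t; have [? ?] := hu n; rewrite im_fourier1// fim_damp.
  apply/cvg_L2P => //.
    by move=> n; apply/cLfun2P; rewrite E F; split => //; exact: sqintg_smooth.
  move: hc; apply: cvg_trans; apply: near_eq_cvg; apply: nearW => n.
  apply: eq_Rint => x; rewrite E F /re /im /=.
  by rewrite subrr [0 ^+ 2]expr0n addr0.
Qed.

(** Equality comes from using the norm inequality twice: from the box to sinc, then from sinc to
    [chi], which has the norm of the box. *)
Lemma Rint_sinc_sqr : \int[mu]_x (sinc x ^+ 2) = 1 :> R.
Proof.
have ib := @intg_box R; have sb := @sqintg_box R.
have B1 : \int[mu]_x (box x ^+ 2) = 1 :> R.
  by rewrite (@eq_Rint _ _ box) ?Rint_box// => x; exact: ind_sqr.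
apply/eqP; rewrite eq_le; apply/andP; split.
  have := Plancherel_real_le ib sb; rewrite -EFin_Rint; last first.
    by apply: intgD; apply: sqintg_sqr; [exact: sqintg_fcos|exact: sqintg_fsin].
  rewrite -(EFin_Rint (sqintg_sqr sb)) lee_fin B1; apply: le_trans.
  rewrite le_eqVlt; apply/orP; left; apply/eqP; apply: eq_Rint => x.
  by rewrite fsin_box [0 ^+ 2]expr0n addr0.
have := fourier2_Plancherel_le is_fourier2_sinc.
rewrite (@eq_Rint _ (fun x => re csinc x ^+ 2 + _) (fun x => sinc x ^+ 2)); last first.
  by move=> x; rewrite /re /im /= [0 ^+ 2]expr0n addr0.
apply: le_trans; rewrite le_eqVlt; apply/orP; left; apply/eqP.
have mc : measurable_fun setT (@chi R (- 2^-1) 2^-1) by case: (sqintg_chi (@half_itv R)).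
have mb : measurable_fun setT (@box R) by case: sb.
rewrite (@eq_Rint _ _ (fun x => chi (- 2^-1) 2^-1 x * chi (- 2^-1) 2^-1 x)); last first.
  by move=> x; rewrite /re /im /= [0 ^+ 2]expr0n addr0 expr2.
rewrite (Rint_chi mc (@half_itv R)) -[LHS]B1.
rewrite (@eq_Rint _ (fun x => ind _ _ x * _) (fun x => box x * chi (- 2^-1) 2^-1 x)) //.
rewrite (Rint_chi mb (@half_itv R)).
by apply: eq_Rint => x; rewrite expr2.
Qed.

Lemma csinc_PW2_sphere : PW2_sphere csinc.
Proof.
have [cs _ _] := is_fourier2_sinc.
split.
  split => //; exists (fun t => (chi (- 2^-1) 2^-1 t +i* 0)%C); split.
    exact: is_fourier2_sinc.
  move=> x /= h; rewrite in_itv/=; apply: contrapT => /negP xn.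
  apply: (h (~` `[- 2^-1, 2^-1]%classic)).
  - by apply: closed_openC; exact: interval_closed.
  - by rewrite /= in_itv/=; exact/negP.
  - apply: negligibleS (negligible_set0 _) => y [/= /negP + /eqP]; rewrite in_itv/= => yn; apply.
    by rewrite chi_out// half_itv.
have /cLfun2P[s1 s2] := cs.
rewrite (cLnorm2E s1 s2) (@eq_Rint _ _ (fun x => sinc x ^+ 2)) ?Rint_sinc_sqr ?sqrtr1//.
by move=> x; rewrite /re /im /= [0 ^+ 2]expr0n addr0.
Qed.

End Sinc_PW2.

Section Density.
Context {R : realType}.
Local Notation mu := (@lebesgue_measure R).

(* The properties shared by the functions |f|^2, f on the unit sphere of PW^2. *)
Definition energy_density (N : R -> R) := [/\ continuous N, forall x, 0 <= N x,
  forall x y, N x + N y <= 1 + `|sinc (x - y)| & (\int[mu]_x (N x)%:E = 1)%E].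

Lemma energy_density_le1 N x : energy_density N -> N x <= 1.
Proof.
move=> [_ _ h _]; have := h x x; have := normr_sinc_le1 (x - x).
by move: (`|sinc _|) => s; lra.
Qed.

Lemma energy_density_measurable N : energy_density N -> measurable_fun setT N.
Proof. by move=> [cN _ _ _]; exact: continuous_measurable_fun. Qed.

Lemma measurable_normc (f : R -> R[i]) : cmeasurable f ->
  measurable_fun setT (fun x => Normc.normc (f x)).
Proof.
move=> mf; apply: (@eq_measurable_fun _ _ _ _ _ (fun x => Num.sqrt (re f x ^+ 2 + im f x ^+ 2))).
  by move=> x _; rewrite /re /im; case: (f x).
apply: (measurableT_comp (continuous_measurable_fun _) (measurable_sq mf)).
exact: sqrt_continuous.
Qed.

Lemma continuous_inv_sq (a b : R -> R) : intg a -> intg b -> continuous (inv_sq a b).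
Proof.
move=> ia ib.
have c1 : continuous (inv_re a b) by move=> x; apply: cvgB; [exact: continuous_fcos|exact: continuous_fsin].
have c2 : continuous (inv_im a b) by move=> x; apply: cvgD; [exact: continuous_fsin|exact: continuous_fcos].
have -> : inv_sq a b = (fun x => inv_re a b x * inv_re a b x + inv_im a b x * inv_im a b x).
  by apply/funext => x; rewrite /inv_sq !expr2.
by move=> x; apply: cvgD; apply: cvgM; [exact: c1|exact: c1|exact: c2|exact: c2].
Qed.

Lemma PW2_sphere_density f : PW2_sphere f -> exists2 N, energy_density N &
  {ae mu, forall x, Normc.normc (f x) ^+ 2 = N x}.
Proof.
move=> [Pf nf]; have [a [b [[ia ib] [sa sb] supp le fab]]] := PW2_inversion Pf.
have [/cLfun2P[fr fi] _] := Pf.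
have int1 : \int[mu]_x (re f x ^+ 2 + im f x ^+ 2) = 1.
  move: nf; rewrite (cLnorm2E fr fi) => -[h].
  have := Rint_sqrD_ge0 (re f) (im f); move: h; move: (Rintegral _ _ _) => I h I0.
  by rewrite -(sqr_sqrtr I0) h expr1n.
rewrite int1 in le.
have NE : {ae mu, forall x, Normc.normc (f x) ^+ 2 = inv_sq a b x}.
  by apply: ae_imply fab => x [Er Ei]; rewrite normc_sqr -/(re f x) -/(im f x) Er Ei.
exists (inv_sq a b) => //; split.
- exact: continuous_inv_sq.
- by move=> x; rewrite addr_ge0 ?sqr_ge0.
- exact: two_points.
- rewrite -int1 EFin_Rint; last by apply: intgD; [case: fr|case: fi].
  apply: ae_eq_integral => //.
  + by apply/measurable_EFinP; apply: continuous_measurable_fun; exact: continuous_inv_sq.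
  + by apply/measurable_EFinP; apply: measurable_sq; split; [case: fr|case: fi].
  + by apply: ae_imply NE => x E _; rewrite -E normc_sqr.
Qed.

Lemma int_PW2_itv f (N : R -> R) (A : set R) : cmeasurable f -> measurable_fun setT N -> measurable A ->
  {ae mu, forall x, Normc.normc (f x) ^+ 2 = N x} ->
  (\int[mu]_(x in A) (Normc.normc (f x) ^+ 2)%:E = \int[mu]_(x in A) (N x)%:E)%E.
Proof.
move=> mf mN mA E; apply: ae_eq_integral => //.
- apply/measurable_EFinP; apply: (@measurable_funTS _ _ _ _ _ (fun x : R => Normc.normc (f x) ^+ 2)).
  by apply: measurable_sqr; exact: measurable_normc.
- exact/measurable_EFinP/measurable_funTS.
- by apply: ae_imply E => x + _ => ->.
Qed.

Lemma powR_half (x q : R) : 0 <= x -> x `^ q = (x ^+ 2) `^ (q / 2).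
Proof. by move=> x0; rewrite -powR_mulrn// -powRrM mulrCA mulfV ?mulr1. Qed.

Lemma int_PW2_powR f (N : R -> R) (q : R) : cmeasurable f -> measurable_fun setT N ->
  {ae mu, forall x, Normc.normc (f x) ^+ 2 = N x} ->
  (\int[mu]_x (Normc.normc (f x) `^ q)%:E = \int[mu]_x (N x `^ (q / 2))%:E)%E.
Proof.
move=> mf mN E; apply: ae_eq_integral => //.
- apply/measurable_EFinP.
  exact: (measurableT_comp (measurable_powR q) (measurable_normc mf)).
- apply/measurable_EFinP; exact: (measurableT_comp (measurable_powR (q / 2)) mN).
- by apply: ae_imply E => x + _ => <-; rewrite powR_half ?normc_ge0.
Qed.

End Density.

(** * Upper bound for M_q *)

Section LayerCake.
Context {R : realType}.
Local Notation mu := (@lebesgue_measure R).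
Implicit Types (F G : R -> R).

Lemma lebesgue_measure_cc (a b : R) : a <= b -> mu `[a, b]%classic = (b - a)%:E.
Proof.
move=> ab; rewrite lebesgue_measure_itv/= lte_fin; move: ab; rewrite le_eqVlt => /predU1P[->|->//].
by rewrite ltxx subrr.
Qed.

Lemma lebesgue_measure_co (a b : R) : a <= b -> mu `[a, b[%classic = (b - a)%:E.
Proof.
move=> ab; rewrite lebesgue_measure_itv/= lte_fin; move: ab; rewrite le_eqVlt => /predU1P[->|->//].
by rewrite ltxx subrr.
Qed.

Definition subgraph F := [set z : R * R | (0 <= z.2 < F z.1)%R].

Lemma measurable_subgraph F : measurable_fun setT F -> measurable (subgraph F).
Proof.
move=> mF.
have -> : subgraph F = (fun z : R * R => (z.2, F z.1 - z.2)) @^-1` (`[0%R, +oo[%classic `*` `]0%R, +oo[%classic).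
  apply/seteqP; split => z; rewrite /subgraph /= !in_itv/= !andbT subr_gt0.
    by move=> /andP[].
  by move=> [? ?]; apply/andP.
rewrite -[X in measurable X]setTI; apply: measurable_fun_pair => //.
  exact: measurable_funB (measurableT_comp mF measurable_fst) measurable_snd.
by apply: measurableX.
Qed.

Lemma measurable_superlevel F t : measurable_fun setT F -> measurable [set x | (0 <= t < F x)%R].
Proof.
move=> mF; have -> : [set x | (0 <= t < F x)%R] = (fun x => (x, t)) @^-1` (subgraph F) by [].
by rewrite -[X in measurable X]setTI; apply: (pair2_measurable t) => //; exact: measurable_subgraph.
Qed.

Let integral_slice F t : measurable_fun setT F ->
  (\int[mu]_x (\1_(subgraph F) (x, t) : R)%:E = mu [set x | (0 <= t < F x)%R])%E.
Proof.
move=> mF; rewrite (_ : (fun x => _) = (fun x => (\1_([set x | (0 <= t < F x)%R]) x)%:E)); last first.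
  by apply/funext => x; rewrite !indicE; congr (_ %:R%:E); apply/idP/idP; rewrite !inE.
by rewrite integral_indic ?setIT//; exact: measurable_superlevel.
Qed.

Let measurable_fun_subgraph F : measurable_fun setT F ->
  measurable_fun setT (fun z : R * R => (\1_(subgraph F) z : R)%:E).
Proof. by move=> /measurable_subgraph mF; apply/measurable_EFinP; exact: measurable_indic. Qed.

Lemma measurable_fun_superlevel F : measurable_fun setT F ->
  measurable_fun setT (fun t : R => mu [set x | (0 <= t < F x)%R]).
Proof.
move=> mF; rewrite (_ : (fun t => _) = fun t : R => (\int[mu]_x (\1_(subgraph F) (x, t) : R)%:E)%E); last first.
  by apply/funext => t; rewrite integral_slice.
have K0 (z : R * R) : (0 <= (\1_(subgraph F) z : R)%:E)%E by rewrite lee_fin.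
exact: (@measurable_fun_fubini_tonelli_G _ _ _ _ R mu _ (measurable_fun_subgraph mF) K0).
Qed.

Lemma layer_cake F : measurable_fun setT F -> (forall x, 0 <= F x) ->
  (\int[mu]_x (F x)%:E = \int[mu]_t mu [set x | (0 <= t < F x)%R])%E.
Proof.
move=> mF F0.
have K0 (z : R * R) : (0 <= (\1_(subgraph F) z : R)%:E)%E by rewrite lee_fin.
have := @fubini_tonelli _ _ _ _ R mu mu _ (measurable_fun_subgraph mF) K0.
rewrite /fubini_F /fubini_G => /= FE.
transitivity (\int[mu]_x \int[mu]_y (\1_(subgraph F) (x, y) : R)%:E)%E; last first.
  by rewrite FE; apply: eq_integral => y _; rewrite integral_slice.
apply: eq_integral => x _.
rewrite (_ : (fun y => _) = (fun y => (\1_(`[0%R, F x[%classic) y)%:E)); last first.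
  by apply/funext => y; rewrite !indicE; congr (_ %:R%:E); apply/idP/idP; rewrite !inE /= in_itv/=.
have E := @integral_indic _ _ R mu setT measurableT `[0%R, F x[%classic (measurable_itv _).
transitivity (mu `[0, F x[%classic); first by rewrite lebesgue_measure_co ?subr0.
by rewrite [RHS]E setIT.
Qed.

(** For a nonempty set and a finite [L], the set lies in the interval of length [L] that starts at
    its infimum. *)
Lemma lebesgue_measure_diam (E : set R) (L : \bar R) :
  (forall x y, E x -> E y -> x <= y -> ((y - x)%:E <= L)%E) -> (0 <= L)%E -> measurable E -> (mu E <= L)%E.
Proof.
move=> EL L0 mE; case: L L0 EL => [l| |]//; last by move=> _ _; rewrite leey.
rewrite lee_fin => l0 EL.
have [->|/set0P[x0 Ex0]] := eqVneq E set0; first by rewrite measure0 lee_fin.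
have hi : has_inf E.
  split; first by exists x0.
  exists (x0 - l) => y Ey; have [xy|yx] := leP x0 y; first by lra.
  by have := EL _ _ Ey Ex0 (ltW yx); rewrite lee_fin; lra.
apply: (@le_trans _ _ (mu `[inf E, inf E + l]%classic)); last first.
  by rewrite lebesgue_measure_cc ?lee_fin; lra.
apply: le_measure; rewrite ?inE//; move=> y Ey /=; rewrite in_itv/=; apply/andP; split.
  by apply: ge_inf => //; exact: hi.2.
rewrite -lerBlDr; apply: lb_le_inf; first by exists x0.
move=> z Ez; have [zy|yz] := leP z y; last by lra.
by have := EL _ _ Ez Ey zy; rewrite lee_fin; lra.
Qed.

(* By the layer cake formula, since the diameter of {F > t} is at most the length of {G > t}. *)
Lemma level_diam_le_integral F G : measurable_fun setT F -> (forall x, 0 <= F x) ->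
  measurable_fun setT G -> (forall x, 0 <= G x) ->
  (forall t x y : R, 0 <= t -> t < F x -> t < F y -> x <= y -> forall s : R, 0 <= s -> s <= y - x -> t < G s) ->
  (\int[mu]_x (F x)%:E <= \int[mu]_(x in `[0%R, +oo[) (G x)%:E)%E.
Proof.
move=> mF F0 mG G0 FG.
pose H := G \_ `[0%R, +oo[.
have H0 x : 0 <= H x by rewrite /H patchE; case: ifP.
have mH : measurable_fun setT H by apply/(measurable_restrictT _ _).1 => //; exact: measurable_funTS.
have -> : (\int[mu]_(x in `[0%R, +oo[) (G x)%:E = \int[mu]_x (H x)%:E)%E.
  by rewrite integral_mkcond; apply: eq_integral => x _; rewrite /H !patchE; case: ifP.
rewrite !layer_cake//.
apply: ge0_le_integral => //; [exact: measurable_fun_superlevel|exact: measurable_fun_superlevel|].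
move=> t _; apply: lebesgue_measure_diam => //; last exact: measurable_superlevel.
move=> x y /= /andP[t0 tx] /andP[_ ty] xy.
have -> : (y - x)%:E = mu `[0, y - x]%classic.
  by rewrite lebesgue_measure_cc ?subr0// subr_ge0.
apply: le_measure; rewrite ?inE//; first exact: measurable_superlevel.
move=> s /=; rewrite in_itv/= => /andP[s0 sy]; rewrite t0/= /H patchE mem_set/= ?in_itv/= ?s0//.
exact: (FG t x y).
Qed.

End LayerCake.

Section Gauss.
Context {R : realType}.
Local Notation mu := (@lebesgue_measure R).

(** Up to the factor [normal_peak], the integrand is the density of the centered normal law of
    variance 1 / (2 c). *)
Lemma integralT_gaussZ (c : R) : 0 < c ->
  (\int[mu]_x (expR (- (c * x ^+ 2)))%:E = (Num.sqrt (pi / c))%:E)%E.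
Proof.
move=> c0; pose s := Num.sqrt (2 * c)^-1.
have s2 : s ^+ 2 = (2 * c)^-1 by rewrite sqr_sqrtr// invr_ge0; lra.
have s0 : s != 0 by rewrite sqrtr_eq0 -ltNge invr_gt0; lra.
have P0 : normal_peak s != 0 by rewrite gt_eqF ?normal_peak_gt0.
have E : (\int[mu]_x (normal_pdf 0 s x)%:E = \int[mu]_x ((normal_peak s)%:E * (expR (- (c * x ^+ 2)))%:E))%E.
  apply: eq_integral => x _; rewrite normal_pdfE// /normal_fun subr0 s2 -EFinM.
  by congr (_ * expR _)%:E; field; lra.
have := integral_normal_pdf 0 s; rewrite E.
rewrite ge0_integralZl//; last 2 first.
- by apply/measurable_EFinP; apply: continuous_measurable_fun; cont.
- by rewrite lee_fin normal_peak_ge0.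
have -> : Num.sqrt (pi / c) = (normal_peak s)^-1.
  by rewrite /normal_peak invrK s2; congr Num.sqrt; rewrite -mulr_natr; field; lra.
have : (0 <= \int[mu]_x (expR (- (c * x ^+ 2)))%:E)%E.
  by apply: integral_ge0 => x _; rewrite lee_fin expR_ge0.
case: (integral _ _ _) => [r| |]//=.
- by move=> _ -[h]; congr EFin; apply: (mulfI P0); rewrite h mulfV.
- by move=> _; rewrite gt0_muley ?lte_fin ?normal_peak_gt0.
Qed.

Lemma integral0y_gaussZ (c : R) : 0 < c ->
  (\int[mu]_(x in `[0%R, +oo[) (expR (- (c * x ^+ 2)))%:E = (Num.sqrt (pi / c) / 2)%:E)%E.
Proof.
move=> c0; have := integralT_gaussZ c0.
rewrite ge0_symfun_integralT//=; last 2 first.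
- by cont.
- by move=> x /=; rewrite sqrrN.
rewrite -set_itvcy.
have : (0 <= \int[mu]_(x in `[0%R, +oo[) (expR (- (c * x ^+ 2)))%:E)%E.
  by apply: integral_ge0 => x _; rewrite lee_fin expR_ge0.
case: (integral _ _ _) => [r| |]//=.
- by move=> _ [<-]; congr EFin; field.
- by move=> _; rewrite gt0_muley ?lte_fin.
Qed.

End Gauss.

Section UpperMq.
Context {R : realType}.
Local Notation mu := (@lebesgue_measure R).

(** The function u of the overview. *)
Definition half_sinc (s : R) : R := (1 + `|sinc s|) / 2.

Lemma pi_lt4 : pi < 4 :> R.
Proof. by have := @pihalf_lt2 R; rewrite ltr_pdivrMr//; lra. Qed.

(** On this range y = (pi s)^2 is at most 4 e^2, because pi < 4. The quartic term y^2 / 240 is then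
    below e y / 12, which is exactly what the factor 1 - e gives away. *)
Lemma half_sinc_near (e s : R) : 0 < e -> e < 1 -> `|s| <= e / 2 ->
  half_sinc s <= expR (- ((1 - e) * pi ^+ 2 / 12 * s ^+ 2)).
Proof.
move=> e0 e1 se.
apply: le_trans (expR_ge1Dx _).
have s2 : s ^+ 2 <= e ^+ 2 / 4.
  by rewrite -(real_normK (num_real s)); move: (normr_ge0 s) se; move: (`|s|) => t; nra.
have y2 : (pi * s) ^+ 2 <= 4 * e ^+ 2.
  rewrite exprMn; have := @pi_gt0 R; have := pi_lt4; move: (sqr_ge0 s) s2 => s2 s3.
  move: (pi : R) (s ^+ 2) s2 s3 => p w *.
  have p2 : p ^+ 2 <= 16 by nra.
  by apply: (@le_trans _ _ (16 * w)); [apply: ler_wpM2r|lra].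
have h1 := sinc_ge s; have h2 := sinc_le s.
rewrite [X in 1 + - X](_ : _ = (1 - e) * (pi * s) ^+ 2 / 12); last by rewrite exprMn; ring.
move: y2 h1 h2 (sqr_ge0 (pi * s)); rewrite (_ : (pi * s) ^+ 4 = ((pi * s) ^+ 2) ^+ 2); last by rewrite -exprM.
move: ((pi * s) ^+ 2) => y y2 h1 h2 y0.
have A : y ^+ 2 <= 4 * e * y by rewrite expr2; apply: ler_wpM2r => //; nra.
have B : `|sinc s| <= 1 - y / 6 + y ^+ 2 / 120.
  rewrite ler_norml; apply/andP; split => //.
  by have := sqr_ge0 y; nra.
rewrite /half_sinc; move: (`|_|) B => t B; nra.
Qed.

Lemma half_sinc_far (e s : R) : 0 < e -> e < 1 -> e / 2 <= `|s| -> half_sinc s <= 1 - e ^+ 2 / 24.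
Proof.
move=> e0 e1 se; have h : `|sinc s| <= 1 - (e / 2) ^+ 2 / 3 by apply: sinc_far => //; lra.
by rewrite /half_sinc; move: (`|_|) h => t; rewrite expr_div_n; lra.
Qed.

End UpperMq.

Section UpperMq2.
Context {R : realType}.
Local Notation mu := (@lebesgue_measure R).

Lemma le_powR_nneg (p x y : R) : 0 <= p -> 0 <= x -> x <= y -> x `^ p <= y `^ p.
Proof. by move=> p0 x0 xy; apply: ge0_ler_powR; rewrite ?nnegrE//; exact: le_trans xy. Qed.

Lemma powR_split (p x : R) : 1 <= p -> 0 <= x -> x `^ p = x `^ (p - 1) * x.
Proof.
move=> p1; rewrite le_eqVlt => /predU1P[<-|x0].
  by rewrite mulr0 powR0// gt_eqF//; lra.
rewrite -{1}(subrK 1 p) (@powRD _ x (p - 1) 1) ?powRr1 ?ltW//.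
by apply/implyP => _; rewrite gt_eqF.
Qed.

Variables (e p : R).
Hypotheses (e0 : 0 < e) (e1 : e < 1) (p1 : 1 <= p).

(** Here [a] is the Gaussian rate of [half_sinc] on |s| <= e / 2, and [k] < 1 bounds [half_sinc]
    beyond, by [sinc_far] at distance e / 2. *)
Local Notation a := ((1 - e) * pi ^+ 2 / 12).
Local Notation k := (1 - e ^+ 2 / 24).

Lemma far_bound_gt0 : 0 < k.
Proof. by rewrite subr_gt0 ltr_pdivrMr// mul1r; apply: (@le_lt_trans _ _ 1); [exact: exprn_ile1 (ltW e0) (ltW e1)|rewrite ltr1n]. Qed.

Lemma half_sinc_ge0 (s : R) : 0 <= half_sinc s.
Proof. by rewrite divr_ge0// addr_ge0. Qed.

(** Raising the level by k^p excludes the range |d| > e / 2, where [half_sinc] is at most [k], and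
    leaves the one on which the Gaussian bound holds. *)
Lemma half_sinc_powR_gt (d t : R) : 0 <= t -> t + k `^ p < half_sinc d `^ p ->
  `|d| <= e / 2 /\ t < expR (- (a * p * d ^+ 2)).
Proof.
move=> t0 td; have k0 := far_bound_gt0.
have de : `|d| <= e / 2.
  rewrite leNgt; apply/negP => /ltW /(half_sinc_far e0 e1) h.
  have := le_powR_nneg (le_trans ler01 p1) (half_sinc_ge0 d) h.
  by move: (_ `^ p) (_ `^ p) td => X Y; lra.
split=> //.
have h := le_powR_nneg (le_trans ler01 p1) (half_sinc_ge0 d) (half_sinc_near e0 e1 de).
have -> : expR (- (a * p * d ^+ 2)) = expR (- (a * d ^+ 2)) `^ p by rewrite -expRM; congr expR; ring.
by have := powR_ge0 k p; move: (k `^ p) td h => X; move: (_ `^ p) (_ `^ p) => Y Z; lra.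
Qed.

(** Pointwise N^p <= max (N^p - k^p, 0) + k^(p - 1) N. The last term has integral k^(p - 1),
    exponentially small in p. The truncated one is compared with the Gaussian on the half-line by
    [level_diam_le_integral]. *)
Lemma density_powR_le (N : R -> R) : energy_density N ->
  (\int[mu]_x (N x `^ p)%:E <= (Num.sqrt (pi / (a * p)) / 2 + k `^ (p - 1))%:E)%E.
Proof.
move=> dN; have [cN N0 NN N1] := dN; have mN := energy_density_measurable dN.
have k0 := far_bound_gt0; have p0 := lt_le_trans ltr01 p1.
have a0 : 0 < a * p by rewrite mulr_gt0// divr_gt0// mulr_gt0 ?subr_gt0// exprn_gt0// pi_gt0.
have mNp : measurable_fun setT (fun x => N x `^ p) by exact: (measurableT_comp (measurable_powR p) mN).
pose F x := Num.max (N x `^ p - k `^ p) 0.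
have F0 x : 0 <= F x by rewrite /F le_max lexx orbT.
have mF : measurable_fun setT F.
  by apply: measurable_maxr => //; apply: measurable_funB.
have mEN : measurable_fun setT (fun x => (k `^ (p - 1))%:E * (N x)%:E)%E.
  by under eq_fun do rewrite -EFinM; apply/measurable_EFinP; exact: measurable_funM.
apply: (@le_trans _ _ (\int[mu]_x ((F x)%:E + (k `^ (p - 1))%:E * (N x)%:E))%E).
  apply: ge0_le_integral => //.
  - by move=> x _; rewrite lee_fin powR_ge0.
  - exact/measurable_EFinP.
  - by apply: emeasurable_funD => //; exact/measurable_EFinP.
  move=> x _; rewrite -EFinM -EFinD lee_fin.
  have [Nk|kN] := leP (N x) k.
    rewrite powR_split//; apply: le_trans (_ : k `^ (p - 1) * N x <= _); last by rewrite lerDr.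
    by apply: ler_wpM2r => //; apply: le_powR_nneg => //; rewrite subr_ge0.
  have h : k `^ p <= k `^ (p - 1) * N x.
    by rewrite powR_split ?(ltW k0)//; apply: ler_wpM2l; rewrite ?powR_ge0// ltW.
  apply: (@le_trans _ _ (N x `^ p - k `^ p + k `^ p)); first by rewrite subrK.
  by apply: lerD => //; rewrite /F le_max lexx.
rewrite ge0_integralD//; last 3 first.
- by move=> x _; rewrite lee_fin.
- exact/measurable_EFinP.
- by move=> x _; rewrite -EFinM lee_fin mulr_ge0 ?powR_ge0.
rewrite ge0_integralZl//; last 3 first.
- exact/measurable_EFinP.
- by move=> x _; rewrite lee_fin.
- by rewrite lee_fin powR_ge0.
rewrite N1 mule1 EFinD; apply: leeD => //.
rewrite -integral0y_gaussZ//; apply: level_diam_le_integral => //.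
- by apply: continuous_measurable_fun; cont.
move=> t x y t0 tx ty xy s s0 sd.
have h (z : R) : t < F z -> t + k `^ p < N z `^ p by rewrite /F lt_max => /orP[|]; lra.
have [|_ H] := @half_sinc_powR_gt (x - y) t t0.
  (* The smaller of two values is at most their mean, which the two-point inequality bounds by
     [half_sinc (x - y)]; a level exceeded at both x and y is therefore exceeded by
     [half_sinc (x - y)] as well. *)
  have Nxy : Num.min (N x) (N y) <= half_sinc (x - y).
    by have := NN x y; rewrite /half_sinc ge_min ler_pdivlMr//= ler_pdivlMr//=; case: (leP (N x) (N y)); lra.
  apply: lt_le_trans (le_powR_nneg (ltW p0) _ Nxy); last by rewrite le_min !N0.
  by case: (leP (N x) (N y)) => _; exact: h.
apply: lt_le_trans H _; rewrite ler_expR lerN2; apply: ler_wpM2l; first exact: ltW.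
by rewrite -[leRHS]sqrrN opprB; apply: lerXn2r; rewrite ?nnegrE ?subr_ge0.
Qed.

End UpperMq2.

Section UpperMq3.
Context {R : realType}.
Local Notation mu := (@lebesgue_measure R).

Lemma Mq_le (e q : R) : 0 < e -> e < 1 -> 2 <= q ->
  (M_ q <= (Num.sqrt (pi / ((1 - e) * pi ^+ 2 / 12 * (q / 2))) / 2 + (1 - e ^+ 2 / 24) `^ (q / 2 - 1))%:E)%E.
Proof.
move=> e0 e1 q2; apply: ge_ereal_sup => _ [f Pf <-].
have [[[mf _] _] _] := Pf.
have [N dN fN] := PW2_sphere_density Pf.
rewrite (int_PW2_powR q mf (energy_density_measurable dN) fN).
by apply: density_powR_le => //; rewrite ler_pdivlMr//; lra.
Qed.

End UpperMq3.

(** * Lower bound for M_q *)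

Section GaussLower.
Context {R : realType}.
Local Notation mu := (@lebesgue_measure R).

(** After inversion it suffices that 1 / (1 - w) <= 1 + (1 + e) w, that is (1 + e) w <= e, and this
    holds for w <= e / 2 since e < 1. *)
Lemma expR_le_subr (e w : R) : 0 < e -> e < 1 -> 0 <= w -> w <= e / 2 ->
  expR (- ((1 + e) * w)) <= 1 - w.
Proof.
move=> e0 e1 w0 we; rewrite expRN -[leRHS]invrK lef_pV2 ?posrE ?expR_gt0 ?invr_gt0 ?subr_gt0//; last by lra.
apply: le_trans (expR_ge1Dx _); rewrite -(mul1r (_^-1)) ler_pdivrMr; [nra|lra].
Qed.

(* Beyond s0 the Gaussian is at most expR (- (b s0^2 / 2)) times the Gaussian of parameter b / 2. *)
Lemma gauss_trunc_le (D : set R) (F : R -> R) (b s0 k : R) : measurable D -> 0 < b -> 0 <= s0 ->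
  (forall c, 0 < c -> (\int[mu]_(x in D) (expR (- (c * x ^+ 2)))%:E = (k * Num.sqrt (pi / c))%:E)%E) ->
  measurable_fun D F -> (forall x, D x -> 0 <= F x) ->
  (forall x, D x -> `|x| <= s0 -> expR (- (b * x ^+ 2)) <= F x) ->
  ((k * Num.sqrt (pi / b) * (1 - Num.sqrt 2 * expR (- (b * s0 ^+ 2 / 2))))%:E <=
   \int[mu]_(x in D) (F x)%:E)%E.
Proof.
move=> mD b0 s00 kD mF F0 Fb; have b20 : 0 < b / 2 by lra.
set c := expR (- (b * s0 ^+ 2 / 2)).
have c0 : 0 <= c by exact: expR_ge0.
have mG (d : R) : measurable_fun D (fun x => expR (- (d * x ^+ 2))).
  by apply: measurable_funTS; apply: continuous_measurable_fun; cont.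
have mcG : measurable_fun D (fun x => c%:E * (expR (- (b / 2 * x ^+ 2)))%:E)%E.
  by under eq_fun do rewrite -EFinM; apply/measurable_EFinP; apply: measurable_funM.
have : (\int[mu]_(x in D) (expR (- (b * x ^+ 2)))%:E <=
    \int[mu]_(x in D) ((F x)%:E + c%:E * (expR (- (b / 2 * x ^+ 2)))%:E))%E.
  apply: ge0_le_integral => //.
  - by apply/measurable_EFinP; exact: mG.
  - by apply: emeasurable_funD => //; exact/measurable_EFinP.
  move=> x Dx; rewrite -EFinM -EFinD lee_fin.
  have [xs|xs] := leP `|x| s0.
    by apply: le_trans (Fb _ Dx xs) _; rewrite lerDl mulr_ge0 ?expR_ge0.
  apply: le_trans (_ : c * expR (- (b / 2 * x ^+ 2)) <= _); last by rewrite lerDr F0.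
  rewrite /c -expRD ler_expR.
  have : s0 ^+ 2 <= x ^+ 2.
    by rewrite -(real_normK (num_real x)); apply: lerXn2r; rewrite ?nnegrE// ltW.
  by move: (s0 ^+ 2) (x ^+ 2) => X Y XY; nra.
rewrite ge0_integralD//; last 2 first.
- exact/measurable_EFinP.
- by move=> x _; rewrite -EFinM lee_fin mulr_ge0 ?expR_ge0.
rewrite ge0_integralZl//; last first.
  by apply/measurable_EFinP; exact: mG.
rewrite !kD//; have -> : Num.sqrt (pi / (b / 2)) = Num.sqrt (pi / b) * Num.sqrt 2.
  by rewrite -sqrtrM ?divr_ge0 ?pi_ge0 ?(ltW b0)//; congr Num.sqrt; field; lra.
case: (integral _ _ _) => [r| |]; rewrite ?leey//.
  rewrite -EFinM -EFinD !lee_fin; move: (Num.sqrt _) (Num.sqrt _) => X Y; lra.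
Qed.

Lemma sinc_gauss_le (e x : R) : 0 < e -> e < 1 -> `|x| <= e / 4 ->
  expR (- ((1 + e) * pi ^+ 2 / 6 * x ^+ 2)) <= `|sinc x|.
Proof.
move=> e0 e1 xe; apply: le_trans (ler_norm _); apply: le_trans (sinc_ge x).
have x2 : x ^+ 2 <= e ^+ 2 / 16.
  by rewrite -(real_normK (num_real x)); move: (normr_ge0 x) xe; move: (`|x|) => t; nra.
have y2 : (pi * x) ^+ 2 / 6 <= e / 2.
  rewrite exprMn; have := @pi_gt0 R; have := @pi_lt4 R; move: (sqr_ge0 x) x2 => x2 x3.
  move: (pi : R) (x ^+ 2) x2 x3 => p w *.
  have p2 : p ^+ 2 <= 16 by nra.
  have : p ^+ 2 * w <= 16 * w by apply: ler_wpM2r.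
  by nra.
have y0 : 0 <= (pi * x) ^+ 2 / 6 by rewrite divr_ge0 ?sqr_ge0.
apply: le_trans (expR_le_subr e0 e1 y0 y2).
by rewrite ler_expR exprMn; move: (pi : R) => P; rewrite le_eqVlt; apply/orP; left; apply/eqP; field.
Qed.

Lemma Mq_ge (e q : R) : 0 < e -> e < 1 -> 2 <= q ->
  ((Num.sqrt (pi / ((1 + e) * pi ^+ 2 / 6 * q)) *
    (1 - Num.sqrt 2 * expR (- ((1 + e) * pi ^+ 2 / 6 * q * (e / 4) ^+ 2 / 2))))%:E <= M_ q)%E.
Proof.
move=> e0 e1 q2; set b := (1 + e) * pi ^+ 2 / 6.
have b0 : 0 < b by rewrite divr_gt0// mulr_gt0 ?exprn_gt0 ?pi_gt0//; lra.
have q0 : 0 < q by lra.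
apply: (@le_trans _ _ (\int[mu]_x (Normc.normc (csinc x) `^ q)%:E)%E); last first.
  by apply: ereal_sup_ubound; exists csinc => //; exact: csinc_PW2_sphere.
rewrite -[X in (X * _)%:E]mul1r; apply: gauss_trunc_le => //.
- by rewrite mulr_gt0.
- by rewrite divr_ge0// ltW.
- by move=> c c0; rewrite integralT_gaussZ// mul1r.
- apply: (measurableT_comp (measurable_powR q)); apply: measurable_normc.
  by have [[[+ _] _] _] := @csinc_PW2_sphere R.
- by move=> x _; exact: powR_ge0.
move=> x _ xe; have -> : Normc.normc (csinc x) = `|sinc x|.
  by rewrite /csinc /= [0 ^+ 2]expr0n addr0 sqrtr_sqr.
have -> : expR (- (b * q * x ^+ 2)) = expR (- (b * x ^+ 2)) `^ q by rewrite -expRM; congr expR; ring.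
by apply: le_powR_nneg; [exact: ltW|exact: expR_ge0|exact: sinc_gauss_le].
Qed.

End GaussLower.

(** * The concentration function lambda *)

Section Lambda.
Context {R : realType}.
Local Notation mu := (@lebesgue_measure R).

Definition mass (N : R -> R) (s : R) : R := \int[mu]_x (ind (- (s / 2)) (s / 2) x * N x).

Lemma measurable_ind (a b : R) : measurable_fun setT (ind a b).
Proof. by case: (sqintg_ind a b). Qed.

Lemma normr_ind_le1 (a b x : R) : `|ind a b x| <= 1.
Proof. by rewrite indE; case: (_ <= _ <= _); rewrite ?normr1 ?normr0. Qed.

Lemma ind_ge0 (a b x : R) : 0 <= ind a b x.
Proof. by rewrite indE ler0n. Qed.

Lemma intg_ind_mul (a b : R) N : intg N -> intg (fun x => ind a b x * N x).
Proof.
move=> iN; apply: (@eq_intg _ (fun x => N x * ind a b x)); first by move=> x; rewrite mulrC.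
exact: intg_bounded (measurable_ind a b) (normr_ind_le1 a b) iN.
Qed.

Lemma energy_density_intg (N : R -> R) : energy_density N -> intg N.
Proof.
move=> dN; have [_ N0 _ N1] := dN; apply: intg_lty => //; first exact: energy_density_measurable.
by rewrite N1 ltry.
Qed.

Lemma intg_opp (N : R -> R) : (forall x, 0 <= N x) -> intg N -> intg (fun x => N (- x)).
Proof.
move=> N0 iN; have mN := intg_measurable iN; apply: intg_lty => //; first exact: (measurableT_comp mN).
by rewrite (ge0_integral_opp (f := EFin \o N)) ?intg_int_lty//; exact/measurable_EFinP.
Qed.

Lemma mass_ge0 (N : R -> R) s : energy_density N -> 0 <= mass N s.
Proof. by move=> [_ N0 _ _]; apply: Rintegral_ge0 => x _; rewrite mulr_ge0 ?ind_ge0. Qed.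

Lemma mass_le1 (N : R -> R) s : energy_density N -> mass N s <= 1.
Proof.
move=> dN; have [_ N0 _ N1] := dN; have iN := energy_density_intg dN.
have -> : 1 = \int[mu]_x N x by apply: EFin_inj; rewrite EFin_Rint.
apply: le_Rint => //; first exact: intg_ind_mul.
by move=> x; apply: ler_piMl => //; have := normr_ind_le1 (- (s / 2)) (s / 2) x; rewrite ger0_norm ?ind_ge0.
Qed.

Lemma integral_itv_mass f (N : R -> R) s : cmeasurable f -> energy_density N ->
  {ae mu, forall x, Normc.normc (f x) ^+ 2 = N x} ->
  (\int[mu]_(x in `[(- (s / 2))%R, (s / 2)%R]) (Normc.normc (f x) ^+ 2)%:E = (mass N s)%:E)%E.
Proof.
move=> mf dN fN; rewrite (int_PW2_itv mf (energy_density_measurable dN) _ fN)//.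
rewrite /mass EFin_Rint; last by apply: intg_ind_mul; exact: energy_density_intg.
rewrite integral_mkcond; apply: eq_integral => x _.
by rewrite ind_mul !patchE; case: ifP.
Qed.

Let energies s : set (\bar R) := [set (\int[mu]_(x in `[(- (s / 2))%R, (s / 2)%R])
            (Normc.normc (f x) ^+ 2)%:E)%E | f in PW2_sphere].

Let sup_energies_le s (c : R) : (forall f N, PW2_sphere f -> energy_density N ->
    {ae mu, forall x, Normc.normc (f x) ^+ 2 = N x} -> mass N s <= c) ->
  (ereal_sup (energies s) <= c%:E)%E.
Proof.
move=> h; apply: ge_ereal_sup => _ [f Pf <-].
have [[[mf _] _] _] := Pf; have [N dN fN] := PW2_sphere_density Pf.
by rewrite (integral_itv_mass _ mf dN fN) lee_fin; exact: h fN.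
Qed.

Let sup_energies_ge s f N : PW2_sphere f -> energy_density N ->
  {ae mu, forall x, Normc.normc (f x) ^+ 2 = N x} -> ((mass N s)%:E <= ereal_sup (energies s))%E.
Proof.
move=> Pf dN fN; have [[[mf _] _] _] := Pf.
by apply: ereal_sup_ubound; exists f => //; rewrite (integral_itv_mass _ mf dN fN).
Qed.

Lemma lambdaE s : (lambda s)%:E = ereal_sup (energies s).
Proof.
have le1 : (ereal_sup (energies s) <= 1%:E)%E.
  by apply: sup_energies_le => f N _ dN _; exact: mass_le1.
have [N dN fN] := PW2_sphere_density (@csinc_PW2_sphere R).
have ge0 : (0%:E <= ereal_sup (energies s))%E.
  by apply: le_trans (sup_energies_ge s (@csinc_PW2_sphere R) dN fN); rewrite lee_fin mass_ge0.
rewrite /lambda -/(energies s) fineK// fin_numElt; apply/andP; split.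
  by apply: lt_le_trans ge0; rewrite ltNyr.
by apply: le_lt_trans le1 _; rewrite ltry.
Qed.

Lemma lambda_le s (c : R) : (forall f N, PW2_sphere f -> energy_density N ->
    {ae mu, forall x, Normc.normc (f x) ^+ 2 = N x} -> mass N s <= c) -> lambda s <= c.
Proof. by move=> h; rewrite -lee_fin lambdaE; exact: sup_energies_le. Qed.

Lemma lambda_ge s f N : PW2_sphere f -> energy_density N ->
  {ae mu, forall x, Normc.normc (f x) ^+ 2 = N x} -> mass N s <= lambda s.
Proof. by move=> Pf dN fN; rewrite -lee_fin lambdaE; exact: sup_energies_ge fN. Qed.

End Lambda.

Section LambdaTheory.
Context {R : realType}.
Local Notation mu := (@lebesgue_measure R).

Lemma lambda_le1 (s : R) : lambda s <= 1.
Proof. by apply: lambda_le => f N _ dN _; exact: mass_le1. Qed.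

Lemma lambda_ge0 (s : R) : 0 <= lambda s.
Proof.
have [N dN fN] := PW2_sphere_density (@csinc_PW2_sphere R).
by apply: le_trans (lambda_ge s (@csinc_PW2_sphere R) dN fN); exact: mass_ge0.
Qed.

Lemma le_lambda (s t : R) : s <= t -> lambda s <= lambda t.
Proof.
move=> st; apply: lambda_le => f N Pf dN fN; apply: le_trans (lambda_ge t Pf dN fN).
have iN := energy_density_intg dN; have [_ N0 _ _] := dN.
apply: le_Rint; [exact: intg_ind_mul|exact: intg_ind_mul|move=> x].
apply: ler_wpM2r => //; rewrite !indE ler_nat; case: (boolP (_ <= x <= s / 2)) => // /andP[h1 h2].
by rewrite (_ : (_ <= _ <= _) = true)//; apply/andP; split; lra.
Qed.

Lemma lambda_increment (s t c : R) : 0 <= s -> s <= t ->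
  (forall y, s <= y -> y <= t -> half_sinc y <= c) -> lambda t <= lambda s + (t - s) * c.
Proof.
move=> s0 st hc; apply: lambda_le => f N Pf dN fN.
apply: le_trans (_ : mass N s + (t - s) * c <= _); last by rewrite lerD2r; exact: lambda_ge fN.
have iN := energy_density_intg dN; have [_ N0 NN _] := dN; have mN := energy_density_measurable dN.
pose J := ind (s / 2) (t / 2) : R -> R.
have iJ : intg J by exact: intg_ind.
have i1 : intg (fun x => J x * N x) by exact: intg_ind_mul.
have i2 : intg (fun x => J (- x) * N x).
  apply: (@eq_intg _ (fun x => N x * J (- x))); first by move=> x; rewrite mulrC.
  apply: intg_bounded iN; [|by move=> x; exact: normr_ind_le1].
  by apply: (measurableT_comp (measurable_ind _ _)).
have i3 : intg (fun x => J x * N (- x)) by apply: intg_ind_mul; exact: intg_opp.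
have i0 := intg_ind_mul (- (s / 2)) (s / 2) iN.
have E : \int[mu]_x (J (- x) * N x) = \int[mu]_x (J x * N (- x)).
  rewrite -(Rint_opp i3); last by move=> x; rewrite mulr_ge0 ?ind_ge0.
  by apply: eq_Rint => x; rewrite opprK.
(* The interval [- t/2, t/2] is covered by [- s/2, s/2] and two lateral intervals. An inequality
   between indicators is enough, so the shared endpoints need no discussion. *)
apply: (@le_trans _ _ (mass N s + (\int[mu]_x (J x * N x) + \int[mu]_x (J (- x) * N x)))).
  rewrite -!RintD//; last exact: intgD.
  apply: le_Rint; [exact: intg_ind_mul|by apply: intgD => //; exact: intgD|move=> x].
  rewrite -!mulrDl; apply: ler_wpM2r => //; rewrite /J !indE -!natrD ler_nat.
  case: (boolP (_ <= x <= t / 2)) => // /andP[h1 h2].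
  have [xs|xs] := leP x (s / 2).
    have [sx|sx] := leP (- (s / 2)) x; first by rewrite addn_gt0/=.
    by rewrite (_ : (_ <= - x <= _) = true) ?addn1//; apply/andP; split; lra.
  by rewrite (_ : (s / 2 <= x <= t / 2) = true) ?add1n ?addnS//; apply/andP; split; lra.
rewrite lerD2l E -RintD//.
have -> : (t - s) * c = \int[mu]_x (2 * c * J x).
  by rewrite RintZ// Rint_ind1; [field|lra].
apply: le_Rint; [exact: intgD|exact: intgZ|move=> x].
rewrite -mulrDr mulrC; rewrite /J indE; case: (boolP (_ <= _ <= _)) => [/andP[h1 h2]|_]; last by rewrite !mulr0.
have H : half_sinc (2 * x) <= c by apply: hc; lra.
suff : N x + N (- x) <= 2 * c by rewrite (_ : (true : nat)%:R = 1 :> R)// !mulr1.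
have := NN x (- x); have -> : x - - x = 2 * x by ring.
by move: H; rewrite /half_sinc; move: (`|_|) => S H; lra.
Qed.

(** The interval is empty for s < 0 and a single point for s = 0. The value 0 there lets [lambda]
    serve as a cumulative function on the whole line. *)
Lemma lambda_npos (s : R) : s <= 0 -> lambda s = 0.
Proof.
move=> s0; apply/eqP; rewrite eq_le lambda_ge0 andbT; apply: le_trans (le_lambda s0) _.
apply: lambda_le => f N _ dN _; rewrite /mass mul0r oppr0.
have E0 : \int[mu]_x ind 0 0 x = 0 :> R by rewrite Rint_ind1 ?subrr.
rewrite -[leRHS]E0.
apply: le_Rint; [by apply: intg_ind_mul; exact: energy_density_intg|exact: intg_ind|move=> x].
by apply: ler_piMr; [exact: ind_ge0|exact: energy_density_le1].
Qed.

Lemma half_sinc_le1 (y : R) : half_sinc y <= 1.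
Proof. by have := normr_sinc_le1 y; rewrite /half_sinc; move: (`|_|) => S; lra. Qed.

Lemma lambda_lipschitz (s t : R) : s <= t -> lambda t - lambda s <= t - s.
Proof.
move=> st; have [s0|/ltW s0] := leP 0 s.
  by have := lambda_increment s0 st (fun y _ _ => half_sinc_le1 y); rewrite mulr1 -lerBlDl.
have [t0|/ltW t0] := leP t 0; first by rewrite !lambda_npos// subrr subr_ge0.
have := lambda_increment (lexx 0) t0 (fun y _ _ => half_sinc_le1 y).
rewrite (lambda_npos s0) (lambda_npos (lexx 0)).
by move: (lambda t) => A; lra.
Qed.

Lemma half_sinc_continuous : continuous (@half_sinc R).
Proof. by rewrite /half_sinc; cont; exact: continuous_sinc. Qed.

Lemma derive1_right_le (f : R -> R) (s c : R) : derivable f s 1 ->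
  (\forall h \near 0^'+, f (s + h) - f s <= h * c) -> derive1 f s <= c.
Proof.
move=> df fc; rewrite /derive1.
have cf : h^-1 *: (f (h + s) - f s) @[h --> 0^'+] --> derive1 f s.
  apply: cvg_dnbhs_at_right; rewrite derive1E.
  by move: df; rewrite /derivable /derive; under eq_fun do rewrite /= [_ *: 1]mulr1.
apply: (ler_cvg_to cf (cvg_cst c)); near=> h.
have h0 : 0 < h by near: h; exact: nbhs_right_gt.
rewrite /GRing.scale/= mulrC ler_pdivrMr// mulrC.
rewrite (addrC h s); by near: h.
Unshelve. all: by end_near. Qed.

Lemma derive1_lambda_le (s : R) : 0 <= s -> derivable lambda s 1 -> derive1 (@lambda R) s <= half_sinc s.
Proof.
move=> s0 dl; apply/ler_addgt0Pr => eta eta0; apply: derive1_right_le => //.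
have : \forall y \near s, half_sinc y <= half_sinc s + eta.
  have := @half_sinc_continuous s; move/cvgr_le; apply; lra.
move=> /nbhs_ballP[d /= d0 hd]; near=> h.
have h0 : 0 < h by near: h; exact: nbhs_right_gt.
have hlt : h < d by near: h; exact: nbhs_right_lt.
rewrite lerBlDl -[X in X * _](addrK s) [h + s]addrC; apply: lambda_increment => //; first lra.
move=> y sy yh; apply: hd; rewrite /= /ball/= ler0_norm; lra.
Unshelve. all: by end_near. Qed.

Lemma sinc_sqr_ge (x : R) : 1 - (pi * x) ^+ 2 / 3 <= sinc x ^+ 2.
Proof.
have := sinc_ge x; move: (sqr_ge0 (pi * x)) (sqr_ge0 (sinc x)); move: ((pi * x) ^+ 2) (sinc x) => y S y0 S0 h.
have [|] := leP 0 (1 - y / 6); nra.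
Qed.

(** The left-hand side is also the integral over [0, s] of 1 - (pi x)^2 / 12, the beginning of the
    expansion of [half_sinc]: the lower bound for [lambda] and the upper bound for its derivative
    agree up to the third order. *)
Lemma lambda_cubic (s : R) : 0 <= s -> s - pi ^+ 2 * s ^+ 3 / 36 <= lambda s.
Proof.
move=> s0; have [N dN fN] := PW2_sphere_density (@csinc_PW2_sphere R).
apply: le_trans (lambda_ge s (@csinc_PW2_sphere R) dN fN).
have EN : {ae mu, forall x, ind (- (s / 2)) (s / 2) x * sinc x ^+ 2 = ind (- (s / 2)) (s / 2) x * N x}.
  by apply: ae_imply fN => x <-; rewrite /csinc /= [0 ^+ 2]expr0n addr0 sqrtr_sqr real_normK ?num_real.
have iS : intg (fun x : R => sinc x ^+ 2) by case: (@sqintg_sinc R).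
have mN := energy_density_measurable dN.
rewrite /mass -(Rint_ae_eq _ _ EN); last 2 first.
- by apply: intg_measurable; exact: intg_ind_mul.
- by apply: measurable_funM => //; exact: measurable_ind.
have ss : - (s / 2) <= s / 2 by lra.
have -> : s - pi ^+ 2 * s ^+ 3 / 36 = \int[mu]_x (ind (- (s / 2)) (s / 2) x * (1 - (pi * x) ^+ 2 / 3)).
  rewrite Rint_ind /Rintegral.
  pose F x : R := x - pi ^+ 2 / 9 * (x * x * x).
  have dF (x : R) : is_derive x 1 F (1 - (pi * x) ^+ 2 / 3).
    by apply: is_derive_eq; rewrite /GRing.scale/=; move: (pi : R) => P; field.
  rewrite (FTC_itv ss _ dF); last by cont.
  by rewrite /F /=; move: (pi : R) => P; field.
apply: le_Rint; last first.
- by move=> x; apply: ler_wpM2l; [exact: ind_ge0|exact: sinc_sqr_ge].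
- exact: intg_ind_mul.
have : mu.-integrable `[(- (s / 2))%R, (s / 2)%R] (EFin \o (fun x => 1 - (pi * x) ^+ 2 / 3)).
  by apply: continuous_compact_integrable; [exact: segment_compact|apply: continuous_subspaceT; cont].
move=> /integrable_mkcond => /(_ (measurable_itv _)); apply: eq_integrable => // t _.
by rewrite /= (ind_mul _ _ (fun x => 1 - (pi * x) ^+ 2 / 3)) !patchE; case: ifP.
Qed.

End LambdaTheory.

(** * Densities of Lipschitz functions through Stieltjes measures *)

Section StieltjesDensity.
Context {R : realType}.
Local Notation mu := (@lebesgue_measure R).
Local Notation lsm := lebesgue_stieltjes_measure.

Lemma stieltjes_oc (f : cumulative R R) (a b : R) : a <= b ->
  lsm f `]a, b]%classic = (f b - f a)%:E.
Proof.
move=> ab; rewrite /lsm /measure_extension measurable_mu_extE/=; last exact: is_ocitv.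
by rewrite wlength_itv_bnd.
Qed.

(* The Stieltjes measures of f and id - f add up to Lebesgue measure. *)
Lemma stieltjes_le_lebesgue (f g : cumulative R R) : (forall x, f x + g x = x) ->
  forall A : set (measurableTypeR R), measurable A -> (lsm f A <= mu A)%E.
Proof.
move=> fg A mA.
pose m1 : {measure set (measurableTypeR R) -> \bar R} := lsm f.
pose m2 : {measure set (measurableTypeR R) -> \bar R} := lsm g.
rewrite (@lebesgue_measure_unique _ (measure_add m1 m2) _ A mA).
  rewrite [X in (_ <= X)%E](_ : _ = m1 A + m2 A)%E; last exact: (measure_addE m1 m2).
  by rewrite leeDl.
move=> X /ocitvP[->|[[a b] /= ab ->]]; first by rewrite !measure0.
rewrite [RHS](_ : _ = m1 `]a, b]%classic + m2 `]a, b]%classic)%E; last exact: (measure_addE m1 m2).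
transitivity ((f b - f a)%:E + (g b - g a)%:E)%E; last first.
  by congr (_ + _)%E; apply/esym; exact: (stieltjes_oc _ (ltW ab)).
rewrite /lebesgue_measure (stieltjes_oc (idfun : cumulative R R) (ltW ab)) -EFinD; congr EFin.
by move: (fg a) (fg b) => /= fa fb; lra.
Qed.

Lemma stieltjes_le1 (f : cumulative R R) : (forall x, 0 <= f x <= 1) ->
  (lsm f setT <= 1%:E)%E.
Proof.
move=> f01; rewrite -(bigcup_itvT false false).
pose I n : set R := `]- (n%:R), n%:R]%classic.
have h : (lsm f \o I) n @[n --> \oo] --> lsm f (\bigcup_n I n).
  apply: nondecreasing_cvg_mu; rewrite /I//; first exact: bigcup_measurable.
  by move=> *; apply/subsetPset/subset_itv; rewrite leBSide/= ?lerN2 ler_nat.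
rewrite -(cvg_lim _ h)//; apply: lime_le; first by apply/cvg_ex; exists (lsm f (\bigcup_n I n)).
apply: nearW => n; rewrite /= /I (stieltjes_oc f) ?lee_fin; last by rewrite ge0_cp.
by have := f01 n%:R; have := f01 (- n%:R); move: (f _) (f _) => A B; lra.
Qed.

(** Radon-Nikodym: being dominated by Lebesgue measure, the Stieltjes measure of [f] has a density.
    The existence of the cumulative function g = id - f encodes that [f] is 1-Lipschitz. *)
Lemma stieltjes_density (f g : cumulative R R) : (forall x, f x + g x = x) ->
  (forall x, 0 <= f x <= 1) -> exists h : R -> R, [/\ intg h, forall x, 0 <= h x,
    (\int[mu]_x (h x)%:E <= 1%:E)%E &
    forall a b, a <= b -> (\int[mu]_(x in `]a, b]) (h x)%:E = (f b - f a)%:E)%E].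
Proof.
move=> fg f01.
have fin : fin_num_fun (lsm f : set (measurableTypeR R) -> \bar R).
  move=> A mA; rewrite ge0_fin_numE ?measure_ge0//.
  apply: le_lt_trans (le_measure _ _ _ (@subsetT _ A)) _; rewrite ?inE//.
  by apply: le_lt_trans (stieltjes_le1 f01) _; rewrite ltry.
pose m : {measure set (measurableTypeR R) -> \bar R} := lsm f.
pose nu : {finite_measure set (measurableTypeR R) -> \bar R} :=
  HB.pack (Measure.sort m)
    (@Measure_isFinite.Build _ (measurableTypeR R) R m fin).
have dom : nu `<< mu.
  apply/null_content_dominatesP => A mA A0; apply/eqP; rewrite eq_le measure_ge0 andbT.
  by rewrite -A0; exact: (stieltjes_le_lebesgue fg).
pose h0 := Radon_Nikodym_SigmaFinite.f nu mu.
have h0E x : (fine (h0 x))%:E = h0 x by rewrite fineK// Radon_Nikodym_SigmaFinite.f_fin_num.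
exists (fine \o h0); split.
- have := Radon_Nikodym_SigmaFinite.f_integrable dom; apply: eq_integrable => // x _.
  by rewrite /= h0E.
- by move=> x; apply: fine_ge0; exact: (Radon_Nikodym_SigmaFinite.f_ge0 dom).
- under eq_integral do rewrite /= h0E.
  by rewrite -(Radon_Nikodym_SigmaFinite.f_integral dom)//; exact: (stieltjes_le1 f01).
- move=> a b ab; under eq_integral do rewrite /= h0E.
  rewrite -(Radon_Nikodym_SigmaFinite.f_integral dom)//.
  exact: (stieltjes_oc f ab).
Qed.

Lemma lipschitz1_continuous (f : R -> R) : {homo f : s t / s <= t} ->
  (forall s t, s <= t -> f t - f s <= t - s) -> continuous f.
Proof.
move=> nd lip x; apply/cvgrPdist_le => e e0; near=> y.
have xy : `|x - y| <= e by near: y; exact: cvgr_dist_le.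
apply: le_trans xy; have [yx|/ltW xy] := leP y x.
  by rewrite !ger0_norm ?subr_ge0 ?nd//; exact: lip.
by rewrite !ler0_norm ?subr_le0 ?nd// !opprB; exact: lip.
Unshelve. all: by end_near. Qed.

(** The Radon-Nikodym density reproduces [f] as its own primitive, and Lebesgue differentiation of
    this primitive identifies the density with the derivative almost everywhere. *)
Lemma lipschitz1_density (f : R -> R) : {homo f : s t / s <= t} ->
  (forall s t, s <= t -> f t - f s <= t - s) -> (forall x, 0 <= f x <= 1) ->
  (forall x, x <= 0 -> f x = 0) ->
  exists h : R -> R, [/\ intg h, forall x, 0 <= h x, (\int[mu]_x (h x)%:E <= 1%:E)%E,
    forall b, 0 <= b -> (\int[mu]_(x in `]0%R, b]) (h x)%:E = (f b)%:E)%E &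
    {ae mu, forall x : R, 0 < x -> derivable f x 1 /\ derive1 f x = h x}].
Proof.
move=> nd lip f01 f0; have cf := lipschitz1_continuous nd lip.
have cg : continuous (fun x => x - f x) by move=> x; apply: cvgB; [exact: cvg_id|exact: cf].
have ng : {homo (fun x => x - f x) : s t / s <= t} by move=> s t st; have := lip _ _ st; lra.
pose F : cumulative R R := HB.pack f (isCumulative.Build R _ R f nd (right_continuousW cf)).
pose G : cumulative R R := HB.pack (fun x => x - f x)
  (isCumulative.Build R _ R (fun x => x - f x) ng (right_continuousW cg)).
have FG x : F x + G x = x by rewrite /F /G /=; lra.
have [h [ih h0 h1 hab]] := stieltjes_density FG f01.
have hb (b : R) : 0 <= b -> (\int[mu]_(x in `]0%R, b]) (h x)%:E = (f b)%:E)%E.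
  by move=> b0; rewrite (hab _ _ b0) /F /= (f0 0)// subr0.
exists h; split => //.
have hf : (fun y => \int[mu]_(t in [set` Interval (BRight 0) (BRight y)]) h t) = f.
  apply/funext => y; have [y0|y0] := leP 0 y; first by rewrite /Rintegral hb.
  by rewrite set_itv_ge ?Rintegral_set0 ?f0 ?(ltW y0)// bnd_simp -leNgt ltW.
have := @FTC1 R h (BRight 0); rewrite /= hf => FTC.
have {}FTC : {ae mu, forall x : R, (BRight 0 < BRight x :> itv_bound R)%O -> derivable f x 1 /\ derive1 f x = h x}.
  apply: FTC.
  - by move=> y; exact: (integrableS measurableT).
  - by apply: open_integrable_locally => //; exact: openT.
by apply: ae_imply FTC => x H x0; apply: H; rewrite bnd_simp.
Qed.

End StieltjesDensity.

(** * Bounds for Lambda_q *)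

Section LowerIntegral.
Context {R : realType}.
Local Notation mu := (@lebesgue_measure R).
Implicit Types f g : R -> \bar R.

Import HBNNSimple.

(* The integral of a nonnegative function is a supremum over simple functions,
   which makes sense and is monotone without measurability. *)
Lemma le_lower_integral f g : (forall x, (0 <= f x)%E) -> (forall x, (f x <= g x)%E) ->
  (\int[mu]_x f x <= \int[mu]_x g x)%E.
Proof.
move=> f0 fg; have g0 x : (0 <= g x)%E by exact: le_trans (fg x).
rewrite !ge0_integralTE//; apply: le_ereal_sup => _ [h hf <-]; exists h => //.
by move=> x; exact: le_trans (hf x) (fg x).
Qed.

Lemma ae_le_lower_integral_r f g : (forall x, (0 <= f x)%E) -> (forall x, (0 <= g x)%E) ->
  measurable_fun setT g -> {ae mu, forall x, (f x <= g x)%E} ->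
  (\int[mu]_x f x <= \int[mu]_x g x)%E.
Proof.
move=> f0 g0 mg fg; rewrite (ge0_integralTE mu f0); apply: ge_ereal_sup => _ [h hf <-].
rewrite -integralT_nnsfun; apply: ae_ge0_le_integral => //.
- by move=> x _; rewrite lee_fin; exact: fun_ge0.
- apply/measurable_EFinP; exact: measurable_funP.
- by apply: ae_imply fg => x fgx _; exact: le_trans (hf x) fgx.
Qed.

Lemma ae_le_lower_integral_l f g : (forall x, (0 <= f x)%E) -> (forall x, (0 <= g x)%E) ->
  measurable_fun setT f -> {ae mu, forall x, (f x <= g x)%E} ->
  (\int[mu]_x f x <= \int[mu]_x g x)%E.
Proof.
move=> f0 g0 mf [N [mN N0 fg]].
(* Setting [f] to 0 on the exceptional null set preserves its integral and makes the inequality hold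
   everywhere. *)
pose k := f \_ (~` N).
have k0 x : (0 <= k x)%E by rewrite /k patchE; case: ifP.
have mk : measurable_fun setT k.
  by apply/(measurable_restrictT _ _).1; [exact: measurableC|exact: measurable_funTS].
have -> : (\int[mu]_x f x = \int[mu]_x k x)%E.
  apply: ae_eq_integral => //; exists N; split => // x /=; apply: contra_notP => Nx.
  by rewrite /k patchE mem_set.
apply: le_lower_integral => // x; rewrite /k patchE; case: ifPn => // /set_mem Nx.
by apply: contrapT => fx; exact: Nx (fg _ fx).
Qed.

(** Measurability is asked of [g] alone: this is how the pointwise derivative of [lambda], known
    only almost everywhere, is replaced by a measurable density inside [Lambda_]. *)
Lemma ae_eq_lower_integral (D : set R) f g : measurable D ->
  (forall x, (0 <= f x)%E) -> (forall x, (0 <= g x)%E) ->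
  measurable_fun setT g -> {ae mu, forall x, D x -> f x = g x} ->
  (\int[mu]_(x in D) f x = \int[mu]_(x in D) g x)%E.
Proof.
move=> mD f0 g0 mg fg; rewrite integral_mkcond [RHS]integral_mkcond.
have mgD : measurable_fun setT (g \_ D).
  by apply/(measurable_restrictT _ _).1 => //; exact: measurable_funTS.
have fD0 x : (0 <= (f \_ D) x)%E by rewrite patchE; case: ifP.
have gD0 x : (0 <= (g \_ D) x)%E by rewrite patchE; case: ifP.
have E : {ae mu, forall x, (f \_ D) x = (g \_ D) x}.
  by apply: ae_imply fg => x fgx; rewrite !patchE; case: ifPn => // /set_mem.
apply/eqP; rewrite eq_le; apply/andP; split.
  by apply: ae_le_lower_integral_r => //; apply: ae_imply E => x ->.
by apply: ae_le_lower_integral_l => //; apply: ae_imply E => x ->.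
Qed.

End LowerIntegral.

Section LambdaQ.
Context {R : realType}.
Local Notation mu := (@lebesgue_measure R).

Lemma lambda_density : exists h : R -> R, [/\ intg h, forall x, 0 <= h x,
  (\int[mu]_x (h x)%:E <= 1%:E)%E,
  forall b, 0 <= b -> (\int[mu]_(x in `]0%R, b]) (h x)%:E = (lambda b)%:E)%E &
  {ae mu, forall x : R, 0 < x -> derive1 (@lambda R) x = h x /\ h x <= half_sinc x}].
Proof.
have [h [ih h0 h1 hb hd]] := @lipschitz1_density R (@lambda R)
  (fun s t => @le_lambda R s t) (@lambda_lipschitz R)
  (fun x => introT andP (conj (lambda_ge0 x) (lambda_le1 x))) (@lambda_npos R).
exists h; split => //; apply: ae_imply hd => x H x0.
have [dl E] := H x0; split => //; rewrite -E.
by apply: derive1_lambda_le => //; exact: ltW.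
Qed.

Lemma Lambda_E (h : R -> R) q : measurable_fun setT h ->
  {ae mu, forall x : R, 0 < x -> derive1 (@lambda R) x = h x /\ h x <= half_sinc x} ->
  (Lambda_ q = \int[mu]_(x in `]0%R, +oo[) (h x `^ (q / 2))%:E)%E.
Proof.
move=> mh hd; apply: ae_eq_lower_integral => //.
- by move=> x; rewrite lee_fin powR_ge0.
- by move=> x; rewrite lee_fin powR_ge0.
- by apply/measurable_EFinP; exact: (measurableT_comp (measurable_powR (q / 2)) mh).
- apply: ae_imply hd => x H; rewrite /= in_itv/= andbT => x0.
  by have [-> _] := H x0.
Qed.

(** Almost everywhere on the half-line, h^p is at most the Gaussian for x <= e / 2 and at most k^(p
    - 1) h beyond; the integral of [h] is at most 1 because [lambda] is. The bound is the same as
    the one for [M_]. *)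
Lemma Lambda_le (e q : R) : 0 < e -> e < 1 -> 2 <= q ->
  (Lambda_ q <= (Num.sqrt (pi / ((1 - e) * pi ^+ 2 / 12 * (q / 2))) / 2 +
    (1 - e ^+ 2 / 24) `^ (q / 2 - 1))%:E)%E.
Proof.
move=> e0 e1 q2; have [h [ih h0 h1 hb hd]] := lambda_density.
have mh := intg_measurable ih; rewrite (Lambda_E q mh hd).
set p := q / 2; set a := (1 - e) * pi ^+ 2 / 12; set k := 1 - e ^+ 2 / 24.
have p1 : 1 <= p by rewrite ler_pdivlMr//; lra.
have p0 := lt_le_trans ltr01 p1; have k0 : 0 < k by exact: far_bound_gt0.
have a0 : 0 < a * p by rewrite mulr_gt0// divr_gt0// mulr_gt0 ?subr_gt0// exprn_gt0// pi_gt0.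
have mg : measurable_fun setT (fun x : R => expR (- (a * p * x ^+ 2))).
  by apply: continuous_measurable_fun; cont.
have mkh : measurable_fun setT (fun x => (k `^ (p - 1))%:E * (h x)%:E)%E.
  by under eq_fun do rewrite -EFinM; apply/measurable_EFinP; exact: measurable_funM.
have mhp : measurable_fun setT (fun x => h x `^ p) by exact: (measurableT_comp (measurable_powR p) mh).
apply: (@le_trans _ _ (\int[mu]_(x in `]0%R, +oo[) ((expR (- (a * p * x ^+ 2)))%:E + (k `^ (p - 1))%:E * (h x)%:E))%E).
  apply: ae_ge0_le_integral => //.
  - by move=> x _; rewrite lee_fin powR_ge0.
  - by apply/measurable_EFinP; exact: measurable_funTS.
  - by move=> x _; rewrite -EFinM -EFinD lee_fin addr_ge0 ?expR_ge0 ?mulr_ge0 ?powR_ge0.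
  - by apply: measurable_funTS; apply: emeasurable_funD => //; exact/measurable_EFinP.
  apply: ae_imply hd => x H; rewrite /= in_itv/= andbT => x0; have [_ hx] := H x0.
  rewrite -EFinM -EFinD lee_fin.
  have [xe|/ltW xe] := leP `|x| (e / 2).
    apply: (@le_trans _ _ (expR (- (a * p * x ^+ 2)))); last by rewrite lerDl mulr_ge0 ?powR_ge0.
    have -> : expR (- (a * p * x ^+ 2)) = expR (- (a * x ^+ 2)) `^ p by rewrite -expRM; congr expR; ring.
    by apply: le_powR_nneg; [exact: ltW| |apply: le_trans hx _; exact: half_sinc_near].
  apply: (@le_trans _ _ (k `^ (p - 1) * h x)); last by rewrite lerDr expR_ge0.
  rewrite powR_split//; apply: ler_wpM2r => //; apply: le_powR_nneg => //; first by rewrite subr_ge0.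
  by apply: le_trans hx _; exact: half_sinc_far.
rewrite ge0_integralD//; last 3 first.
- by apply/measurable_EFinP; exact: measurable_funTS.
- by move=> x _; rewrite -EFinM lee_fin mulr_ge0 ?powR_ge0.
- exact: measurable_funTS.
rewrite EFinD; apply: leeD.
  rewrite -integral0y_gaussZ//; apply: ge0_subset_integral => //.
  - by apply/measurable_EFinP; exact: measurable_funTS.
  - by move=> x /=; rewrite !in_itv/= !andbT => /ltW.
apply: (@le_trans _ _ (\int[mu]_x ((k `^ (p - 1))%:E * (h x)%:E))%E).
  by apply: ge0_subset_integral => // x _; rewrite -EFinM lee_fin mulr_ge0 ?powR_ge0.
rewrite ge0_integralZl//; last 3 first.
- by apply/measurable_EFinP.
- by move=> x _; rewrite lee_fin.
- by rewrite lee_fin powR_ge0.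
rewrite -[leRHS]mule1; apply: lee_wpmul2l => //.
by rewrite lee_fin powR_ge0.
Qed.

(* Young's inequality for x * v^(p-1): v^p - x^p <= p v^(p-1) (v - x). *)
Lemma powR_sub_le (p x v : R) : 1 < p -> 0 <= x -> x <= v -> v <= 1 ->
  v `^ p + p * x <= x `^ p + p * v.
Proof.
move=> p1 x0 xv v1; have v0 := le_trans x0 xv; have p0 : 0 < p by lra.
pose q := p / (p - 1); have q0 : 0 < q by rewrite divr_gt0//; lra.
have := @conjugate_powR R x (v `^ (p - 1)) p q x0 (powR_ge0 _ _) p0 q0.
have -> : (v `^ (p - 1)) `^ q = v `^ p.
  by rewrite -powRrM /q mulrCA mulfV ?mulr1//; lra.
have pq : p^-1 + q^-1 = 1 by rewrite /q invf_div; field; lra.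
move=> /(_ pq).
rewrite [v `^ p]powR_split ?(ltW p1)//.
have -> : q^-1 = 1 - p^-1 by rewrite /q invf_div; field; lra.
have w1 : v `^ (p - 1) <= 1.
  have := @le_powR_nneg R (p - 1) v 1; rewrite powR1; apply => //; lra.
move: (v `^ (p - 1)) w1 (powR_ge0 v (p - 1)) => w w1 w0.
move: (x `^ p) => X h.
have {h} : p * (x * w) <= X + (p - 1) * (w * v).
  by have := ler_wpM2l (ltW p0) h; rewrite [leRHS](_ : _ = X + (p - 1) * (w * v))//; field; lra.
have : p * w * (v - x) <= p * (v - x).
  by apply: ler_wpM2r; [lra|rewrite ler_piMr// ltW].
lra.
Qed.

(** A gap V - L between the integrals of [v] and [h] becomes a gap of at most p (V - L) between the
    integrals of their powers. The terms are arranged so that no difference of possibly infinite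
    integrals occurs. *)
Lemma int_powR_compare (p s0 L V : R) (h v : R -> R) : 1 < p ->
  measurable_fun setT h -> measurable_fun setT v -> (forall x, 0 <= h x) ->
  (forall x, 0 < x -> x <= s0 -> 0 <= v x /\ v x <= 1) ->
  {ae mu, forall x : R, 0 < x -> x <= s0 -> h x <= v x} ->
  (\int[mu]_(x in `]0%R, s0]) (h x)%:E = L%:E)%E ->
  (\int[mu]_(x in `]0%R, s0]) (v x)%:E = V%:E)%E ->
  (\int[mu]_(x in `]0%R, s0]) (v x `^ p)%:E + (p * L)%:E <=
   \int[mu]_(x in `]0%R, s0]) (h x `^ p)%:E + (p * V)%:E)%E.
Proof.
move=> p1 mh mv h0 v01 hv hL vV; have p0 : 0 <= p by lra.
pose D0 : set R := `]0%R, s0]%classic; have mD0 : measurable D0 by exact: measurable_itv.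
have mph (w : R -> R) : measurable_fun setT w -> measurable_fun D0 (fun x => p%:E * (w x)%:E)%E.
  move=> mw; apply: measurable_funTS; under eq_fun do rewrite -EFinM.
  by apply/measurable_EFinP; exact: measurable_funM.
have mE (w : R -> R) : measurable_fun setT w -> measurable_fun D0 (fun x => (w x)%:E).
  by move=> mw; apply/measurable_EFinP; exact: measurable_funTS.
have mpow (w : R -> R) : measurable_fun setT w -> measurable_fun setT (fun x => w x `^ p).
  by move=> mw; exact: (measurableT_comp (measurable_powR p) mw).
have D0E (x : R) : D0 x -> 0 < x /\ x <= s0 by rewrite /D0 /= in_itv/= => /andP[].
have w0 (w : R -> R) x : (0 <= (w x `^ p)%:E)%E by rewrite lee_fin powR_ge0.
have ph0 x : (0 <= p%:E * (h x)%:E)%E by rewrite -EFinM lee_fin mulr_ge0.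
have pv0 x : D0 x -> (0 <= p%:E * (v x)%:E)%E.
  by move=> /D0E[x0 xs]; rewrite -EFinM lee_fin mulr_ge0//; have [] := v01 _ x0 xs.
have m1 := mE _ (mpow _ mv); have m2 := mph _ mh; have m3 := mE _ (mpow _ mh); have m4 := mph _ mv.
have : (\int[mu]_(x in D0) ((v x `^ p)%:E + p%:E * (h x)%:E) <=
    \int[mu]_(x in D0) ((h x `^ p)%:E + p%:E * (v x)%:E))%E.
  apply: ae_ge0_le_integral => //.
  - by move=> x _; apply: adde_ge0.
  - exact: emeasurable_funD.
  - by move=> x Dx; apply: adde_ge0 => //; exact: pv0.
  - exact: emeasurable_funD.
  apply: ae_imply hv => x H /D0E[x0 xs]; have [v0 v1] := v01 _ x0 xs.
  by rewrite -!EFinM -!EFinD lee_fin; apply: powR_sub_le => //; exact: H.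
rewrite (ge0_integralD mu mD0 _ m1 _ m2)//.
rewrite (ge0_integralD mu mD0 _ m3 _ m4)//.
have p0E : (0 <= p%:E)%E by rewrite lee_fin.
rewrite (ge0_integralZl mu mD0 (mE _ mh) _ p0E)//; last by move=> x _; rewrite lee_fin.
rewrite (ge0_integralZl mu mD0 (mE _ mv) _ p0E)//; last first.
  by move=> x /D0E[x0 xs]; rewrite lee_fin; have [] := v01 _ x0 xs.
by rewrite /D0 hL vV -!EFinM.
Qed.

(** The density [h] is compared on ]0, s0] with a polynomial [v] above [half_sinc]. By
    [lambda_cubic] the integrals of [v] and [h] differ by at most pi^4 s0^5 / 1200, and v^p
    dominates a Gaussian whose tail beyond s0 is the correction with sqrt 2. *)
Lemma Lambda_ge (e q s0 b : R) : 0 < e -> e < 1 -> 2 < q -> 0 <= s0 -> s0 <= e / 4 ->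
  b = (1 + e) * pi ^+ 2 / 12 * (q / 2) ->
  ((Num.sqrt (pi / b) / 2 * (1 - Num.sqrt 2 * expR (- (b * s0 ^+ 2 / 2))) -
     q / 2 * (pi ^+ 4 / 1200 * s0 ^+ 5))%:E <= Lambda_ q)%E.
Proof.
move=> e0 e1 q2 s00 se bE; have [h [ih h0 h1 hb hd]] := lambda_density.
have mh := intg_measurable ih; rewrite (Lambda_E q mh hd).
set p := q / 2; rewrite -/p in bE; have p1 : 1 < p by rewrite ltr_pdivlMr//; lra.
have p0 : 0 < p by lra.
have b0 : 0 < b by rewrite bE mulr_gt0// divr_gt0// mulr_gt0 ?exprn_gt0 ?pi_gt0//; lra.
(* The mean of 1 and of the Taylor upper bound of sinc. Its quartic coefficient 1/240 integrates to
   1/1200, and its other terms integrate to the lower bound of [lambda_cubic]. *)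
pose v x : R := 1 - (pi * x) ^+ 2 / 12 + (pi * x) ^+ 4 / 240.
have y1 (x : R) : 0 < x -> x <= s0 -> (pi * x) ^+ 2 <= e ^+ 2.
  move=> x0 xs; apply: lerXn2r; rewrite ?nnegrE ?mulr_ge0 ?pi_ge0 ?(ltW x0) ?(ltW e0)//.
  have := @pi_lt4 R; have := @pi_gt0 R; move: (pi : R) => P P0 P4.
  apply: (@le_trans _ _ (4 * x)); last by lra.
  by apply: ler_wpM2r; lra.
have e21 : e ^+ 2 <= e by rewrite expr2; nra.
have vw (x : R) : v x = 1 - (pi * x) ^+ 2 / 12 + ((pi * x) ^+ 2) ^+ 2 / 240 by rewrite /v -exprM.
have v1 (x : R) : 0 < x -> x <= s0 -> v x <= 1.
  by move=> x0 xs; rewrite vw; move: (y1 _ x0 xs) (sqr_ge0 (pi * x)); move: ((pi * x) ^+ 2) => y; nra.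
have uv (x : R) : 0 < x -> x <= s0 -> half_sinc x <= v x.
  move=> x0 xs; have := sinc_ge x; have := sinc_le x; rewrite (_ : (pi * x) ^+ 4 = ((pi * x) ^+ 2) ^+ 2); last by rewrite -exprM.
  rewrite vw; move: (y1 _ x0 xs) (sqr_ge0 (pi * x)); move: ((pi * x) ^+ 2) => y ye yp B A.
  have C : `|sinc x| <= 1 - y / 6 + y ^+ 2 / 120.
    by rewrite ler_norml; apply/andP; split => //; have := sqr_ge0 y; nra.
  by rewrite /half_sinc; move: (`|_|) C => t C; lra.
have gv (x : R) : 0 < x -> x <= s0 -> expR (- (b * x ^+ 2)) <= v x `^ p.
  move=> x0 xs; have -> : expR (- (b * x ^+ 2)) = expR (- ((1 + e) * ((pi * x) ^+ 2 / 12))) `^ p.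
    by rewrite -expRM; congr expR; rewrite bE; move: (pi : R) => P; ring.
  apply: le_powR_nneg; [exact: ltW|exact: expR_ge0|].
  have y := y1 _ x0 xs; have y0 := sqr_ge0 (pi * x).
  apply: (@le_trans _ _ (1 - (pi * x) ^+ 2 / 12)).
    by apply: expR_le_subr => //; move: ((pi * x) ^+ 2) y y0 => w *; lra.
  rewrite vw lerDl; apply: mulr_ge0; first exact: sqr_ge0.
  by rewrite invr_ge0 ler0n.
have mhp : measurable_fun setT (fun x => h x `^ p) by exact: (measurableT_comp (measurable_powR p) mh).
have cv : continuous v by rewrite /v; cont.
have mv := continuous_measurable_fun cv.
have mvp : measurable_fun setT (fun x => v x `^ p) by exact: (measurableT_comp (measurable_powR p) mv).
(* The Gaussian comparison runs over the whole half-line, so v^p is extended by 0 beyond s0, where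
   only nonnegativity is required. *)
pose D0 : set R := `]0%R, s0]%classic; pose F := (fun x => v x `^ p) \_ D0.
have mD0 : measurable D0 by exact: measurable_itv.
have F0 x : 0 <= F x by rewrite /F patchE; case: ifP => // _; exact: powR_ge0.
have mF : measurable_fun setT F by apply/(measurable_restrictT _ _).1 => //; exact: measurable_funTS.
have G1 := @gauss_trunc_le R `]0%R, +oo[%classic F b s0 2^-1 (measurable_itv _) b0 s00.
have {}G1 : ((Num.sqrt (pi / b) / 2 * (1 - Num.sqrt 2 * expR (- (b * s0 ^+ 2 / 2))))%:E <=
    \int[mu]_(x in D0) (v x `^ p)%:E)%E.
  rewrite [_ / 2]mulrC; apply: (le_trans (G1 _ _ _ _)).
  - move=> c c0; rewrite [_ * Num.sqrt _]mulrC -integral0y_gaussZ// integral_itv_obnd_cbnd//.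
    by apply/measurable_EFinP; apply: measurable_funTS; apply: continuous_measurable_fun; cont.
  - exact: measurable_funTS.
  - by [].
  - move=> x /=; rewrite in_itv/= andbT => x0 xs; rewrite /F patchE mem_set; last first.
      by rewrite /D0 /= in_itv/= x0 (le_trans (ler_norm x)).
    by apply: gv => //; exact: le_trans (ler_norm x) xs.
  rewrite [leLHS](_ : _ = \int[mu]_(x in `]0%R, +oo[ `&` D0) (v x `^ p)%:E)%E.
    rewrite (_ : `]0%R, +oo[ `&` D0 = D0)//; apply/seteqP; split => x; first by case.
    by rewrite /D0 /= !in_itv/= => /andP[-> ->].
  rewrite integral_mkcondr; apply: eq_integral => x _; rewrite /F !patchE.
  by case: ifP.
have vV : (\int[mu]_(x in `]0%R, s0]) (v x)%:E = (s0 - pi ^+ 2 * s0 ^+ 3 / 36 + pi ^+ 4 / 1200 * s0 ^+ 5)%:E)%E.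
  rewrite integral_itv_obnd_cbnd; last first.
    by apply/measurable_EFinP; exact: measurable_funTS.
  pose W (x : R) : R := x - pi ^+ 2 / 36 * (x * x * x) + pi ^+ 4 / 1200 * (x * x * x * x * x).
  have dW (x : R) : is_derive x 1 W (v x).
    by apply: is_derive_eq; rewrite /GRing.scale/= /v; move: (pi : R) => P; field.
  by rewrite (FTC_itv s00 cv dW) /W; congr EFin; move: (pi : R) => P; field.
have v01 (x : R) : 0 < x -> x <= s0 -> 0 <= v x /\ v x <= 1.
  by move=> x0 xs; split; [exact: le_trans (half_sinc_ge0 x) (uv _ x0 xs)|exact: v1].
have hv : {ae mu, forall x : R, 0 < x -> x <= s0 -> h x <= v x}.
  by apply: ae_imply hd => x H x0 xs; have [_ hx] := H x0; exact: le_trans hx (uv _ x0 xs).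
have H := int_powR_compare p1 mh mv h0 v01 hv (hb _ s00) vV.
have cub := lambda_cubic s00.
have BL : (\int[mu]_(x in `]0%R, s0]) (h x `^ p)%:E <= \int[mu]_(x in `]0%R, +oo[) (h x `^ p)%:E)%E.
  apply: ge0_subset_integral => //.
  - by apply/measurable_EFinP; exact: measurable_funTS.
  - by move=> x _; rewrite lee_fin powR_ge0.
  - by move=> x /=; rewrite !in_itv/= andbT => /andP[].
have := le_trans (leeD2r (p * lambda s0)%:E G1) (le_trans H (leeD2r _ BL)).
have {cub} := ler_wpM2l (ltW p0) cub.
move: (integral _ _ _) (pi : R) (lambda s0) (_ * (1 - _)) => [r| |] P l G.
- by rewrite -!EFinD !lee_fin; lra.
- by move=> _ _; rewrite leey.
- by move=> _; rewrite -EFinD addNye.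
Qed.

End LambdaQ.

(** * Rescaling and limits as q tends to infinity *)

Section Limits.
Context {R : realType}.

(** The parameter e is fixed before q grows, so that [A] and the threshold [B] may depend on it.
    With e <= eta / 8 and e <= 1/2 both main terms are within eta / 4 of 1, and A / q takes at most
    eta / 2. *)
Lemma cvgy1_of_bounds (X : R -> R) :
  (forall e, 0 < e -> e < 1 -> exists A B : R, forall q, B <= q -> 0 < q ->
    1 - 2 * e - A / q <= X q /\ X q <= (1 - e)^-1 + A / q) ->
  X q @[q --> +oo] --> (1 : R).
Proof.
move=> h; apply/cvgrPdist_le => eta eta0.
pose e : R := Num.min (1 / 2) (eta / 8).
have e0 : 0 < e by rewrite lt_min; apply/andP; split; lra.
have e1 : e <= 1 / 2 by rewrite ge_min lexx.
have e2 : e <= eta / 8 by rewrite ge_min lexx orbT.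
have [|A [B hAB]] := h e e0; first by lra.
near=> q.
have q0 : 0 < q by near: q; exact: nbhs_pinfty_gt.
have qB : B <= q by near: q; apply: nbhs_pinfty_ge; rewrite num_real.
have qA : A * (2 / eta) <= q by near: q; apply: nbhs_pinfty_ge; rewrite num_real.
have [lo up] := hAB q qB q0.
have Aq : A / q <= eta / 2.
  rewrite ler_pdivrMr//; apply: le_trans (_ : eta / 2 * (A * (2 / eta)) <= _).
    by rewrite le_eqVlt; apply/orP; left; apply/eqP; field; lra.
  by apply: ler_wpM2l => //; lra.
have inve : (1 - e)^-1 <= 1 + 2 * e.
  by rewrite -[leLHS]mul1r ler_pdivrMr; nra.
move: (A / q) ((1 - e)^-1) lo up Aq inve => a b *.
by rewrite ler_norml; apply/andP; split; lra.
Unshelve. all: by end_near. Qed.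

(** The reciprocal of the expected asymptotic value sqrt (6 / (pi q)). *)
Definition scale (q : R) : R := Num.sqrt (pi * q / 6).

Lemma scale_gt0 q : 0 < q -> 0 < scale q.
Proof. by move=> q0; rewrite sqrtr_gt0 divr_gt0// mulr_gt0// pi_gt0. Qed.

Lemma scale_le (q : R) : 0 <= q -> scale q <= Num.sqrt q.
Proof.
move=> q0; rewrite ler_sqrt// ler_pdivrMr//; have := @pi_lt4 R.
by move: (pi : R) => P P4; nra.
Qed.

Lemma sqrt_scale (A c q : R) : 0 <= A -> A * (pi * q / 6) = c -> Num.sqrt A * scale q = Num.sqrt c.
Proof. by move=> A0 <-; rewrite /scale -sqrtrM. Qed.

Lemma far_term_le (k : R) : 0 < k -> k < 1 -> exists2 A, 0 <= A &
  forall q, 4 <= q -> k `^ (q / 2 - 1) * scale q <= A / q.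
Proof.
move=> k0 k1; pose d := - ln k.
have d0 : 0 < d by rewrite oppr_gt0 ln_lt0// k0 k1.
exists (64 / d ^+ 2); first by rewrite divr_ge0 ?sqr_ge0.
move=> q q4; have q0 : 0 < q by lra.
have -> : k `^ (q / 2 - 1) = expR (- (d * (q / 2 - 1))).
  by rewrite /powR gt_eqF// /d mulNr opprK mulrC.
(* For q >= 4 the exponent d (q / 2 - 1) is at least d q / 4 = 2 t, and exp (- t) <= 1 / t used
   twice gives 64 / (d q)^2; the remaining factor [scale q] is at most q. *)
pose t := d * q / 8.
have t0 : 0 < t by rewrite /t !mulr_gt0 ?invr_gt0.
have E1 : expR (- (d * (q / 2 - 1))) <= expR (- t) * expR (- t).
  by rewrite -expRD ler_expR /t; nra.
have E2 : expR (- t) <= t^-1.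
  rewrite expRN lef_pV2 ?posrE ?expR_gt0//; apply: le_trans (expR_ge1Dx t); lra.
have E3 : expR (- t) * expR (- t) <= t^-1 * t^-1 by apply: ler_pM; rewrite ?expR_ge0.
have Sq : scale q <= q.
  apply: le_trans (scale_le (ltW q0)) _; rewrite -[leRHS](ger0_norm (ltW q0)) -sqrtr_sqr ler_sqrt ?sqr_ge0//.
  by rewrite expr2; nra.
apply: (@le_trans _ _ (t^-1 * t^-1 * q)).
  by apply: ler_pM; rewrite ?expR_ge0 ?(ltW (scale_gt0 q0))//; exact: le_trans E1 E3.
rewrite le_eqVlt; apply/orP; left; apply/eqP; rewrite /t; field.
by rewrite !gt_eqF.
Qed.

Lemma near_term_le (e q : R) : 0 < e -> e < 1 -> 0 < q ->
  Num.sqrt (pi / ((1 - e) * pi ^+ 2 / 12 * (q / 2))) / 2 * scale q <= (1 - e)^-1.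
Proof.
move=> e0 e1 q0; rewrite mulrAC (@sqrt_scale _ (4 / (1 - e))); last 2 first.
- by rewrite divr_ge0 ?pi_ge0// !mulr_ge0 ?exprn_ge0 ?pi_ge0 ?invr_ge0 ?subr_ge0 ?(ltW q0) ?(ltW e1).
- have := @pi_gt0 R; move: (pi : R) => P P0; field.
  by rewrite !gt_eqF//= subr_gt0.
rewrite ler_pdivrMr//; have a0 : 0 < (1 - e)^-1 by rewrite invr_gt0; lra.
have a1 : 1 <= (1 - e)^-1 by rewrite invf_ge1; lra.
move: ((1 - e)^-1) a0 a1 => a a0 a1.
rewrite -[leRHS]ger0_norm; last by rewrite mulr_ge0// ltW.
by rewrite -sqrtr_sqr ler_sqrt ?sqr_ge0//; nra.
Qed.

Lemma sqrt_inv_ge (e : R) : 0 < e -> e < 1 -> 1 - e <= Num.sqrt (1 + e)^-1.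
Proof.
move=> e0 e1; rewrite -[leLHS]ger0_norm; last by lra.
rewrite -sqrtr_sqr ler_sqrt ?invr_ge0; last by lra.
rewrite -[leRHS]mul1r ler_pdivlMr; last by lra.
by rewrite expr2; nra.
Qed.

Lemma sqrt_inv_le1 (e : R) : 0 < e -> Num.sqrt (1 + e)^-1 <= 1.
Proof. by move=> e0; rewrite -[leRHS]sqrtr1 ler_sqrt// invf_le1; lra. Qed.

Lemma sqrt2_le2 : Num.sqrt 2 <= 2 :> R.
Proof. by rewrite -[leRHS]ger0_norm// -sqrtr_sqr ler_sqrt ?sqr_ge0// expr2; lra. Qed.

Lemma scale_M_ge (e q : R) : 0 < e -> e < 1 -> 0 < q ->
  Num.sqrt (pi / ((1 + e) * pi ^+ 2 / 6 * q)) * scale q = Num.sqrt (1 + e)^-1.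
Proof.
move=> e0 e1 q0; apply: sqrt_scale.
  by rewrite divr_ge0 ?pi_ge0// !mulr_ge0 ?exprn_ge0 ?pi_ge0 ?invr_ge0 ?(ltW q0)//; lra.
have := @pi_gt0 R; move: (pi : R) => P P0; field.
by rewrite !gt_eqF//=; lra.
Qed.

Lemma scale_Lambda_ge (e q : R) : 0 < e -> e < 1 -> 0 < q ->
  Num.sqrt (pi / ((1 + e) * pi ^+ 2 / 12 * (q / 2))) / 2 * scale q = Num.sqrt (1 + e)^-1.
Proof.
move=> e0 e1 q0; rewrite mulrAC (@sqrt_scale _ (4 * (1 + e)^-1)); last 2 first.
- by rewrite divr_ge0 ?pi_ge0// !mulr_ge0 ?exprn_ge0 ?pi_ge0 ?invr_ge0 ?(ltW q0)//; lra.
- have := @pi_gt0 R; move: (pi : R) => P P0; field.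
  by rewrite !gt_eqF//=; lra.
rewrite sqrtrM// (_ : 4 = 2 ^+ 2); last by rewrite expr2; lra.
by rewrite sqrtr_sqr ger0_norm//; field.
Qed.

Lemma Mq_ge0 (q : R) : (0 <= M_ q)%E.
Proof.
apply: le_trans (ereal_sup_ubound _); last by exists csinc; [exact: csinc_PW2_sphere|reflexivity].
by apply: integral_ge0 => x _; rewrite lee_fin powR_ge0.
Qed.

Lemma Lambda_ge0 (q : R) : (0 <= Lambda_ q)%E.
Proof. by apply: integral_ge0 => x _; rewrite lee_fin powR_ge0. Qed.

Lemma fine_between (x : \bar R) (l u : R) : (0 <= x)%E -> (l%:E <= x)%E -> (x <= u%:E)%E ->
  l <= fine x /\ fine x <= u.
Proof. by case: x => [r| |]//= _; rewrite !lee_fin. Qed.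

Lemma scaled_le (e : R) : 0 < e -> e < 1 -> exists2 A, 0 <= A & forall q, 4 <= q ->
  (Num.sqrt (pi / ((1 - e) * pi ^+ 2 / 12 * (q / 2))) / 2 + (1 - e ^+ 2 / 24) `^ (q / 2 - 1)) * scale q
  <= (1 - e)^-1 + A / q.
Proof.
move=> e0 e1; have k0 := far_bound_gt0 e0 e1.
have [|A A0 hA] := far_term_le k0; first by rewrite gtrBl divr_gt0// exprn_gt0.
exists A => // q q4; rewrite mulrDl; apply: lerD; last exact: hA.
by apply: near_term_le => //; lra.
Qed.

Lemma scaled_Mq_cvg : fine (M_ q) * scale q @[q --> +oo] --> (1 : R).
Proof.
apply: cvgy1_of_bounds => e e0 e1; have [A A0 hA] := scaled_le e0 e1.
pose c : R := (1 + e) * pi ^+ 2 / 6 * (e / 4) ^+ 2 / 2.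
have c0 : 0 < c by rewrite !mulr_gt0 ?invr_gt0 ?exprn_gt0 ?pi_gt0//; lra.
(* The term 2 / c pays for the Gaussian tail: sqrt 2 exp (- c q) is at most 2 / (c q). *)
exists (A + 2 / c), 4 => q q4 q0.
have q2 : 2 <= q by lra.
have [lo up] := fine_between (Mq_ge0 q) (Mq_ge e0 e1 q2) (Mq_le e0 e1 q2).
have S0 := scale_gt0 q0; have Ac : 0 <= 2 / c by rewrite divr_ge0// ltW.
have E : expR (- ((1 + e) * pi ^+ 2 / 6 * q * (e / 4) ^+ 2 / 2)) <= c^-1 / q.
  rewrite (_ : (1 + e) * pi ^+ 2 / 6 * q * (e / 4) ^+ 2 / 2 = c * q); last by rewrite /c; move: (pi : R) => P; field.
  have cq : 0 < c * q by exact: mulr_gt0.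
  rewrite expRN -invfM lef_pV2 ?posrE ?expR_gt0//; apply: le_trans (expR_ge1Dx _); lra.
split.
- apply: (le_trans _ (ler_wpM2r (ltW S0) lo)).
  rewrite mulrAC scale_M_ge//.
  have := sqrt_inv_ge e0 e1; have := sqrt_inv_le1 e0; have := sqrt2_le2.
  have : 0 <= Num.sqrt 2 :> R by exact: sqrtr_ge0.
  have : 0 <= A / q by rewrite divr_ge0// ltW.
  have -> : (A + 2 / c) / q = A / q + 2 * (c^-1 / q) by rewrite mulrDl !mulrA.
  move: E (expR_ge0 (- ((1 + e) * pi ^+ 2 / 6 * q * (e / 4) ^+ 2 / 2))).
  move: (Num.sqrt 2) (Num.sqrt (1 + e)^-1) (expR _) (A / q) (c^-1 / q) => s T x a b xb x0 a0 s0 s2 T1 Te.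
  have sx : s * x <= 2 * b by nra.
  have : 0 <= s * x by exact: mulr_ge0.
  by move: (s * x) sx => y *; nra.
- apply: le_trans (ler_wpM2r (ltW S0) up) _; apply: le_trans (hA _ q4) _.
  by rewrite lerD2l ler_wpM2r ?invr_ge0 ?(ltW q0)// lerDl.
Qed.

Lemma scaled_Lambda_cvg : fine (Lambda_ q) * scale q @[q --> +oo] --> (1 : R).
Proof.
apply: cvgy1_of_bounds => e e0 e1; have [A A0 hA] := scaled_le e0 e1.
pose c : R := (1 + e) * pi ^+ 2 / 48.
have c0 : 0 < c by rewrite !mulr_gt0 ?invr_gt0 ?exprn_gt0 ?pi_gt0//; lra.
(* The cut-off is K / sqrt q, which makes the exponent of the Gaussian tail equal to c K^2. The
   choice c K^2 = 2 / e gives exp (- 2 / e) <= e / 2, so that the tail with its factor sqrt 2 is at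
   most e. *)
pose K : R := Num.sqrt (2 / (c * e)).
have K0 : 0 <= K by exact: sqrtr_ge0.
have K2 : c * K ^+ 2 = 2 / e.
  have -> : K ^+ 2 = 2 / (c * e) by rewrite /K sqr_sqrtr// divr_ge0// mulr_ge0 ?ltW.
  by move: (c) c0 => d d0; field; rewrite !gt_eqF.
pose C : R := pi ^+ 4 / 2400 * K ^+ 5.
have P0 : 0 <= pi ^+ 4 :> R by exact: exprn_ge0 (pi_ge0 R).
have C0 : 0 <= C by apply: mulr_ge0; [rewrite divr_ge0 ?ler0n|exact: exprn_ge0].
(* At s0 = K / sqrt q the quintic loss times [scale q] is at most C / q. The threshold for q
   contains (4 K / e)^2 to ensure s0 <= e / 4. *)
exists (A + C), (4 + (4 * K / e) ^+ 2) => q qB q0.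
have q4 : 4 <= q by apply: le_trans qB; rewrite lerDl sqr_ge0.
pose w := Num.sqrt q; have w0 : 0 < w by rewrite sqrtr_gt0.
have qw : q = w ^+ 2 by rewrite sqr_sqrtr// ltW.
pose s0 := K / w.
have s00 : 0 <= s0 by rewrite divr_ge0// ltW.
have s0e : s0 <= e / 4.
  rewrite ler_pdivrMr//; suff : 4 * K / e <= w by rewrite ler_pdivrMr//; lra.
  rewrite -[leLHS]ger0_norm ?divr_ge0 ?mulr_ge0 ?(ltW e0)// -sqrtr_sqr ler_sqrt ?(ltW q0)//.
  by apply: le_trans qB; rewrite lerDr.
have q2 : 2 < q by lra.
have [lo up] := fine_between (Lambda_ge0 q) (Lambda_ge e0 e1 q2 s00 s0e erefl) (Lambda_le e0 e1 (ltW q2)).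
have S0 := scale_gt0 q0.
have Sw : scale q <= w by exact: scale_le (ltW q0).
have E : expR (- ((1 + e) * pi ^+ 2 / 12 * (q / 2) * s0 ^+ 2 / 2)) <= e / 2.
  rewrite (_ : (1 + e) * pi ^+ 2 / 12 * (q / 2) * s0 ^+ 2 / 2 = 2 / e); last first.
    rewrite -K2 /c /s0 qw; move: (pi : R) => P; field; exact: lt0r_neq0.
  rewrite expRN -[leRHS]invrK invf_div lef_pV2 ?posrE ?expR_gt0 ?divr_gt0//.
  by apply: le_trans (expR_ge1Dx _); lra.
have T : q / 2 * (pi ^+ 4 / 1200 * s0 ^+ 5) * scale q <= C / q.
  apply: (@le_trans _ _ (q / 2 * (pi ^+ 4 / 1200 * s0 ^+ 5) * w)).
    apply: ler_wpM2l; last exact: Sw.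
    by apply: mulr_ge0; [rewrite divr_ge0 ?ler0n ?ltW|apply: mulr_ge0; [rewrite divr_ge0 ?ler0n|exact: exprn_ge0]].
  rewrite le_eqVlt; apply/orP; left; apply/eqP; rewrite /C /s0 qw; move: (pi : R) => P; field; exact: lt0r_neq0.
split.
- apply: (le_trans _ (ler_wpM2r (ltW S0) lo)).
  rewrite mulrBl mulrAC scale_Lambda_ge//.
  have := sqrt_inv_ge e0 e1; have := sqrt_inv_le1 e0; have := sqrt2_le2.
  have : 0 <= Num.sqrt 2 :> R by exact: sqrtr_ge0.
  have : 0 <= A / q by rewrite divr_ge0// ltW.
  have -> : (A + C) / q = A / q + C / q by rewrite mulrDl.
  move: T; move: (_ * scale q) => t tc.
  move: E (expR_ge0 (- ((1 + e) * pi ^+ 2 / 12 * (q / 2) * s0 ^+ 2 / 2))).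
  move: tc; move: (Num.sqrt 2) (Num.sqrt (1 + e)^-1) (expR _) (A / q) (C / q) => s U x a b tb xb x0 a0 t0 s2 T1 Te.
  have sx : s * x <= e by nra.
  have : 0 <= s * x by exact: mulr_ge0.
  by move: (s * x) sx => y *; nra.
- apply: le_trans (ler_wpM2r (ltW S0) up) _; apply: le_trans (hA _ q4) _.
  by rewrite lerD2l ler_wpM2r ?invr_ge0 ?(ltW q0)// lerDl.
Qed.

End Limits.

(* If a value in the extended reals were infinite, [fine] would send it to 0;
   the limits being 1, both quantities are eventually finite and nonzero. *)
Theorem mainTheorem3 (R : realType) :
  (fine (Lambda_ q) / fine (M_ q) @[q --> +oo] --> (1 : R)) /\
  (fine (M_ q) * Num.sqrt (pi * q / 6) @[q --> +oo] --> (1 : R)).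
Proof.
split; last exact: scaled_Mq_cvg.
have h : (fine (Lambda_ q) * scale q) / (fine (M_ q) * scale q) @[q --> +oo] --> (1 / 1 : R).
  by apply: cvgM; [exact: scaled_Lambda_cvg|apply: cvgV; [exact: oner_neq0|exact: scaled_Mq_cvg]].
rewrite divr1 in h; move: h; apply: cvg_trans; apply: near_eq_cvg; near=> q.
have S0 : 0 < scale q by apply: scale_gt0; near: q; exact: nbhs_pinfty_gt.
by rewrite /= invfM mulrACA mulfV ?mulr1// gt_eqF.
Unshelve. all: by end_near. Qed.
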